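(* Let $\mathcal{F}$ be the set of bases of a rank-$k$ linear matroid $\mathcal{M} = (U, \mathcal{I})$ on $|U| = n$ elements, represented by a matrix $V \in \mathbb{R}^{k \times n}$ whose entries have representation size $\mathrm{poly}(n)$. For an unknown integer weight function $w^*$ with $|w^*_e| \le B$ for all $e \in U$, one can sort the bases according to their weight $w^*(S)$, and hence find a minimum-weight basis $\arg\min_{S \in \mathcal{F}} w^*(S)$, in $\mathrm{poly}(n, B)$ time. The number of comparison queries used is $O(nB \log (nB))$, and more generally $O((n + C)\log C)$, where $C = |\{w^*(S) : S \in \mathcal{F}\}|$ is the number of distinct basis weights.
   Context: The independent sets of the linear matroid are the subsets of $U$ whose corresponding columns of $V$ are linearly independent; bases are independent sets of size $k$. $w^*(S) := \sum_{e \in S} w^*_e$. A comparison query takes two bases $S, T \in \mathcal{F}$ and reveals whether $w^*(S) <, =, >$ $w^*(T)$. *)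

(* Defs.v *)
From HB Require Import structures.
From mathcomp Require Import all_boot all_order all_algebra.
From mathcomp Require Import reals.
Set Implicit Arguments.
Unset Strict Implicit.
Unset Printing Implicit Defensive.
Import Order.TTheory GRing.Theory Num.Theory.
Local Open Scope ring_scope.

(* * Model of computation *)

(* A uniform, Turing-complete language of finite programs over binary trees
   with integer leaves, with an oracle instruction and a logarithmic (bit) cost
   measure.  Trees are shared, so building, inspecting or passing a tree takes
   one step; integer arithmetic is charged the product of the bit lengths of
   its operands (schoolbook cost).  Polynomial time in this model coincides
   with polynomial time on Turing machines. *)

Inductive tree := VInt of int | VPair of tree & tree.

Inductive binop := Add | Sub | Mul | Div | Leq.

Inductive expr :=
| Var of nat                 (* de Bruijn index into the environment *)
| Cst of int
| Op of binop & expr & expr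
| MkPair of expr & expr
| Fst of expr
| Snd of expr
| IsPair of expr
| If of expr & expr & expr   (* a nonzero integer counts as true *)
| Let of expr & expr         (* the body sees the value as variable 0 *)
| Call of expr & expr        (* [Call f a]: f sees only variable 0, set to a *)
| Loop of expr & expr        (* [Loop c b]: while c, overwrite variable 0 by b;
                                returns the last value of variable 0 *)
| Query of expr & expr.

Definition bitlen (z : int) : nat := (trunc_log 2 `|z|).+1.

Definition eval_op (o : binop) (x y : int) : int :=
  match o with
  | Add => x + y
  | Sub => x - y
  | Mul => x * y
  | Div => (x %/ y)%Z
  | Leq => (x <= y)%R%:Z
  end.

(* [O a b r]: on the question (a, b) the oracle answers r.  A run that puts to
   the oracle a question without an answer is stuck. *)
Definition oracle := tree -> tree -> int -> Prop.

Definition no_oracle : oracle := fun _ _ _ => False.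

(* [eval O env e v t q]: in the environment env, e evaluates to v in t steps,
   with q oracle queries. *)
Inductive eval (O : oracle) : seq tree -> expr -> tree -> nat -> nat -> Prop :=
| EvVar env i v :
    onth env i = Some v -> eval O env (Var i) v 1 0
| EvCst env z : eval O env (Cst z) (VInt z) 1 0
| EvOp env o e1 e2 x y t1 q1 t2 q2 :
    eval O env e1 (VInt x) t1 q1 -> eval O env e2 (VInt y) t2 q2 ->
    eval O env (Op o e1 e2) (VInt (eval_op o x y))
         (t1 + t2 + bitlen x * bitlen y).+1 (q1 + q2)
| EvPair env e1 e2 v1 v2 t1 q1 t2 q2 :
    eval O env e1 v1 t1 q1 -> eval O env e2 v2 t2 q2 ->
    eval O env (MkPair e1 e2) (VPair v1 v2) (t1 + t2).+1 (q1 + q2)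
| EvFst env e v1 v2 t q :
    eval O env e (VPair v1 v2) t q -> eval O env (Fst e) v1 t.+1 q
| EvSnd env e v1 v2 t q :
    eval O env e (VPair v1 v2) t q -> eval O env (Snd e) v2 t.+1 q
| EvIsPair env e v t q :
    eval O env e v t q ->
    eval O env (IsPair e) (VInt (if v is VPair _ _ then 1 else 0)) t.+1 q
| EvIf env e e1 e2 z v t1 q1 t2 q2 :
    eval O env e (VInt z) t1 q1 ->
    eval O env (if z != 0 then e1 else e2) v t2 q2 ->
    eval O env (If e e1 e2) v (t1 + t2).+1 (q1 + q2)
| EvLet env e1 e2 v1 v2 t1 q1 t2 q2 :
    eval O env e1 v1 t1 q1 -> eval O (v1 :: env) e2 v2 t2 q2 ->
    eval O env (Let e1 e2) v2 (t1 + t2).+1 (q1 + q2)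
| EvCall env f e v1 v2 t1 q1 t2 q2 :
    eval O env e v1 t1 q1 -> eval O [:: v1] f v2 t2 q2 ->
    eval O env (Call f e) v2 (t1 + t2).+1 (q1 + q2)
| EvLoopStop env c b v t q :
    eval O (v :: env) c (VInt 0) t q ->
    eval O (v :: env) (Loop c b) v t.+1 q
| EvLoopStep env c b v v1 v2 z t1 q1 t2 q2 t3 q3 :
    eval O (v :: env) c (VInt z) t1 q1 -> z != 0 ->
    eval O (v :: env) b v1 t2 q2 ->
    eval O (v1 :: env) (Loop c b) v2 t3 q3 ->
    eval O (v :: env) (Loop c b) v2 (t1 + t2 + t3).+1 (q1 + q2 + q3)
| EvQuery env e1 e2 v1 v2 r t1 q1 t2 q2 :
    eval O env e1 v1 t1 q1 -> eval O env e2 v2 t2 q2 -> O v1 v2 r ->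
    eval O env (Query e1 e2) (VInt r) (t1 + t2).+1 (q1 + q2).+1.

Lemma eval_det (O : oracle) :
  (forall a b r r', O a b r -> O a b r' -> r = r') ->
  forall env e v t q, eval O env e v t q ->
  forall v' t' q', eval O env e v' t' q' -> [/\ v = v', t = t' & q = q'].
Proof.
move=> detO env e v t q; elim=> {env e v t q}; intros;
  match goal with H : eval _ _ _ ?v ?t ?q |- [/\ _ = ?v, _ = ?t & _ = ?q] =>
    inversion H; subst; clear H end;
  repeat match goal with
  | IH : forall _ _ _, eval O ?n ?e _ _ _ -> _, H : eval O ?n ?e _ _ _ |- _ =>
      let E := fresh in have [E ? ?] := IH _ _ _ H; clear H;
      try discriminate E; try (injection E as ?); subst
  end; try by [];
  try by match goal with H : is_true (0 != 0) |- _ => rewrite eqxx in H end.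
- by have [->] : Some v = Some v' by congruence.
- by match goal with H : O _ _ r, H' : O _ _ _ |- _ =>
       rewrite (detO _ _ _ _ H H') end.
Qed.

Fixpoint vsize (v : tree) : nat :=
  match v with
  | VInt z => bitlen z
  | VPair a b => (vsize a + vsize b).+1
  end.

(* The time charged for a run includes writing the result out in full, i.e.
   without sharing. *)
Definition computes (O : oracle) (p : expr) (x y : tree) (t q : nat) : Prop :=
  exists2 t0, eval O [:: x] p y t0 q & (t0 + vsize y <= t)%N.

Definition poly_bounded (f : nat -> nat) : Prop :=
  exists c d : nat, forall m, (f m <= c * m.+1 ^ d)%N.

Definition poly_bounded2 (f : nat -> nat -> nat) : Prop :=
  exists c d : nat, forall m l, (f m l <= c * (m + l).+1 ^ d)%N.

(* * Linear matroids and comparisons of bases *)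

Section Matroid.
Variables (R : realType) (k n : nat) (V : 'M[R]_(k, n)).

Definition indep (S : {set 'I_n}) : bool := free [seq col e V | e <- enum S].

Definition bases : {set {set 'I_n}} := [set S | indep S & #|S| == k].

End Matroid.

Definition weight (n : nat) (w : 'I_n -> int) (S : {set 'I_n}) : int :=
  \sum_(e in S) w e.

Definition num_weights (n : nat) (F : {set {set 'I_n}}) (w : 'I_n -> int) : nat :=
  size (undup [seq weight w T | T in F]).

(* L lists one basis of each weight, by increasing weight. *)
Definition sorted_reps (n : nat) (F : {set {set 'I_n}}) (w : 'I_n -> int)
    (L : seq {set 'I_n}) : Prop :=
  [/\ {subset L <= F},
      sorted <%R [seq weight w T | T <- L] &
      forall T, T \in F -> weight w T \in [seq weight w T | T <- L]].

(* * Encodings *)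

Definition vlist (s : seq tree) : tree := foldr VPair (VInt 0) s.

Definition enc_set (n : nat) (S : {set 'I_n}) : tree :=
  vlist [seq VInt (e \in S)%:Z | e <- enum 'I_n].

Definition enc_rat (x : rat) : tree := VPair (VInt (numq x)) (VInt (denq x)).

Definition rat_size (x : rat) : nat := (bitlen (numq x) + bitlen (denq x))%N.

Definition enc_mx (k n : nat) (A : 'M[rat]_(k, n)) : tree :=
  VPair (VInt n) (VPair (VInt k)
    (vlist [seq vlist [seq enc_rat (A i j) | j <- enum 'I_n] | i <- enum 'I_k])).

(* Only pairs of feasible sets may be compared; the answer is -1, 0 or 1
   according to whether w(S) <, =, > w(T). *)
Definition comparison (n : nat) (F : {set {set 'I_n}}) (w : 'I_n -> int) : oracle :=
  fun a b r => exists S T : {set 'I_n},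
    [/\ S \in F, T \in F, a = enc_set S, b = enc_set T &
        r = Num.sg (weight w S - weight w T)].

(* The explicit form of q = O((n + C) log C) and q = O(nB log(nB)).
   - log C is read as log(C + 1): for C >= 2 they agree up to a constant factor,
     and for C = 1 no bound O((n + C) * 0) is possible, since up to n - 1 queries
     are needed to discover that all bases have the same weight.
   - The bound in B presupposes B >= 1, as log(nB) does. *)
Definition query_bound (c n B C q : nat) : Prop :=
  (q <= c * ((n + C) * trunc_log 2 C.+1))%N /\
  ((0 < B)%N -> (q <= c * (n * B * trunc_log 2 (n * B)))%N).

(* Main.v *)
Require Import Defs.
From mathcomp Require Import all_boot all_order all_algebra all_fingroup.
From mathcomp Require Import reals zify ring lra.
Import Order.TTheory GRing.Theory Num.Theory.
Local Open Scope ring_scope.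

(* The program maintains representatives T_1 < ... < T_c of the basis weights
   found so far, together with linearly independent equations w . d = 0, where d
   is a difference of indicator vectors of bases known to have equal weight.
   Two bases are known to be equivalent when their difference is orthogonal to
   the projection P onto the complement of the span of the d's; reading the
   entries of P in a large radix turns this into the equality of two integer
   keys.  Each round finds a basis S whose key is new and locates it among the
   T_i by binary search: either S is a new representative, or it gives a new
   independent equation.  Hence there are at most n + C rounds, each with
   O(log C) queries, and no query is needed before a second key has been seen.

   S is found without queries.  A small modulus p keeps the key of S apart from
   the keys of the T_i, because an integer with few bits is not divisible by all
   small p.  Whether the columns in U contain a basis whose reduced key sum is s
   is read off one digit of det(1 + Z A^T A Z), where Z holds powers of a large
   radix X: by Cauchy-Binet the digits of this integer in base X^2 are
   nonnegative combinations of squared minors.  Deleting elements of U one by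
   one then isolates a basis.

   Both the projection and this determinant are updated by the fraction-free
   rank-one formula Q' = (g' Q - v v^T) / g, in which all divisions are exact:
   for the determinant Q = adj(H) and g = det(H), for the projection
   Q = g - D^T adj(D D^T) D and g = det(D D^T). *)

Set Implicit Arguments.
Unset Strict Implicit.
Unset Printing Implicit Defensive.

(** * Polynomial bounds and runs of programs *)

(** The bases are exponentially many, so equivalence has to be decided by an integer that is
    additive over the elements: only then does the search for an unseen class become the search for
    a basis of prescribed sum. Such keys have about n^3 bits and cannot serve as exponents; reduced
    modulo p they can. No good p is known in advance, so all p up to [pmax] and all sums s up to n p
    are tried, and the full key of each basis found is compared with the known ones; failure for all
    of them certifies that no unseen key is left. Bit sizes stay polynomial because a Gram
    determinant grows by a factor of at most n^2 with each equation and bounds all entries of its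
    projection. Equal keys force equal weights, so the final keys rank any basis without the oracle.
    The bound n B log(n B) is 0 for n B = 1, hence an instance with a single basis has to be solved
    without any query: this holds because a query always compares a basis with a new key to a
    representative. *)

Lemma leq_addSS a b c d : (a <= c -> b <= d -> (a + b).+1 <= (c + d).+1)%N.
Proof. by move=> h1 h2; rewrite ltnS leq_add. Qed.

Section PolyBounded.
Local Open Scope nat_scope.

Lemma poly_bounded_const c : poly_bounded (fun=> c).
Proof. by exists c, 0 => m; rewrite expn0 muln1. Qed.

Lemma poly_bounded_id : poly_bounded id.
Proof. by exists 1, 1 => m; rewrite mul1n expn1. Qed.

Lemma poly_boundedD f g :
  poly_bounded f -> poly_bounded g -> poly_bounded (fun m => f m + g m).
Proof.
move=> [c [d fP]] [c' [d' gP]]; exists (c + c'), (d + d') => m.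
rewrite mulnDl leq_add //.
  by rewrite (leq_trans (fP m)) // leq_mul // leq_pexp2l // leq_addr.
by rewrite (leq_trans (gP m)) // leq_mul // leq_pexp2l // leq_addl.
Qed.

Lemma poly_boundedM f g :
  poly_bounded f -> poly_bounded g -> poly_bounded (fun m => f m * g m).
Proof.
move=> [c [d fP]] [c' [d' gP]]; exists (c * c'), (d + d') => m.
by rewrite expnD mulnACA leq_mul.
Qed.

Lemma poly_boundedS f : poly_bounded f -> poly_bounded (fun m => (f m).+1).
Proof.
move=> pf; have [c [d h]] := poly_boundedD pf (poly_bounded_const 1).
by exists c, d => m; rewrite -addn1.
Qed.

Lemma poly_boundedX f d :
  poly_bounded f -> poly_bounded (fun m => f m ^ d).
Proof.
move=> pf; elim: d => [|d IH]; first exact: poly_bounded_const.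
have [c [e h]] := poly_boundedM pf IH.
by exists c, e => m; rewrite expnS.
Qed.

Lemma poly_bounded_comp f g :
  poly_bounded f -> poly_bounded g -> poly_bounded (fun m => f (g m)).
Proof.
move=> [c [d fP]] pg.
have [c' [d' h]] := poly_boundedM (poly_bounded_const c)
   (poly_boundedX d (poly_boundedS pg)).
by exists c', d' => m; rewrite (leq_trans (fP _)).
Qed.

End PolyBounded.

Ltac poly :=
  solve [repeat (first [exact: poly_bounded_const | exact: poly_bounded_id
    | assumption | apply: poly_boundedS | apply: poly_boundedD
    | apply: poly_boundedM | apply: poly_boundedX
    | match goal with
      | H : forall f, poly_bounded f -> poly_bounded (fun m => ?c (f m) m)
        |- poly_bounded (fun m => ?c (@?f m) m) => apply: (H f)
      | H : forall f, poly_bounded f -> poly_bounded (fun m => ?c (f m) m)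
        |- poly_bounded (?c ?a) => apply: (H (fun=> a))
      | H : poly_bounded ?f |- poly_bounded (fun m => ?f (@?g m)) =>
        apply: (@poly_bounded_comp f g H)
      end ])].

Notation V0 := (Var 0).
Notation "a ,, b" := (MkPair a b) (at level 61, right associativity).
Notation "a ;; b" := (VPair a b) (at level 61, right associativity).

Notation "x +' y" := (Op Defs.Add x y) (at level 50, left associativity).
Notation "x -' y" := (Op Defs.Sub x y) (at level 50, left associativity).
Notation "x *' y" := (Op Defs.Mul x y) (at level 40, left associativity).
Notation "x /' y" := (Op Defs.Div x y) (at level 40, left associativity).
Notation "x <=' y" := (Op Defs.Leq x y) (at level 55).

(* Programs are functions of variable 0, a right-nested tuple: [hd i] is its
   component i, counted from 0, and [tl i] the rest of it from component i on. *)
Definition tl i e := iter i Snd e.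
Definition hd i e := Fst (iter i Snd e).

Section Run.
Variable O : oracle.

(* Upper bounds on time and number of queries; only the result is exact. *)
Definition run env e v (T Q : nat) : Prop :=
  exists t q, [/\ (t <= T)%N, (q <= Q)%N & eval O env e v t q].

Implicit Types (env : seq tree) (e : expr) (v : tree).

Lemma run_conv env e v T Q v' T' Q' : run env e v T Q ->
  v = v' -> (T <= T')%N -> (Q <= Q')%N -> run env e v' T' Q'.
Proof.
by move=> [t [q [tT qQ h]]] <- TT QQ; exists t, q; split=> //;
  apply: leq_trans; eauto.
Qed.

Lemma run_var env i v : onth env i = Some v -> run env (Var i) v 1 0.
Proof. by move=> h; exists 1%N, 0%N; split=> //; constructor. Qed.

Lemma run_cst env z : run env (Cst z) (VInt z) 1 0.
Proof. by exists 1%N, 0%N; split=> //; constructor. Qed.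

Lemma run_op b env o e1 e2 x y T1 Q1 T2 Q2 :
  run env e1 (VInt x) T1 Q1 -> run env e2 (VInt y) T2 Q2 ->
  (bitlen x <= b)%N -> (bitlen y <= b)%N ->
  run env (Op o e1 e2) (VInt (eval_op o x y)) (T1 + T2 + b * b).+1 (Q1 + Q2).
Proof.
move=> [t1 [q1 [tT1 qQ1 h1]]] [t2 [q2 [tT2 qQ2 h2]]] bx b_y.
exists (t1 + t2 + bitlen x * bitlen y).+1, (q1 + q2)%N; split.
- by rewrite ltnS !leq_add // leq_mul.
- by rewrite leq_add.
by constructor.
Qed.

Lemma run_pair env e1 e2 v1 v2 T1 Q1 T2 Q2 :
  run env e1 v1 T1 Q1 -> run env e2 v2 T2 Q2 ->
  run env (e1,, e2) (v1;; v2) (T1 + T2).+1 (Q1 + Q2).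
Proof.
move=> [t1 [q1 [tT1 qQ1 h1]]] [t2 [q2 [tT2 qQ2 h2]]].
by exists (t1 + t2).+1, (q1 + q2)%N; split; [exact: leq_addSS|exact: leq_add|constructor].
Qed.

Lemma run_fst env e v1 v2 T Q :
  run env e (v1;; v2) T Q -> run env (Fst e) v1 T.+1 Q.
Proof. by move=> [t [q [tT qQ h]]]; exists t.+1, q; split=> //; econstructor; eauto. Qed.

Lemma run_snd env e v1 v2 T Q :
  run env e (v1;; v2) T Q -> run env (Snd e) v2 T.+1 Q.
Proof. by move=> [t [q [tT qQ h]]]; exists t.+1, q; split=> //; econstructor; eauto. Qed.

Lemma run_ispair env e v T Q :
  run env e v T Q ->
  run env (IsPair e) (VInt (if v is VPair _ _ then 1 else 0)) T.+1 Q.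
Proof. by move=> [t [q [tT qQ h]]]; exists t.+1, q; split=> //; econstructor; eauto. Qed.

(** The bound charges both branches, hence does not depend on the outcome of the test; each branch
    may use what the outcome says. *)
Lemma run_if env e e1 e2 z v T1 Q1 T2 Q2 T3 Q3 :
  run env e (VInt z) T1 Q1 ->
  (z != 0 -> run env e1 v T2 Q2) -> (z = 0 -> run env e2 v T3 Q3) ->
  run env (If e e1 e2) v (T1 + (T2 + T3)).+1 (Q1 + (Q2 + Q3)).
Proof.
move=> [t1 [q1 [tT1 qQ1 h1]]] h2 h3; have [z0|z0] := eqVneq z 0.
  have [t [q [tT qQ h]]] := h3 z0.
  exists (t1 + t).+1, (q1 + q)%N; split.
  - by rewrite leq_addSS // (leq_trans tT) // leq_addl.
  - by rewrite leq_add // (leq_trans qQ) // leq_addl.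
  by apply: EvIf h1 _; rewrite z0 eqxx.
have [t [q [tT qQ h]]] := h2 z0.
exists (t1 + t).+1, (q1 + q)%N; split.
- by rewrite leq_addSS // (leq_trans tT) // leq_addr.
- by rewrite leq_add // (leq_trans qQ) // leq_addr.
by apply: EvIf h1 _; rewrite z0.
Qed.

(** Here the outcome is known, so the other branch neither has to run nor is charged. *)
Lemma run_if1 env e e1 e2 z v T1 Q1 T2 Q2 : z != 0 ->
  run env e (VInt z) T1 Q1 -> run env e1 v T2 Q2 ->
  run env (If e e1 e2) v (T1 + T2).+1 (Q1 + Q2).
Proof.
move=> z0 [t1 [q1 [tT1 qQ1 h1]]] [t2 [q2 [tT2 qQ2 h2]]].
exists (t1 + t2).+1, (q1 + q2)%N; split; [exact: leq_addSS|exact: leq_add|].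
by apply: EvIf h1 _; rewrite z0.
Qed.

Lemma run_if0 env e e1 e2 v T1 Q1 T2 Q2 :
  run env e (VInt 0) T1 Q1 -> run env e2 v T2 Q2 ->
  run env (If e e1 e2) v (T1 + T2).+1 (Q1 + Q2).
Proof.
move=> [t1 [q1 [tT1 qQ1 h1]]] [t2 [q2 [tT2 qQ2 h2]]].
exists (t1 + t2).+1, (q1 + q2)%N; split; [exact: leq_addSS|exact: leq_add|].
by apply: EvIf h1 _; rewrite eqxx.
Qed.

Lemma run_let env e1 e2 v1 v2 T1 Q1 T2 Q2 :
  run env e1 v1 T1 Q1 -> run (v1 :: env) e2 v2 T2 Q2 ->
  run env (Let e1 e2) v2 (T1 + T2).+1 (Q1 + Q2).
Proof.
move=> [t1 [q1 [tT1 qQ1 h1]]] [t2 [q2 [tT2 qQ2 h2]]].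
by exists (t1 + t2).+1, (q1 + q2)%N; split; [exact: leq_addSS|exact: leq_add|econstructor; eauto].
Qed.

Lemma run_call env f e v1 v2 T1 Q1 T2 Q2 :
  run env e v1 T1 Q1 -> run [:: v1] f v2 T2 Q2 ->
  run env (Call f e) v2 (T1 + T2).+1 (Q1 + Q2).
Proof.
move=> [t1 [q1 [tT1 qQ1 h1]]] [t2 [q2 [tT2 qQ2 h2]]].
by exists (t1 + t2).+1, (q1 + q2)%N; split; [exact: leq_addSS|exact: leq_add|econstructor; eauto].
Qed.

Lemma run_query env e1 e2 v1 v2 r T1 Q1 T2 Q2 :
  run env e1 v1 T1 Q1 -> run env e2 v2 T2 Q2 -> O v1 v2 r ->
  run env (Query e1 e2) (VInt r) (T1 + T2).+1 (Q1 + Q2).+1.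
Proof.
move=> [t1 [q1 [tT1 qQ1 h1]]] [t2 [q2 [tT2 qQ2 h2]]] r_.
by exists (t1 + t2).+1, (q1 + q2).+1; split; [exact: leq_addSS|exact: leq_addSS|econstructor; eauto].
Qed.

(* [mu] bounds the number of remaining iterations, [Phi] the remaining queries. *)
Lemma run_loop (St : Type) (enc : St -> tree) (Inv dn : St -> Prop)
    (mu Phi : St -> nat) env c b Tc Tb :
  (forall s, Inv s ->
     (dn s /\ run (enc s :: env) c (VInt 0) Tc 0) \/
     exists s' z q, [/\ [/\ Inv s', z != 0 & run (enc s :: env) c (VInt z) Tc 0],
        (mu s' < mu s)%N, (q + Phi s' <= Phi s)%N &
        run (enc s :: env) b (enc s') Tb q]) ->
  forall s, Inv s -> exists s',
    [/\ Inv s', dn s' &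
     run (enc s :: env) (Loop c b) (enc s') ((mu s).+1 * (Tc + Tb).+1) (Phi s)].
Proof.
move=> step s; move: {2}(mu s).+1 (ltnSn (mu s)) => N.
elim: N s => // N IH s sN Is.
case: (step s Is) => [[ds rc]|[s' [z [q' [[Is' z0 rc] lt_mu lePhi rb]]]]].
  exists s; split=> //; have [t [q [tT qQ h]]] := rc.
  exists t.+1, q; split; last by constructor.
    by rewrite mulSn (leq_trans _ (leq_addr _ _)) // ltnS (leq_trans tT) // leq_addr.
  by rewrite (leq_trans qQ).
have [|s2 [I2 d2 r2]] := IH s' _ Is'.
  exact: leq_trans lt_mu _.
exists s2; split=> //.
have [t1 [q1 [tT1 qQ1 h1]]] := rc; have [t2 [q2 [tT2 qQ2 h2]]] := rb.
have [t3 [q3 [tT3 qQ3 h3]]] := r2.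
exists (t1 + t2 + t3).+1, (q1 + q2 + q3)%N; split.
- rewrite mulSn addSn ltnS !leq_add // (leq_trans tT3) //.
  by rewrite leq_mul2r orbC lt_mu.
- by rewrite (leq_trans _ lePhi) // leq_add //; move: qQ1; rewrite leqn0 => /eqP->.
by apply: EvLoopStep h1 _ h2 h3.
Qed.

End Run.

Global Opaque run.

Ltac step := match goal with
 | |- run _ _ (Var _) _ _ _ => eapply run_var; reflexivity
 | |- run _ _ (Cst _) _ _ _ => apply run_cst
 | |- run _ _ (_,, _) _ _ _ => eapply run_pair
 | |- run _ _ (Fst _) _ _ _ => eapply run_fst
 | |- run _ _ (Snd _) _ _ _ => eapply run_snd
 | |- run _ _ (IsPair _) _ _ _ => eapply run_ispair
 | |- run _ _ (Op _ _ _) _ _ _ => eapply run_op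
 | |- run _ _ (Let _ _) _ _ _ => eapply run_let
 | |- run _ _ (Call _ _) _ _ _ => eapply run_call
 | |- run _ _ (If _ _ _) _ _ _ => eapply run_if
 end.
Ltac steps := repeat step.

Definition Fold (body : expr) : expr :=
  Fst (Snd (Loop (IsPair (hd 0 V0))
    (Snd (hd 0 V0),, Call body (Fst (hd 0 V0),, Snd V0),, tl 2 V0))).

(* [F s1] encodes the accumulator after the prefix [s1] of [s]. *)
Lemma Fold_run O (T : Type) (E : T -> tree) (F : seq T -> tree) ctx body cb m
    (s : seq T) :
  (forall s1 x s2, s = s1 ++ x :: s2 ->
     run O [:: E x;; F s1;; ctx] body (F (rcons s1 x)) cb 0) ->
  (size s <= m)%N ->
  run O [:: vlist (map E s);; F [::];; ctx] (Fold body) (F s)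
    (m.+1 * (cb + 50)) 0.
Proof.
move=> hb sm.
(* A state splits the list into the consumed prefix, which determines the accumulator, and the rest,
   which is still to be read. *)
pose St := (seq T * seq T)%type.
pose enc (st : St) := vlist (map E st.2);; F st.1;; ctx.
have step_ (st : St) : st.1 ++ st.2 = s ->
    (st.2 = [::] /\ run O [:: enc st] (IsPair (hd 0 V0)) (VInt 0) 4 0) \/
    exists (st' : St) z q, [/\ [/\ st'.1 ++ st'.2 = s, z != 0 &
       run O [:: enc st] (IsPair (hd 0 V0)) (VInt z) 4 0],
       (size st'.2 < size st.2)%N, (q + 0 <= 0)%N &
       run O [:: enc st] (Snd (hd 0 V0),, Call body (Fst (hd 0 V0),, Snd V0),, tl 2 V0)
         (enc st') (cb + 20) q].
  case: st => s1 [|x s2] /= es; [left; split=> //|right].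
    by apply: run_conv; first by rewrite /hd /=; steps.
  exists (rcons s1 x, s2), 1, 0%N; split=> //=.
    split=> //; first by rewrite cat_rcons.
    by apply: run_conv; first by rewrite /hd /=; steps.
  rewrite /hd /tl /=; apply: run_conv.
  - by steps; apply: (hb s1 x s2).
  - by [].
  - by rewrite !addSn !addnS; lia.
  - by [].
have [s' [I' e2 h2]] := run_loop step_ (erefl : ([::], s).1 ++ ([::], s).2 = s).
rewrite e2 cats0 in I'.
rewrite /Fold; apply: run_conv; first by do 2! step; rewrite /enc e2 I' in h2; exact: h2.
- by [].
- rewrite /=; nia.
- by [].
Qed.

(** Sizes are tracked by powers of two instead of by [bitlen]: the size of a product is then the sum
    of the sizes and a sum costs one more bit, so the budget of a composite computation can simply
    be added up. *)
Definition sm (b : nat) (x : int) : bool := (`|x| < 2 ^ b)%N.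

Lemma bitlen_sm b x : sm b x -> (bitlen x <= b.+1)%N.
Proof.
rewrite /sm /bitlen ltnS; have [->|x0] := posnP `|x|%N; first by rewrite trunc_log0.
by move=> h; apply: ltnW; rewrite -(ltn_exp2l _ _ (isT : 1 < 2)%N) (leq_ltn_trans _ h) //
  trunc_logP.
Qed.

Lemma sm_bitlen b x : (bitlen x <= b)%N -> sm b x.
Proof.
rewrite /sm /bitlen => h; apply: leq_trans (_ : 2 ^ (trunc_log 2 `|x|).+1 <= _)%N.
  exact: trunc_log_ltn.
by rewrite leq_exp2l.
Qed.

Lemma smW a b x : sm a x -> (a <= b)%N -> sm b x.
Proof. by rewrite /sm => h ab; rewrite (leq_trans h) // leq_exp2l. Qed.

Lemma smD a b x y : sm a x -> sm a y -> (a < b)%N -> sm b (x + y).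
Proof.
rewrite /sm => hx hy ab; have: (2 ^ a.+1 <= 2 ^ b)%N by rewrite leq_exp2l.
rewrite expnS; lia.
Qed.

Lemma smN a x : sm a (- x) = sm a x.
Proof. by rewrite /sm abszN. Qed.

Lemma smB a b x y : sm a x -> sm a y -> (a < b)%N -> sm b (x - y).
Proof. by move=> hx hy; apply: smD; rewrite ?smN. Qed.

Lemma smM a c b x y : sm a x -> sm c y -> (a + c <= b)%N -> sm b (x * y).
Proof.
rewrite /sm => hx hy ab; rewrite abszM.
apply: leq_trans (_ : 2 ^ (a + c) <= _)%N; last by rewrite leq_exp2l.
rewrite expnD; nia.
Qed.

Lemma sm_div a x y : sm a x -> sm a (x %/ y)%Z.
Proof. by rewrite /sm => h; by apply: leq_ltn_trans h; apply: lez_div. Qed.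

Lemma sm_nat b n : (n <= b)%N -> sm b n.
Proof. by rewrite /sm absz_nat => h; apply: leq_ltn_trans h _; apply: ltn_expl. Qed.

Lemma smX a b x e : sm a x -> (0 < b)%N -> (a * e <= b)%N -> sm b (x ^+ e).
Proof.
move=> hx b0 ab; rewrite /sm abszX; case: e ab => [|e] ab.
  by rewrite expn0 -{1}(expn0 2) ltn_exp2l.
rewrite (@leq_trans ((2 ^ a) ^ e.+1)%N) //; first by rewrite ltn_exp2r.
by rewrite -expnM leq_exp2l.
Qed.

Lemma sm_sum a b (T : Type) (s : seq T) (f : T -> int) :
  (forall x, sm a (f x)) -> (a + size s <= b)%N -> sm b (\sum_(x <- s) f x).
Proof.
move=> hf; rewrite /sm => ab.
suff h : (absz (\sum_(x <- s) f x)%R <= size s * 2 ^ a)%N.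
  apply: leq_ltn_trans h _; apply: leq_trans (_ : 2 ^ (a + size s) <= _)%N; last first.
    by rewrite leq_exp2l.
  by rewrite expnD mulnC ltn_pmul2l ?expn_gt0 // ltn_expl.
elim: s {ab} => [|x s IH]; first by rewrite big_nil.
rewrite big_cons /= mulSn; have := hf x; rewrite /sm => hx.
have tri (u v : int) : (absz (u + v)%R <= `|u| + `|v|)%N by lia.
by apply: leq_trans (leq_add (ltnW hx) IH); apply: tri.
Qed.

Lemma sm_bool b (c : bool) : (0 < b)%N -> sm b c%:Z.
Proof. by move=> b0; apply: sm_nat; case: c. Qed.

(** A common size [b] for both operands makes the charge a function of [b] alone, which suits bounds
    that are uniform in the inputs. *)
Lemma run_ops b O env o e1 e2 x y T1 Q1 T2 Q2 :
  run O env e1 (VInt x) T1 Q1 -> run O env e2 (VInt y) T2 Q2 ->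
  sm b x -> sm b y ->
  run O env (Op o e1 e2) (VInt (eval_op o x y))
    (T1 + T2 + b.+1 * b.+1).+1 (Q1 + Q2).
Proof. by move=> h1 h2 sx sy; apply: run_op => //; apply: bitlen_sm. Qed.

Ltac stepsb b := repeat (first
  [ match goal with |- run _ _ (Op _ _ _) _ _ _ => eapply (@run_ops b) end
  | step ]).

Lemma split_cat (T : Type) (s s1 s2 : seq T) x : s = s1 ++ x :: s2 ->
  [/\ drop (size s1) s = x :: s2, drop (size s1).+1 s = s2 & (size s1 < size s)%N].
Proof.
move=> ->; rewrite drop_size_cat // -cat_rcons drop_size_cat ?size_rcons //.
by rewrite size_cat size_rcons leq_addr.
Qed.

Definition SUM := Fold (hd 0 V0 +' hd 1 V0).

Lemma SUM_run : exists2 c, poly_bounded c &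
  forall O a b (T : Type) (s : seq T) (f : T -> int),
  (forall x, sm a (f x)) -> (a + size s <= b)%N ->
  run O [:: vlist [seq VInt (f x) | x <- s];; VInt 0;; VInt 0] SUM
    (VInt (\sum_(x <- s) f x)) (c b) 0.
Proof.
(* The bound is an existential variable that may depend on [b] only: the rules add up the cost,
   [exact: leqnn] takes this sum as the bound, and [poly] checks it at the end. Most lemmas about
   programs below follow this scheme. *)
eexists; last first.
  move=> O a b T s f hf ab.
  apply: run_conv.
  - have := @Fold_run O T (fun x => VInt (f x))
      (fun s1 => VInt (\sum_(x <- s1) f x)) (VInt 0) (hd 0 V0 +' hd 1 V0).
    rewrite big_nil; apply; last by apply: leq_trans ab; apply: leq_addl.
    move=> s1 x s2 es; apply: run_conv.
    + rewrite /hd /=; stepsb b.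
        by apply: smW (hf x) _; apply: leq_trans ab; apply: leq_addr.
      apply: (sm_sum hf); apply: leq_trans ab.
      by rewrite leq_add2l ltnW //; case: (split_cat es).
    + by rewrite /= -cats1 big_cat big_seq1 addrC.
    + exact: leqnn.
    + by [].
  - by [].
  - exact: leqnn.
  - by [].
by rewrite /=; poly.
Qed.

Definition RevApp := Fold (hd 0 V0,, hd 1 V0).

Lemma RevApp_run : exists2 c, poly_bounded c &
  forall O b (T : Type) (s s' : seq T) (E : T -> tree) ctx,
  (size s <= b)%N ->
  run O [:: vlist (map E s);; vlist (map E s');; ctx] RevApp
    (vlist (map E (rev s ++ s'))) (c b) 0.
Proof.
eexists; last first.
  move=> O b T s s' E ctx sb.
  apply: run_conv.
  - eapply (@Fold_run O T E (fun s1 => vlist (map E (rev s1 ++ s'))) ctx); last exact: sb.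
    move=> s1 x s2 _; apply: run_conv.
    + by rewrite /hd /=; steps.
    + by rewrite rev_rcons.
    + exact: leqnn.
    + by [].
  - by [].
  - exact: leqnn.
  - by [].
by rewrite /=; poly.
Qed.

Definition Map2 body := Call RevApp (Snd (Call
  (Fold (Snd (Fst (hd 1 V0)),,
     (Call body (hd 0 V0,, Fst (Fst (hd 1 V0)),, tl 2 V0),, Snd (hd 1 V0))))
  (hd 0 V0,, (hd 1 V0,, Cst 0),, tl 2 V0)),, Cst 0,, Cst 0).

(** The cost of the body is a parameter of the bound, because it is itself known only through a
    bound in [b]; polynomiality is stated after substituting such a bound. *)
Lemma Map2_run : exists2 c : nat -> nat -> nat,
  (forall f, poly_bounded f -> poly_bounded (fun m => c (f m) m)) &
  forall O b cb (T : eqType) (s : seq T) (E1 E2 E3 : T -> tree) body ctx,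
  (forall x, x \in s -> run O [:: E1 x;; E2 x;; ctx] body (E3 x) cb 0) ->
  (size s <= b)%N ->
  run O [:: vlist (map E1 s);; vlist (map E2 s);; ctx] (Map2 body)
    (vlist (map E3 s)) (c cb b) 0.
Proof.
have [cr pr Hr] := RevApp_run.
eexists; last first.
  move=> O b cb T s E1 E2 E3 body ctx hb sb.
  apply: run_conv.
  - rewrite /Map2 /hd /tl /=; steps.
      (* The accumulator pairs the unread rest of the second list with the results so far in reverse
         order. *)
      have := @Fold_run O T E1 (fun s1 => vlist (map E2 (drop (size s1) s));;
        vlist (map E3 (rev s1))) ctx.
      rewrite drop0; apply; last exact: sb.
      move=> s1 x s2 es; have [d1 d2 ss] := split_cat es.
      rewrite d1 size_rcons d2 rev_rcons; apply: run_conv.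
      + steps; apply: hb.
        by rewrite es mem_cat inE eqxx orbT.
      + by [].
      + exact: leqnn.
      + by [].
    apply: (Hr O b T (rev s) [::] E3).
    by rewrite size_rev.
  - by rewrite revK cats0.
  - exact: leqnn.
  - by [].
by move=> f pf; rewrite /=; poly.
Qed.

Definition IOTA := Snd (Call (Loop (hd 0 V0)
   (Let (hd 0 V0 -' Cst 1) (V0,, V0,, Snd (Var 1)))) (V0,, Cst 0)).

Lemma IOTA_run : exists2 c, poly_bounded c &
  forall O b (n : nat), (n <= b)%N ->
  run O [:: VInt n] IOTA (vlist [seq VInt (i : nat) | i <- iota 0 n]) (c b) 0.
Proof.
eexists; last first.
  move=> O b n nb.
  pose enc (j : nat) := VInt j;; vlist [seq VInt (i : nat) | i <- iota j (n - j)].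
  have [||s' [I' d' r']] := @run_loop O nat enc (fun j => j <= n)%N (fun j => j = 0%N)
    id (fun=> 0%N) [::] (hd 0 V0)
    (Let (hd 0 V0 -' Cst 1) (V0,, V0,, Snd (Var 1))) 10
    (b.+2 * b.+2 + 20)%N _ n.
  - move=> [|j] jn; [left; split=> //|right].
      by apply: run_conv; first by rewrite /hd /=; steps.
    exists j, j.+1%:Z, 0%N; split=> //.
      split=> //; first exact: ltnW.
      by apply: run_conv; first by rewrite /hd /=; steps.
    apply: run_conv.
    + rewrite /hd /=; stepsb b.+1.
        by apply: sm_nat; lia.
      exact: sm_nat.
    + have -> : eval_op Defs.Sub j.+1 1 = j by rewrite /=; lia.
      by rewrite /enc; have -> : (n - j = (n - j.+1).+1)%N by lia.
    + by lia.
    + by [].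
  - exact: leqnn.
  have h : (n.+1 * (10 + (b.+2 * b.+2 + 20)).+1 <=
      b.+1 * (10 + (b.+2 * b.+2 + 20)).+1)%N by rewrite leq_mul2r ltnS nb orbT.
  rewrite d' in r'; have r := run_conv r' erefl h (leqnn _).
  apply: run_conv.
  - rewrite /IOTA; steps.
    by move: r; rewrite /enc subnn subn0; apply.
  - by [].
  - exact: leqnn.
  - by [].
by rewrite /=; poly.
Qed.

(** * Integer arithmetic and lists *)

(** Goals with open variables are refused, since closing one of them could fix an operand that
    another step has to determine. *)
Ltac sma := match goal with |- ?G => tryif has_evar G then fail else idtac end;
  solve [ match goal with
 | H : is_true (sm _ ?x) |- is_true (sm _ ?x) => simple eapply smW; [exact H | first [done | lia]]
 | |- is_true (sm _ (eval_op Defs.Leq _ _)) => apply: sm_bool; lia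
 | H : forall i, is_true (sm _ _) |- _ => simple eapply smW; [simple apply H | first [done | lia]]
 | H : forall i j, is_true (sm _ _) |- _ => simple eapply smW; [simple apply H | first [done | lia]]
 end ].

Definition POW := Call (Fold (hd 1 V0 *' tl 2 V0))
  (Call IOTA (tl 1 V0),, Cst 1,, Fst V0).

Lemma POW_run : exists2 c, poly_bounded c &
  forall O a b x (e : nat), sm a x -> (0 < b)%N -> (e <= b)%N -> (a * e <= b)%N ->
  run O [:: VInt x;; VInt e] POW (VInt (x ^+ e)) (c b) 0.
Proof.
have [ci pi Hi] := IOTA_run.
eexists; last first.
  move=> O a b x e ax b0 eb ab.
  apply: run_conv.
  - rewrite /POW /hd /tl /=; steps; first exact: Hi eb.
    apply: (@Fold_run O nat (fun i => VInt i) (fun s => VInt (x ^+ size s)) (VInt x)).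
      move=> s1 i s2 es; have [_ _] := split_cat es.
      rewrite size_iota => le_s; apply: run_conv.
      + stepsb b.
        * by apply: smX ax b0 _; apply: leq_trans ab; rewrite leq_mul2l ltnW ?orbT.
        * by apply: smW ax _; apply: leq_trans ab; rewrite leq_pmulr // (leq_trans _ le_s).
      + by rewrite /= size_rcons exprSr.
      + exact: leqnn.
      + by [].
    by rewrite size_iota; exact: eb.
  - by rewrite size_iota.
  - exact: leqnn.
  - by [].
by rewrite /=; poly.
Qed.

Definition DOT := Call SUM (Call (Map2 (hd 0 V0 *' hd 1 V0))
  (Fst V0,, tl 1 V0,, Cst 0),, Cst 0,, Cst 0).

Lemma DOT_run : exists2 c, poly_bounded c &
  forall O a a' b (T : eqType) (s : seq T) (f g : T -> int),
  (forall x, sm a (f x)) -> (forall x, sm a' (g x)) -> (a + a' + size s <= b)%N ->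
  run O [:: vlist [seq VInt (f x) | x <- s];; vlist [seq VInt (g x) | x <- s]]
    DOT (VInt (\sum_(x <- s) f x * g x)) (c b) 0.
Proof.
have [cs ps Hs] := SUM_run; have [cm pm Hm] := Map2_run.
eexists; last first.
  move=> O a a' b T s f g hf hg ab.
  apply: run_conv.
  - rewrite /DOT /tl /=; steps.
      apply: (Hm O b _ T s _ _ (fun x => VInt (f x * g x))); last by lia.
      move=> x _; apply: run_conv.
      + by rewrite /hd /=; stepsb b; sma.
      + by [].
      + exact: leqnn.
      + by [].
    apply: (Hs O (a + a')%N b T s) => // x.
    exact: smM (hf x) (hg x) _.
  - by [].
  - exact: leqnn.
  - by [].
by rewrite /=; poly.
Qed.

Definition UPDENT := (hd 3 V0 *' hd 0 V0 -' tl 4 V0 *' hd 1 V0) /' hd 2 V0.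

Definition UPDROW := Call (Map2 UPDENT)
  (hd 0 V0,, tl 4 V0,, (hd 2 V0,, hd 3 V0,, hd 1 V0)).

Definition UPD :=
  Let (Call (Map2 (Call DOT (hd 0 V0,, tl 2 V0))) (tl 3 V0,, tl 3 V0,, hd 1 V0))
 (Let (hd 0 (Var 1) *' hd 2 (Var 1) +' Call DOT (hd 1 (Var 1),, Var 0))
  (Var 0,, Call (Map2 UPDROW)
     (tl 3 (Var 2),, Var 1,, (hd 2 (Var 2),, Var 0,, Var 1)))).

Definition encv n (f : 'I_n -> int) := vlist [seq VInt (f j) | j <- enum 'I_n].

Definition encm k n (A : 'I_k -> 'I_n -> int) := vlist [seq encv (A i) | i <- enum 'I_k].

Definition upd_v n (bv : 'I_n -> int) (Q : 'I_n -> 'I_n -> int) i := \sum_j Q i j * bv j.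

(** The flag separates the two uses: the determinant of H + b^T b is g + b Q b^T, while the Gram
    determinant after adding the row b is b Q b^T alone. *)
Definition upd_g (flag : bool) n (bv : 'I_n -> int) (g : int) (Q : 'I_n -> 'I_n -> int) :=
  flag%:Z * g + \sum_j bv j * upd_v bv Q j.

Definition upd_m (flag : bool) n (bv : 'I_n -> int) (g : int) (Q : 'I_n -> 'I_n -> int) i j :=
  ((upd_g flag bv g Q * Q i j - upd_v bv Q i * upd_v bv Q j) %/ g)%Z.

Lemma sm_sumI a b n (f : 'I_n -> int) :
  (forall x, sm a (f x)) -> (a + n <= b)%N -> sm b (\sum_x f x).
Proof.
by move=> hf ab; rewrite -big_enum /=; apply: (sm_sum hf); rewrite size_enum_ord.
Qed.

Lemma UPD_run : exists2 c, poly_bounded c &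
  forall O a b (flag : bool) n (bv : 'I_n -> int) g Q,
  (forall x, sm a (bv x)) -> sm a g -> (forall i j, sm a (Q i j)) ->
  (4 * a + 2 * n + 10 <= b)%N ->
  run O [:: VInt flag;; encv bv;; VInt g;; encm Q] UPD
    (VInt (upd_g flag bv g Q);; encm (upd_m flag bv g Q)) (c b) 0.
Proof.
have [cd pd Hd] := DOT_run; have [cm pm Hm] := Map2_run.
eexists; last first.
  move=> O a b flag n bv g Q hb hg hQ ab.
  have hv i : sm (2 * a + n) (upd_v bv Q i).
    by apply: (@sm_sumI (a + a)) => [j|]; [exact: smM (hQ _ _) (hb _) _|lia].
  have hbv : sm (3 * a + 2 * n) (\sum_j bv j * upd_v bv Q j).
    by apply: (@sm_sumI (3 * a + n)) => [j|]; [apply: (smM (hb _) (hv _)); lia|lia].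
  have hfg : sm a.+1 (flag%:Z * g) by apply: (@smM 1 a) => //; exact: sm_bool.
  have hg' : sm (3 * a + 2 * n + 2) (upd_g flag bv g Q).
    by apply: (@smD (3 * a + 2 * n + 1)); [sma|sma|lia].
  have sn : (size (enum 'I_n) <= b)%N by rewrite size_enum_ord; lia.
  have hp i j : sm (4 * a + 2 * n + 2) (upd_g flag bv g Q * Q i j).
    by apply: (smM hg' (hQ _ _)); lia.
  have hvv i j : sm (4 * a + 2 * n) (upd_v bv Q i * upd_v bv Q j).
    by apply: (smM (hv _) (hv _)); lia.
  apply: run_conv.
  - rewrite /UPD /hd /tl /=; stepsb b.
    + apply: (Hm O b _ _ (enum 'I_n) (fun i => encv (Q i)) (fun i => encv (Q i))
        (fun i => VInt (upd_v bv Q i))) => // i _.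
      apply: run_conv.
      * steps; apply: (Hd O a a b _ (enum 'I_n) (Q i) bv) => //.
        by rewrite size_enum_ord; lia.
      * by rewrite big_enum.
      * exact: leqnn.
      * by [].
    + by apply: sm_bool; lia.
    + sma.
    + apply: (Hd O a (2 * a + n)%N b _ (enum 'I_n) bv (upd_v bv Q)) => //.
      by rewrite size_enum_ord; lia.
    + sma.
    + by rewrite big_enum; sma.
    + rewrite /= big_enum.
      apply: (Hm O b _ _ (enum 'I_n) (fun i => encv (Q i)) (fun i => VInt (upd_v bv Q i))
        (fun i => encv (upd_m flag bv g Q i))) => // i _.
      apply: run_conv.
      * rewrite /UPDROW /hd /tl /=; steps.
        apply: (Hm O b _ _ (enum 'I_n) (fun j => VInt (Q i j)) (fun j => VInt (upd_v bv Q j))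
          (fun j => VInt (upd_m flag bv g Q i j))) => // j _.
        apply: run_conv.
        - rewrite /UPDENT /hd /tl /=; stepsb b; rewrite -/(upd_g flag bv g Q).
          all: try by rewrite /=; sma.
          by rewrite /=; apply: (@smB (4 * a + 2 * n + 2)); [sma|sma|lia].
        - by [].
        - exact: leqnn.
        - by [].
      * by [].
      * exact: leqnn.
      * by [].
  - by rewrite big_enum.
  - exact: leqnn.
  - by [].
by rewrite /=; poly.
Qed.

(** * Fraction-free rank-one updates *)

Lemma mx11_mulC (R : comNzRingType) m n (A : 'M[R]_(m, 1)) (B : 'M[R]_(1, n)) (c : 'M[R]_1) :
  A *m c *m B = c 0 0 *: (A *m B).
Proof. by rewrite {1}[c]mx11_scalar mul_mx_scalar scalemxAl. Qed.

Section RankOne.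
Variable R : idomainType.

(** Multiplying by a block triangular matrix with diagonal blocks adj G and det G clears the upper
    right block without inverting G. Both sides then carry the factor (det G)^r, which cancels in an
    integral domain. *)
Lemma det_bordered r (G : 'M[R]_r) (B : 'cV_r) (C : 'rV_r) (d : 'M_1) :
  \det G != 0 ->
  \det (block_mx G B C d) = \det G * d 0 0 - (C *m \adj G *m B) 0 0.
Proof.
move=> g0; set g := \det G; set J := \adj G.
have e : block_mx G B C d *m block_mx J (- (J *m B)) 0 (g%:M) =
    block_mx g%:M 0 (C *m J) (g *: d - C *m J *m B).
  rewrite mulmx_block !mulmx0 !addr0 !mulmxN !mulmxA mul_mx_adj -/g.
  by rewrite mul_scalar_mx !mul_mx_scalar addNr addrC.
have := congr1 determinant e; rewrite det_mulmx det_ublock det_lblock det_scalar1.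
have Jg : \det J * g = g ^+ r by rewrite mulrC -det_mulmx mul_mx_adj det_scalar.
rewrite Jg det_scalar mulrC => /(mulfI (expf_neq0 r g0)) ->.
by rewrite [_ - _]mx11_scalar det_scalar1 !mxE.
Qed.

(** The matrix determinant lemma, read off from the matrix with blocks H, b, -c, 1, which is one
    column operation away from a block triangular one. *)
Lemma det_rank1 n (H : 'M[R]_n) (b : 'cV_n) (c : 'rV_n) : \det H != 0 ->
  \det (H + b *m c) = \det H + (c *m \adj H *m b) 0 0.
Proof.
move=> g0; have e : block_mx H b (- c) 1%:M *m block_mx 1%:M 0 c 1%:M =
    block_mx (H + b *m c) b 0 1%:M.
  by rewrite mulmx_block !mulmx1 !mulmx0 !mul1mx add0r addNr add0r.
have := congr1 determinant e.
rewrite det_mulmx det_lblock !det1 !mulr1 det_ublock det1 mulr1 => <-.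
by rewrite det_bordered // !mulNmx [1%:M _ _]mxE mulr1 [X in _ - X]mxE opprK.
Qed.

(** The Sherman-Morrison formula with denominators cleared: the right-hand side times H' is the
    scalar g g', so it remains to multiply by adj H' and cancel g'. Symmetry of H turns b adj H into
    v^T. *)
Lemma adj_rank1 n (H : 'M[R]_n) (b : 'rV_n) :
  H^T = H -> \det H != 0 -> \det (H + b^T *m b) != 0 ->
  let v := \adj H *m b^T in
  \det H *: \adj (H + b^T *m b) = \det (H + b^T *m b) *: \adj H - v *m v^T.
Proof.
move=> Hs g0; set H' := H + _ => g'0 v; set Q := \adj H; set Q' := \adj H'.
set g := \det H; set g' := \det H'.
have Qs : Q^T = Q by rewrite trmx_adj Hs.
have g'E : g' = g + (b *m v) 0 0 by rewrite /g' det_rank1 // mulmxA.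
have vt : v^T = b *m Q by rewrite trmx_mul trmxK Qs.
have vtb : (v^T *m b^T) 0 0 = g' - g by rewrite g'E vt -mulmxA addrAC subrr add0r.
set Y := _ - _; have YH : Y *m H' = (g * g')%:M.
  rewrite mulmxBl -scalemxAl !mulmxDr mul_adj_mx -/g mulmxA -/v.
  rewrite -[v *m v^T *m H]mulmxA {1}vt -[b *m Q *m H]mulmxA mul_adj_mx -/g.
  rewrite mul_mx_scalar -scalemxAr scalerDr scale_scalar_mx.
  rewrite -mulmxA [v^T *m (_ *m _)]mulmxA mulmxA mx11_mulC vtb.
  by rewrite -scalerDl [g + _]addrC subrK addrK mulrC.
have := congr1 (mulmx^~ Q') YH; rewrite /= -mulmxA mul_mx_adj -/g' mul_mx_scalar.
rewrite mul_scalar_mx mulrC -scalerA => h.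
apply/matrixP => i j; have := congr1 (fun A : 'M_n => A i j) h.
by rewrite !mxE => /(mulfI g'0) <-.
Qed.

Definition gproj r n (D : 'M[R]_(r, n)) : 'M[R]_n :=
  (\det (D *m D^T))%:M - D^T *m \adj (D *m D^T) *m D.

Section Proj.
Variables (r n : nat) (D : 'M[R]_(r, n)).
Let G := D *m D^T.
Let g := \det G.
Let P := gproj D.

Lemma gproj_sym : P^T = P.
Proof.
rewrite /P /gproj linearB /= tr_scalar_mx !trmx_mul trmxK trmx_adj.
by rewrite trmx_mul trmxK mulmxA.
Qed.

Lemma mulmx_proj : D *m P = 0.
Proof.
rewrite /P /gproj mulmxBr mul_mx_scalar !mulmxA mul_mx_adj mul_scalar_mx.
exact: subrr.
Qed.

Lemma gproj_tr0 : P *m D^T = 0.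
Proof. by rewrite -[P]trmxK -trmx_mul gproj_sym mulmx_proj trmx0. Qed.

Lemma gproj_sqr : P *m P = g *: P.
Proof.
rewrite {1}/P {1}/gproj mulmxBl mul_scalar_mx -[X in _ - X]mulmxA mulmx_proj.
by rewrite mulmx0 subr0.
Qed.

End Proj.

(** By the bordered determinant. Geometrically, d P d^T is g times the squared distance of d from
    the row space of [D]. *)
Lemma det_gram_rcons r n (D : 'M[R]_(r, n)) (d : 'rV_n) :
  \det (D *m D^T) != 0 ->
  \det (col_mx D d *m (col_mx D d)^T) = (d *m gproj D *m d^T) 0 0.
Proof.
move=> g0; rewrite tr_col_mx mul_col_row det_bordered //.
rewrite /gproj mulmxBr mulmxBl mul_mx_scalar -scalemxAl !mulmxA.
by rewrite [in RHS]mxE [in RHS]mxE [X in _ = _ + X]mxE.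
Qed.

(** With Y the right-hand side, Y P' is computed twice. Expanding Y gives g g' P', since P P' = g P'
    and d P' = 0; expanding P' gives g' Y, since Y kills both blocks of D'^T. Then g' cancels. *)
Lemma proj_rcons r n (D : 'M[R]_(r, n)) (d : 'rV_n) :
  \det (D *m D^T) != 0 -> \det (col_mx D d *m (col_mx D d)^T) != 0 ->
  let v := gproj D *m d^T in
  \det (D *m D^T) *: gproj (col_mx D d) =
  \det (col_mx D d *m (col_mx D d)^T) *: gproj D - v *m v^T.
Proof.
move=> g0 g'0 v; set D' := col_mx D d; set P := gproj D; set P' := gproj D'.
set g := \det _; set g' := \det _.
have /eqP := mulmx_proj D'; rewrite mul_col_mx col_mx_eq0 => /andP[/eqP DP /eqP dP].
have vt : v^T = d *m P by rewrite trmx_mul trmxK gproj_sym.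
have PP : P *m P' = g *: P'.
  by rewrite /P {1}/gproj mulmxBl mul_scalar_mx -[X in _ - X]mulmxA DP mulmx0 subr0.
set Y := _ - _; have YP : Y *m P' = (g' * g) *: P'.
  rewrite mulmxBl -scalemxAl PP -[v *m _ *m _]mulmxA vt -[d *m _ *m _]mulmxA PP.
  by rewrite -scalemxAr dP scaler0 mulmx0 subr0 scalerA.
have YD : Y *m D'^T = 0.
  have vD : v^T *m D^T = 0 by rewrite vt -mulmxA gproj_tr0 mulmx0.
  have vd : v *m v^T *m d^T = g' *: v.
    rewrite -mulmxA [v^T *m _]mx11_scalar mul_mx_scalar; congr (_ *: _).
    by rewrite vt -det_gram_rcons.
  rewrite tr_col_mx mul_mx_row !mulmxBl vd -mulmxA vD mulmx0 -!scalemxAl.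
  by rewrite gproj_tr0 scaler0 !subrr row_mx0.
move: YP; rewrite {1}/P' {1}/gproj mulmxBr mul_mx_scalar -/D' -/g' !mulmxA YD.
rewrite !mul0mx subr0 -scalerA => h.
apply/matrixP => i j; have := congr1 (fun A : 'M_n => A i j) h.
by rewrite !mxE => /(mulfI g'0) <-.
Qed.

End RankOne.

Lemma sum_sqr_gt0 n (v : 'cV[int]_n) : (v^T *m v) 0 0 >= 0 /\
  (v != 0 -> (v^T *m v) 0 0 > 0).
Proof.
have e : (v^T *m v) 0 0 = \sum_i v i 0 ^+ 2.
  by rewrite mxE; apply: eq_bigr => i _; rewrite mxE expr2.
rewrite e; split=> [|v0]; first by apply: sumr_ge0 => i _; apply: sqr_ge0.
rewrite lt_neqAle sumr_ge0 ?andbT => [|i _]; last exact: sqr_ge0.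
rewrite eq_sym psumr_eq0 => [|i _]; last exact: sqr_ge0.
apply: contraNN v0 => /allP h; apply/eqP/matrixP => i j.
by have := h i (mem_index_enum _); rewrite sqrf_eq0 (ord1 j) mxE => /eqP.
Qed.

(** The diagonal comes first: Q_ii^2 <= g Q_ii yields Q_ii <= g, and then Q_ij^2 <= g^2. *)
Lemma le_entries n (Q : 'M[int]_n) (g : int) : 0 < g ->
  (forall i, \sum_j Q i j ^+ 2 <= g * Q i i) -> forall i j, `|Q i j| <= g.
Proof.
move=> g0 h i j.
have le1 j' : Q i j' ^+ 2 <= g * Q i i.
  apply: le_trans (h i); rewrite (bigD1 j') //= lerDl.
  by apply: sumr_ge0 => l _; apply: sqr_ge0.
have := le1 i; have := le1 j; move: (Q i j) (Q i i) => x y; rewrite !expr2 => hx hy.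
have yg : y <= g by nia.
have : x * x <= g * g by nia.
nia.
Qed.

Definition one_bounded n (d : 'rV[int]_n) : Prop := forall j, `|d 0 j| <= 1.

Lemma quad_le n (Q : 'M[int]_n) (d : 'rV_n) (g c : int) :
  0 <= c -> (forall i j, `|Q i j| <= g) -> (forall j, `|d 0 j| <= c) ->
  (d *m Q *m d^T) 0 0 <= (n * n)%:Z * (c * c * g).
Proof.
move=> c0 hQ hd; rewrite mxE.
apply: le_trans (_ : \sum_(i < n) \sum_(j < n) (c * c * g) <= _).
  apply: ler_sum => i _; rewrite !mxE mulr_suml; apply: ler_sum => j _.
  apply: le_trans (ler_norm _) _; rewrite !normrM mulrAC.
  by rewrite !ler_pM ?mulr_ge0.
by rewrite !big_const_ord !iter_addr_0 -mulrnA -mulr_natl natz.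
Qed.

Section ProjInt.
Variables (r n : nat) (D : 'M[int]_(r, n)).
Hypothesis g0 : 0 < \det (D *m D^T).

(** Symmetry and P^2 = g P make the squared norm of row i equal to g P_ii. *)
Lemma gproj_le i j : `|gproj D i j| <= \det (D *m D^T).
Proof.
apply: le_entries => // {}i; rewrite le_eqVlt; apply/orP; left.
have := congr1 (fun A : 'M_n => A i i) (gproj_sqr D); rewrite [RHS]mxE => <-.
apply/eqP; rewrite mxE; apply: eq_bigr => l _.
by have := congr1 (fun A : 'M_n => A i l) (gproj_sym D); rewrite mxE expr2 => ->.
Qed.

(** Again by P^2 = g P, the new determinant d P d^T times g is the squared norm of P d^T. *)
Lemma det_gram_gt0 (d : 'rV_n) : gproj D *m d^T != 0 ->
  0 < \det (col_mx D d *m (col_mx D d)^T).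
Proof.
move=> v0; rewrite det_gram_rcons ?gt_eqF //.
have [_ /(_ v0)] := sum_sqr_gt0 (gproj D *m d^T).
rewrite trmx_mul trmxK gproj_sym mulmxA -[d *m _ *m gproj D]mulmxA gproj_sqr.
by rewrite -scalemxAr -scalemxAl [X in _ < X]mxE pmulr_rgt0.
Qed.

Lemma det_gram_le (d : 'rV_n) : one_bounded d ->
  \det (col_mx D d *m (col_mx D d)^T) <= (n * n)%:Z * \det (D *m D^T).
Proof.
move=> hd; rewrite det_gram_rcons ?gt_eqF //.
by apply: le_trans (quad_le _ gproj_le hd) _; rewrite // !mul1r.
Qed.

(** A nonzero Gram determinant forces rank r over the rationals. This caps the number of equations,
    and so the number of rounds that find no new weight. *)
Lemma gram_rank : (r <= n)%N.
Proof.
have u : map_mx intr D *m (map_mx intr D)^T \in @unitmx rat r.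
  by rewrite unitmxE map_trmx -map_mxM det_map_mx unitfE intr_eq0 gt_eqF.
have := mxrankM_maxl (map_mx intr D : 'M[rat]_(r, n)) (map_mx intr D)^T.
by rewrite (mxrank_unit u) => /leq_trans -> //; apply: rank_leq_col.
Qed.

End ProjInt.

Section Updates.
Variable n : nat.

Lemma upd_vE (Q : 'M[int]_n) (b : 'rV_n) i : upd_v (b 0) Q i = (Q *m b^T) i 0.
Proof. by rewrite mxE; apply: eq_bigr => j _; rewrite mxE. Qed.

Lemma upd_gE flag (Q : 'M[int]_n) (b : 'rV_n) g :
  upd_g flag (b 0) g Q = flag%:Z * g + (b *m Q *m b^T) 0 0.
Proof.
by rewrite /upd_g -mulmxA mxE; congr (_ + _); apply: eq_bigr => j _; rewrite upd_vE.
Qed.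

Lemma upd_mE flag (Q Q' : 'M[int]_n) (b : 'rV_n) g : g != 0 ->
  g *: Q' = upd_g flag (b 0) g Q *: Q - (Q *m b^T) *m (Q *m b^T)^T ->
  forall i j, upd_m flag (b 0) g Q i j = Q' i j.
Proof.
move=> g0 e i j; rewrite /upd_m !upd_vE.
have := congr1 (fun A : 'M_n => A i j) e; rewrite mxE [RHS]mxE [X in _ = X + _]mxE [X in _ = _ + X]mxE mxE big_ord1.
by rewrite [_^T 0 j]mxE => <-; rewrite mulKz.
Qed.

Lemma upd_proj r (D : 'M[int]_(r, n)) (d : 'rV_n) :
  0 < \det (D *m D^T) -> gproj D *m d^T != 0 ->
  let D' := col_mx D d in
  upd_g false (d 0) (\det (D *m D^T)) (gproj D) = \det (D' *m D'^T) /\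
  forall i j, upd_m false (d 0) (\det (D *m D^T)) (gproj D) i j = gproj D' i j.
Proof.
move=> g0 v0 D'; have gE : upd_g false (d 0) (\det (D *m D^T)) (gproj D) = \det (D' *m D'^T).
  by rewrite upd_gE mul0r add0r det_gram_rcons ?gt_eqF.
split=> //; apply: upd_mE; first by rewrite gt_eqF.
by rewrite gE proj_rcons ?gt_eqF // det_gram_gt0.
Qed.

Variables (I : Type) (b : I -> 'rV[int]_n).

(** The identity summand makes every partial sum positive definite, so the update never divides by
    zero, even when the rows are dependent. *)
Definition gram1 (s : seq I) : 'M[int]_n := 1%:M + \sum_(i <- s) (b i)^T *m b i.

Lemma gram1_rcons s i : gram1 (rcons s i) = gram1 s + (b i)^T *m b i.
Proof. by rewrite /gram1 -cats1 big_cat big_seq1 addrA. Qed.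

Lemma gram1_sym s : (gram1 s)^T = gram1 s.
Proof.
rewrite /gram1 linearD /= trmx1 linear_sum /=; congr (_ + _).
by apply: eq_bigr => i _; rewrite trmx_mul trmxK.
Qed.

Lemma gram1_quad s (x : 'rV_n) : (x *m x^T) 0 0 <= (x *m gram1 s *m x^T) 0 0.
Proof.
elim/last_ind: s => [|s i IH]; first by rewrite /gram1 big_nil addr0 mulmx1.
rewrite gram1_rcons mulmxDr mulmxDl [X in _ <= X]mxE (le_trans IH) // lerDl.
rewrite mulmxA -mulmxA; have [+ _] := sum_sqr_gt0 (b i *m x^T).
by rewrite trmx_mul trmxK.
Qed.

(** Apply [gram1_quad] to x = row i of the adjugate Q: the quadratic form at x equals the
    determinant times Q_ii, and the squared norm of x lies below it. *)
Lemma gram1_adj_le s : 0 < \det (gram1 s) ->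
  forall i j, `|\adj (gram1 s) i j| <= \det (gram1 s).
Proof.
move=> g0; apply: le_entries => // i; set Q := \adj _.
have rowE (A : 'M[int]_n) : (row i A *m (row i Q)^T) 0 0 = (A *m Q^T) i i.
  by rewrite !mxE; apply: eq_bigr => j _; rewrite !mxE.
have := gram1_quad s (row i Q); rewrite -[row i Q *m gram1 s]row_mul [Q *m gram1 s]mul_adj_mx !rowE mul_scalar_mx.
rewrite [X in _ <= X]mxE [X in _ <= _ * X]mxE; apply: le_trans; rewrite mxE le_eqVlt.
by apply/orP; left; apply/eqP/eq_bigr => j _; rewrite [_^T _ _]mxE expr2.
Qed.

Lemma gram1_det_gt0 s : 0 < \det (gram1 s).
Proof.
elim/last_ind: s => [|s i IH]; first by rewrite /gram1 big_nil addr0 det1.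
rewrite gram1_rcons det_rank1 ?gt_eqF // ltr_wpDr //.
(* Multiplied by the determinant of H, the increment b adj(H) b^T becomes the quadratic form of H at
   b adj(H), which is nonnegative. *)
rewrite -(pmulr_rge0 _ IH); set Q := \adj _.
have Qs : Q^T = Q by rewrite trmx_adj gram1_sym.
have := gram1_quad s (b i *m Q).
have -> : b i *m Q *m gram1 s = \det (gram1 s) *: b i.
  by rewrite -mulmxA mul_adj_mx mul_mx_scalar.
rewrite -scalemxAl [X in _ <= X]mxE trmx_mul Qs !mulmxA; apply: le_trans.
have [+ _] := sum_sqr_gt0 (b i *m Q)^T.
by rewrite trmxK trmx_mul Qs !mulmxA.
Qed.

Lemma gram1_det_rcons s i (c : int) : 0 <= c -> (forall j, `|b i 0 j| <= c) ->
  \det (gram1 (rcons s i)) <= (1 + (n * n)%:Z * (c * c)) * \det (gram1 s).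
Proof.
move=> c0 hb; rewrite gram1_rcons det_rank1 ?gt_eqF ?gram1_det_gt0 // mulrDl mul1r.
by rewrite lerD2l -mulrA quad_le //; apply: gram1_adj_le; apply: gram1_det_gt0.
Qed.

Lemma upd_gram1 s i :
  upd_g true (b i 0) (\det (gram1 s)) (\adj (gram1 s)) = \det (gram1 (rcons s i)) /\
  forall j l, upd_m true (b i 0) (\det (gram1 s)) (\adj (gram1 s)) j l =
    \adj (gram1 (rcons s i)) j l.
Proof.
have g0 := gram1_det_gt0 s.
have gE : upd_g true (b i 0) (\det (gram1 s)) (\adj (gram1 s)) =
    \det (gram1 (rcons s i)).
  by rewrite upd_gE mul1r gram1_rcons det_rank1 ?gt_eqF.
split=> //; apply: upd_mE; first by rewrite gt_eqF.
rewrite gE gram1_rcons adj_rank1 ?gram1_sym ?gt_eqF //.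
by rewrite -gram1_rcons gram1_det_gt0.
Qed.

End Updates.

(** * Small moduli and a generating function for bases *)

Section NonDivisor.
Local Open Scope nat_scope.

(* Leibniz' harmonic triangle: 1/((k+1) C(n+1,k+1)) = 1/(k C(n,k)) - 1/(k C(n+1,k)). *)
Lemma dvdn_mul_bin (Z k n : nat) : (forall j, 0 < j <= n -> j %| Z) ->
  0 < k <= n -> k * 'C(n, k) %| Z.
Proof.
elim: k n => // k IH n dvd /andP[_ kn]; case: k => [|k] in IH kn *.
  by rewrite mul1n bin1; apply: dvd; rewrite leqnn andbT.
case: n => // n in dvd kn *; rewrite !ltnS in kn.
have /dvdnP[a aE] : k.+1 * 'C(n, k.+1) %| Z.
  by apply: IH => // j /andP[j0 jn]; apply: dvd; rewrite j0 ltnW.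
have /dvdnP[b bE] : k.+1 * 'C(n.+1, k.+1) %| Z.
  by apply: IH => //; apply: ltnW; rewrite ltnS.
rewrite -mul_bin_diag in bE; rewrite -mul_bin_diag.
have e := mul_bin_left n k.
apply/dvdnP; exists (a - b).
have e1 : a * (n.+1 * 'C(n, k.+1)) * k.+1 = n.+1 * Z by rewrite aE; ring.
have e2 : b * (n.+1 * 'C(n, k.+1)) * k.+1 = (n - k) * Z.
  rewrite bE -[LHS]mulnA -[_ * _ * k.+1]mulnA [_ * k.+1]mulnC e; ring.
apply/eqP; rewrite -(eqn_pmul2r (isT : 0 < k.+1)) !mulnBl e1 e2 -mulnBl mulnC.
by apply/eqP; congr (_ * _); lia.
Qed.

(** Vandermonde's convolution: the central coefficient is the sum of ['C(m, i) * 'C(m, m - i)],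
    where the second factors are positive and the first ones sum to 2^m. *)
Lemma exp2_le_bin m : 2 ^ m <= 'C(m + m, m).
Proof.
rewrite -binomial.Vandermonde (_ : 2 ^ m = \sum_(i < m.+1) 'C(m, i)); last first.
  rewrite -[2]/(1 + 1) expnDn; apply: eq_bigr => i _.
  by rewrite !exp1n !muln1.
apply: leq_sum => i _; rewrite leq_pmulr // bin_gt0; exact: leq_subr.
Qed.

(** If all numbers up to 2m divided Z, so would [m * 'C(m + m, m)], which is at least 2^m. In effect
    this bounds lcm(1, ..., 2m) from below, without prime numbers. *)
Lemma small_nondivisor m Z : 0 < Z -> Z < 2 ^ m ->
  exists2 p, 0 < p <= m + m & ~~ (p %| Z).
Proof.
case: m => [|m] Z0 Zm; first by rewrite expn0 in Zm; lia.
have [/existsP[p hp]|/existsPn h] :=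
    boolP [exists p : 'I_(m.+1 + m.+1).+1, (0 < p) && ~~ (p %| Z)].
  by move/andP: hp => [p0 pZ]; exists (p : nat) => //; rewrite p0 -ltnS ltn_ord.
have dvd : m.+1 * 'C(m.+1 + m.+1, m.+1) %| Z.
  apply: dvdn_mul_bin => [j /andP[j0 jm]|]; last by rewrite leq_addr.
  by have := h (inord j); rewrite inordK ?ltnS // j0 /= negbK.
have := dvdn_leq Z0 dvd; rewrite leqNgt (leq_trans Zm) //.
by apply: leq_trans (exp2_le_bin _) _; apply: leq_pmull.
Qed.
End NonDivisor.

(** The digits may have either sign: the lowest one is a multiple of K smaller than K in absolute
    value, hence 0, and the others follow by induction. *)
Lemma radix_eq0 n (K : int) (v : 'I_n -> int) : (forall i, `|v i| < K) ->
  \sum_(i < n) K ^+ i * v i = 0 -> forall i, v i = 0.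
Proof.
elim: n v => [|n IH] v hv; first by move=> _ [].
rewrite big_ord_recl mul1r => e.
have K0 : 0 < K by apply: le_lt_trans (hv ord0).
have e' : \sum_(i < n) K ^+ (lift ord0 i) * v (lift ord0 i) =
    K * \sum_(i < n) K ^+ i * v (lift ord0 i).
  by rewrite mulr_sumr; apply: eq_bigr => i _; rewrite mulrA -exprS.
rewrite e' in e; set s := \sum_(i < n) _ in e.
have v0 : v ord0 = 0.
  move: {e'} s (v ord0) (hv ord0) e => s x hx e.
  have : s = 0 by nia.
  by move=> s0; move: e; rewrite s0 mulr0 addr0.
have s0 : s = 0.
  by move: e; rewrite v0 add0r => /eqP; rewrite mulf_eq0 gt_eqF //= => /eqP.
move=> i; case: (unliftP ord0 i) => [j ->|->]; last exact: v0.
by apply: (IH (fun j => v (lift ord0 j)) _ s0) => l; apply: hv.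
Qed.

Section CauchyBinet.
Variable R : comNzRingType.

Lemma det_mulmx_sum k m (A : 'M[R]_(k, m)) (B : 'M[R]_(m, k)) :
  \det (A *m B) = \sum_(f : {ffun 'I_k -> 'I_m})
    (\prod_i A i (f i)) * \det (rowsub f B).
Proof.
under [RHS]eq_bigr do rewrite mulr_sumr; rewrite exchange_big /=.
apply: eq_bigr => s _; under eq_bigr do rewrite mxE; rewrite bigA_distr_bigA mulr_sumr.
apply: eq_bigr => f _; rewrite mulrCA -big_split /=; congr (_ * _).
by apply: eq_bigr => i _; rewrite mxE.
Qed.

(* Cauchy-Binet, summed over all maps instead of all subsets of columns. *)
Lemma fact_det_mulmx k m (A : 'M[R]_(k, m)) (B : 'M[R]_(m, k)) :
  (k`!)%:R * \det (A *m B) = \sum_(f : {ffun 'I_k -> 'I_m})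
    \det (colsub f A) * \det (rowsub f B).
Proof.
(* Composing the maps f with s produces the term of s in the Leibniz expansion of
   [\det (colsub f A)]; the k! equal expressions are then summed. *)
have detsE (s : 'S_k) : \det (A *m B) = \sum_(f : {ffun 'I_k -> 'I_m})
    ((-1) ^+ s * \prod_i A i (f (s i))) * \det (rowsub f B).
  rewrite det_mulmx_sum.
  rewrite (reindex_onto (fun f : {ffun 'I_k -> 'I_m} => [ffun i => f (s i)])
    (fun f : {ffun 'I_k -> 'I_m} => [ffun i => f ((s^-1)%g i)])) /=; last first.
    by move=> f _; apply/ffunP => i; rewrite !ffunE permK.
  apply: eq_big => [f|f _].
    by rewrite /=; apply/eqP/ffunP => i; rewrite !ffunE permKV.
  rewrite (_ : \prod_i _ = \prod_i A i (f (s i))); last first.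
    by apply: eq_bigr => i _; rewrite ffunE.
  rewrite (_ : rowsub _ B = row_perm s (rowsub f B)); last first.
    by apply/matrixP => i j; rewrite !mxE ffunE.
  by rewrite row_permE det_mulmx det_perm mulrCA mulrA.
have -> : (k`!)%:R * \det (A *m B) = \sum_(s : 'S_k) \det (A *m B).
  by rewrite sumr_const card_Sn mulr_natl.
rewrite (eq_bigr _ (fun s _ => detsE s)) exchange_big /=.
apply: eq_bigr => f _; rewrite -mulr_suml; congr (_ * _).
by apply: eq_bigr => s _; congr (_ * _); apply: eq_bigr => i _; rewrite mxE.
Qed.

End CauchyBinet.

(** Sylvester's identity. It links the k x k form, to which Cauchy-Binet applies, with the n x n
    form, which rank-one updates build row by row. *)
Lemma det_1DmulC (R : comNzRingType) m n (A : 'M[R]_(m, n)) (B : 'M[R]_(n, m)) :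
  \det (1%:M + A *m B) = \det (1%:M + B *m A).
Proof.
have e1 : block_mx 1%:M (- A) B 1%:M *m block_mx 1%:M A 0 1%:M =
    block_mx 1%:M 0 B (1%:M + B *m A).
  by rewrite mulmx_block !mulmx1 !mulmx0 !addr0 !mul1mx addrN addrC.
have e2 : block_mx 1%:M A 0 1%:M *m block_mx 1%:M (- A) B 1%:M =
    block_mx (1%:M + A *m B) 0 B 1%:M.
  by rewrite mulmx_block !mul0mx !mulmx1 !mul1mx !add0r addNr.
have := congr1 determinant e1; have := congr1 determinant e2.
by rewrite !det_mulmx !det_ublock !det_lblock !det1 !mulr1 !mul1r => <- <-.
Qed.

(** The coefficients are the digits of p(b) in base b: the part of p below degree t evaluates to
    less than b^t, so the division leaves the value of [drop_poly t p], whose last digit is the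
    coefficient. *)
Lemma horner_digit (p : {poly int}) (b : int) t : (forall i, 0 <= p`_i < b) ->
  let q := divz p.[b] (b ^+ t) in q - b * divz q b = p`_t.
Proof.
move=> hp; have b0 : 0 < b by have /andP[h] := hp 0%N; apply: le_lt_trans.
have bt0 : 0 < b ^+ t by rewrite exprn_gt0.
have h s : 0 <= (take_poly s p).[b] < b ^+ s.
  elim: s => [|s]; first by rewrite take_poly0l horner0.
  have -> : take_poly s.+1 p = take_poly s p + p`_s *: 'X^s.
    apply/polyP => i; rewrite coefD coefZ coefXn !coef_take_poly ltnS leq_eqVlt.
    by case: ltngtP => // [_|_|->]; rewrite ?mulr0 ?addr0 ?mulr1 ?add0r.
  rewrite hornerD hornerZ hornerXn exprS; move: (hp s) => /andP[c0 cb] /andP[T0 TB].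
  have B0 : 0 < b ^+ s by rewrite exprn_gt0.
  rewrite addr_ge0 /=; [|done|by rewrite mulr_ge0 // ltW].
  have : (p`_s + 1) * b ^+ s <= b * b ^+ s by rewrite ler_pM2r // lezD1.
  by rewrite mulrDl mul1r; apply: lt_le_trans; rewrite [X in X < _]addrC ltrD2l.
have e : p.[b] = (drop_poly t p).[b] * b ^+ t + (take_poly t p).[b].
  by rewrite -{1}(poly_take_drop t p) hornerD hornerM hornerXn addrC.
cbv zeta; have -> : divz p.[b] (b ^+ t) = (drop_poly t p).[b].
  rewrite e divzMDl ?gt_eqF // divz_small ?addr0 //.
  by rewrite gtz0_abs.
have -> : (drop_poly t p).[b] = (drop_poly t.+1 p).[b] * b + p`_t.
  have -> : drop_poly t p = drop_poly t.+1 p * 'X + (p`_t)%:P.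
    apply/polyP => i; rewrite coefD coefMX coefC !coef_drop_poly.
    by case: i => [|i]; rewrite ?add0n ?add0r ?addr0 // addSnnS.
  by rewrite hornerD hornerM hornerX hornerC.
rewrite divzMDl ?gt_eqF // divz_small ?gtz0_abs // addr0; ring.
Qed.

Section GeneratingFunction.
Variables (k n : nat) (A : 'M[int]_(k, n)).

Definition mono (U : {set 'I_n}) (eps : 'I_n -> nat) (e : 'I_n) : {poly int} :=
  if e \in U then 'X^(eps e) else 0.

Definition genf U eps : {poly int} := \det (1%:M +
  (map_mx polyC A *m diag_mx (\row_e mono U eps e)) *m (map_mx polyC A)^T).

(** The unit block absorbs the summand 1: by Cauchy-Binet the terms are squared k-minors of [1 | A],
    and columns from the unit block contribute degree 0. *)
Let W := row_mx 1%:M A.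

Lemma fact_genf U eps : (k`!)%:R * genf U eps =
  \sum_(f : {ffun 'I_k -> 'I_(k + n)}) (\det (colsub f W) ^+ 2)%:P *
    \prod_i (if split (f i) is inr e then mono U eps e else 1).
Proof.
have -> : genf U eps =
    \det (row_mx 1%:M (map_mx polyC A *m diag_mx (\row_e mono U eps e)) *m
          (map_mx polyC W)^T).
  by rewrite /W map_row_mx map_mx1 tr_row_mx trmx1 mul_row_col mulmx1.
rewrite fact_det_mulmx; apply: eq_bigr => f _.
have -> : rowsub f (map_mx polyC W)^T = (map_mx polyC (colsub f W))^T.
  by apply/matrixP => i j; rewrite !mxE.
rewrite det_tr det_map_mx.
set Y := colsub f (row_mx 1%:M (_ *m _)); set y := \row_i (if split (f i) is inr e then mono U eps e else 1).
have -> : Y = map_mx polyC (colsub f W) *m diag_mx y.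
  apply/matrixP => i j; rewrite mul_mx_diag !mxE.
  case: splitP => l _; rewrite ?mulr1.
    by rewrite !mxE rmorph_nat.
  by rewrite mul_mx_diag !mxE.
rewrite det_mulmx det_diag det_map_mx mulrAC -expr2 rmorphXn; congr (_ * _).
by apply: eq_bigr => i _; rewrite mxE.
Qed.

Definition allowed (U : {set 'I_n}) (f : {ffun 'I_k -> 'I_(k + n)}) : bool :=
  [forall i, if split (f i) is inr e then e \in U else true].

Definition expsum (eps : 'I_n -> nat) (f : {ffun 'I_k -> 'I_(k + n)}) : nat :=
  \sum_i (if split (f i) is inr e then eps e else 0%N).

Lemma fact_coef_genf U eps t : (k`!)%:R * (genf U eps)`_t =
  \sum_(f : {ffun 'I_k -> 'I_(k + n)}) \det (colsub f W) ^+ 2 *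
    (allowed U f && (expsum eps f == t))%:R.
Proof.
have := congr1 (fun p : {poly int} => p`_t) (fact_genf U eps).
rewrite mulr_natl coefMn => h; rewrite mulr_natl h coef_sum.
apply: eq_bigr => f _; rewrite coefCM; congr (_ * _).
have [al|] := boolP (allowed U f).
  have -> : \prod_i (if split (f i) is inr e then mono U eps e else 1) =
      'X^(expsum eps f) :> {poly int}.
    rewrite /expsum expr_sum; apply: eq_bigr => i _.
    by move/forallP: al => /(_ i); case: split => // e; rewrite /mono => ->.
  by rewrite coefXn eq_sym.
rewrite negb_forall => /existsP[i hi]; rewrite (bigD1 i) //=.
by move: hi; case: split => // e /negPf; rewrite /mono => ->; rewrite mul0r coef0.
Qed.

(** The squared minors of all maps sum to k! det(1 + A A^T), and k! times a coefficient collects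
    only some of them. *)
Lemma genf_coef_bounds U eps t : 0 <= (genf U eps)`_t <= \det (1%:M + A *m A^T).
Proof.
have k0 : 0 < (k`!)%:R :> int by rewrite ltr0n fact_gt0.
apply/andP; split.
  rewrite -(pmulr_rge0 _ k0) fact_coef_genf.
  by apply: sumr_ge0 => f _; rewrite mulr_ge0 ?sqr_ge0 ?ler0n.
rewrite -(ler_pM2l k0) fact_coef_genf.
have -> : (k`!)%:R * \det (1%:M + A *m A^T) =
    \sum_(f : {ffun 'I_k -> 'I_(k + n)}) \det (colsub f W) ^+ 2.
  have -> : 1%:M + A *m A^T = W *m W^T by rewrite tr_row_mx mul_row_col trmx1 mulmx1.
  rewrite fact_det_mulmx; apply: eq_bigr => f _; rewrite expr2; congr (_ * _).
  by rewrite -det_tr; congr (\det _); apply/matrixP => i j; rewrite !mxE.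
apply: ler_sum => f _; case: (_ && _); first by rewrite mulr1.
by rewrite mulr0 sqr_ge0.
Qed.

(** The offset o counts the columns taken from A: a selection that uses the unit block has exponent
    at most (k - 1) (o + p) < k o, so degree k o + s is reached only by k columns of A whose values
    add up to s. All terms are nonnegative, so one nonzero minor suffices. *)
Lemma genf_coef_neq0 (U : {set 'I_n}) (u : 'I_n -> nat) o p s : (k <= n)%N ->
  (forall e, u e < p)%N -> (n * p < o)%N ->
  reflect (exists2 g : {ffun 'I_k -> 'I_n}, \det (colsub g A) != 0 &
             (forall i, g i \in U) /\ (\sum_i u (g i) = s)%N)
    ((genf U (fun e => o + u e)%N)`_(k * o + s) != 0).
Proof.
move=> kn up npo; pose eps e := (o + u e)%N; rewrite -[fun e => (o + u e)%N]/eps.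
have k0 : (k`!)%:R != 0 :> int by rewrite pnatr_eq0 -lt0n fact_gt0.
rewrite -(mulrI_eq0 _ (mulfI k0)) fact_coef_genf psumr_neq0; last first.
  by move=> f _; rewrite mulr_ge0 ?sqr_ge0 ?ler0n.
have WE (g : {ffun 'I_k -> 'I_n}) (f : {ffun 'I_k -> 'I_(k + n)}) :
    (forall i, f i = rshift k (g i)) -> colsub f W = colsub g A.
  by move=> fg; apply/matrixP => i j; rewrite mxE fg [in RHS]mxE row_mxEr.
apply: (iffP hasP) => [[f _ /=]|[g dg [gU gs]]].
  rewrite lt_neqAle eq_sym mulf_eq0 negb_or => /andP[/andP[]].
  rewrite sqrf_eq0 => dW; case al: (allowed U f) => //=; case: (expsum eps f =P _) => // es _ _.
  have allr i : exists e, f i == rshift k e.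
    case: (splitP (f i)) => [j fj|e fe]; last by exists e; apply/eqP/val_inj.
    exfalso; have : (expsum eps f <= (k - 1) * (o + p))%N.
      rewrite /expsum (bigD1 i) //=.
      have -> : split (f i) = inl j.
        by rewrite -(unsplitK (inl j)) /=; congr split; apply: val_inj.
      rewrite add0n; apply: leq_trans (_ : \sum_(l < k | l != i) (o + p) <= _)%N.
        by apply: leq_sum => l _; case: split => // e; rewrite leq_add2l ltnW.
      rewrite sum_nat_const leq_mul2r; apply/orP; right.
      by rewrite cardC1 card_ord subn1.
    have k1 := ltn_ord i; rewrite es => h.
    have : ((k - 1) * p <= n * p)%N by rewrite leq_mul2r; lia.
    by move: h; rewrite -{1}(subnK (leq_ltn_trans (leq0n _) k1)); nia.
  pose g := [ffun i => xchoose (allr i)].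
  have fg i : f i = rshift k (g i) by rewrite ffunE; apply/eqP; apply: xchooseP (allr i).
  exists g; first by rewrite -(WE g f).
  split=> [i|].
    by move/forallP: al => /(_ i); rewrite fg -/(unsplit (inr _)) unsplitK.
  move: es; rewrite /expsum.
  rewrite (_ : \sum_i _ = \sum_(i < k) (o + u (g i)))%N; last first.
    by apply: eq_bigr => i _; rewrite fg -/(unsplit (inr _)) unsplitK.
  by rewrite big_split sum_nat_const card_ord /= => /addnI.
exists [ffun i => rshift k (g i)]; first exact: mem_index_enum.
rewrite /= (WE g) => [|i]; last by rewrite ffunE.
have -> : allowed U [ffun i => rshift k (g i)].
  by apply/forallP => i; rewrite ffunE -/(unsplit (inr _)) unsplitK.
have -> : expsum eps [ffun i => rshift k (g i)] = (k * o + s)%N.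
  rewrite /expsum -gs (_ : \sum_i _ = \sum_(i < k) (o + u (g i)))%N.
    by rewrite big_split sum_nat_const card_ord.
  by apply: eq_bigr => i _; rewrite ffunE -/(unsplit (inr _)) unsplitK.
by rewrite eqxx mulr1 lt_neqAle eq_sym sqrf_eq0 dg sqr_ge0.
Qed.

End GeneratingFunction.

(** One common factor for the whole matrix: every k-minor is multiplied by the same power of it, so
    the bases do not change. *)
Definition den_prod k n (A : 'M[rat]_(k, n)) : int := \prod_i \prod_j denq (A i j).

Definition int_mx k n (A : 'M[rat]_(k, n)) : 'M[int]_(k, n) :=
  \matrix_(i, j) divz (den_prod A * numq (A i j)) (denq (A i j)).

Lemma den_prod_neq0 k n (A : 'M[rat]_(k, n)) : den_prod A != 0.
Proof.
by apply/prodf_neq0 => i _; apply/prodf_neq0 => j _; apply: denq_neq0.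
Qed.

Lemma int_mxE k n (A : 'M[rat]_(k, n)) :
  map_mx intr (int_mx A) = (den_prod A)%:~R *: A :> 'M[rat]_(k, n).
Proof.
apply/matrixP => i j; rewrite !mxE.
set a := A i j; have [q da] : exists q, den_prod A = denq a * q.
  exists (divz (den_prod A) (denq a)).
  rewrite mulrC divzK // /den_prod (bigD1 i) //= (bigD1 j) //= -mulrA.
  exact: dvdz_mulr.
rewrite da -mulrA mulKz ?denq_neq0 // -[X in _ = _ * X]divq_num_den -/a !rmorphM /=.
have : (denq a)%:~R != 0 :> rat by rewrite intr_eq0 denq_neq0.
move: (denq a)%:~R (numq a)%:~R => d x d0; by field.
Qed.

Lemma free_colsub (K : fieldType) k n (V : 'M[K]_(k, n)) (g : 'I_k -> 'I_n) :
  free [seq col (g i) V | i <- enum 'I_k] = (\det (colsub g V) != 0).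
Proof.
pose X := [tuple col (g i) V | i < k].
have -> : [seq col (g i) V | i <- enum 'I_k] = X by [].
have comb (c : 'I_k -> K) : \sum_i c i *: X`_i = (\row_i c i *m (colsub g V)^T)^T.
  apply/matrixP => i j; rewrite !mxE summxE; apply: eq_bigr => l _.
  by rewrite -tnth_nth tnth_mktuple !mxE.
apply/freeP/idP => [h|d0 c].
  rewrite -det_tr; apply/negP => /det0P[v v0 vM]; move/eqP: v0; apply.
  apply/rowP => i; rewrite mxE; apply: (h (v 0)).
  rewrite comb; have -> : \row_i v 0 i = v by apply/rowP => j; rewrite mxE.
  by rewrite vM trmx0.
rewrite comb -trmx0 => /trmx_inj e i.
have u : (colsub g V)^T \in unitmx by rewrite unitmx_tr unitmxE unitfE.
have := congr1 (fun M => (M *m invmx (colsub g V)^T) 0 i) e.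
by rewrite -mulmxA mulmxV // mulmx1 mul0mx !mxE.
Qed.

Lemma det_colsub_inj (R : comNzRingType) k n (V : 'M[R]_(k, n)) (g : 'I_k -> 'I_n) :
  \det (colsub g V) != 0 -> injective g.
Proof.
move=> d0 i j gij; apply/eqP; apply: contraNT d0 => ij; rewrite -det_tr.
apply/eqP/(determinant_alternate ij) => l; rewrite !mxE gij //.
Qed.

Section Bases.
Variables (R : realType) (k n : nat) (A : 'M[rat]_(k, n)).
Let V : 'M[R]_(k, n) := map_mx ratr A.

Lemma det_colsub_int (g : 'I_k -> 'I_n) :
  (\det (colsub g V) != 0) = (\det (colsub g (int_mx A)) != 0).
Proof.
have -> : colsub g V = map_mx ratr (colsub g A) by apply/matrixP => i j; rewrite !mxE.
rewrite det_map_mx fmorph_eq0 -(intr_eq0 rat) -det_map_mx.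
have -> : map_mx intr (colsub g (int_mx A)) = (den_prod A)%:~R *: colsub g A :> 'M[rat]_k.
  have := int_mxE A => /matrixP e; apply/matrixP => i j.
  by have := e i (g j); rewrite !mxE.
by rewrite detZ mulf_eq0 expf_eq0 intr_eq0 (negPf (den_prod_neq0 A)) andbF.
Qed.

(** Bases are described by maps because the Cauchy-Binet sum runs over maps; a nonzero minor makes
    the map injective, so its image has k elements. *)
Lemma basesP (S : {set 'I_n}) :
  reflect (exists2 g : {ffun 'I_k -> 'I_n}, \det (colsub g (int_mx A)) != 0 &
             S = [set g i | i : 'I_k]) (S \in bases V).
Proof.
rewrite inE /indep; apply: (iffP andP) => [[fr /eqP Sk]|[g + ->]].
  have sz : size (enum S) == k by rewrite -cardE Sk.
  pose t := Tuple sz; exists [ffun i => tnth t i]; last first.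
    apply/setP => e; rewrite -mem_enum -[enum S]/(tval t).
    apply/tnthP/imsetP => [[i ->]|[i _ ->]]; exists i => //; rewrite ffunE //.
  rewrite -det_colsub_int -free_colsub.
  rewrite (_ : [seq _ | i <- enum 'I_k] = [seq col e V | e <- enum S]) //.
  rewrite -[enum S]/(tval t) -[in RHS](map_tnth_enum t).
  by rewrite -[RHS]map_comp; apply: eq_map => i /=; rewrite ffunE.
rewrite -det_colsub_int => d0; have gI := det_colsub_inj d0.
split; last by rewrite card_imset // card_ord.
suff /perm_free-> : perm_eq [seq col e V | e <- enum [set g i | i : 'I_k]]
  [seq col (g i) V | i <- enum 'I_k] by rewrite free_colsub.
rewrite (map_comp (fun e => col e V) g); apply: perm_map; apply: uniq_perm.
- exact: enum_uniq.
- by rewrite map_inj_uniq // enum_uniq.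
move=> e; rewrite mem_enum; apply/imsetP/mapP => [[i _ ->]|[i _ ->]]; exists i => //.
by rewrite mem_enum.
Qed.

Lemma bases_neq0 : \rank V = k -> exists S, S \in bases V.
Proof.
move=> rk; have fV : row_full V^T by rewrite /row_full mxrank_tr rk.
exists [set fullrankfun fV i | i : 'I_k]; apply/basesP; exists (fullrankfun fV) => //.
rewrite -det_colsub_int -unitfE -unitmxE -unitmx_tr.
have -> : (colsub (fullrankfun fV) V)^T = rowsub (fullrankfun fV) V^T.
  by apply/matrixP => i j; rewrite !mxE.
exact: fullrowsub_unit.
Qed.

End Bases.

(** * Keys of bases *)

Section Greedy.
Variables (n : nat) (test : {set 'I_n} -> bool).

Definition greedy (s : seq 'I_n) : {set 'I_n} :=
  foldl (fun U e => if test (U :\ e) then U :\ e else U) setT s.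

Variable good : {set 'I_n} -> Prop.
Hypothesis testP : forall U : {set 'I_n}, reflect (exists2 S, good S & S \subset U) (test U).

Lemma greedy_rcons s e : greedy (rcons s e) =
  if test (greedy s :\ e) then greedy s :\ e else greedy s.
Proof. by rewrite /greedy -cats1 foldl_cat. Qed.

(** The test is monotone, so an element once kept cannot be deleted from any later, smaller set. A
    good set S inside the result is therefore all of it: an element outside S could still be
    deleted. *)
Lemma greedy_good : test (greedy (enum 'I_n)) -> good (greedy (enum 'I_n)).
Proof.
have h s e : e \in s -> e \in greedy s -> ~~ test (greedy s :\ e).
  elim/last_ind: s => // s x IH; rewrite mem_rcons inE greedy_rcons.
  case: (boolP (test (greedy s :\ x))) => tx.
    have [->|_ /= es] := eqVneq e x; first by rewrite !inE eqxx.
    rewrite !inE => /andP[_ eg]; apply: contra (IH es eg).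
    by move=> /testP[S gS sS]; apply/testP; exists S => //;
      apply: subset_trans sS _; apply: setSD; apply: subD1set.
  by have [->|_ /= es] := eqVneq e x; [move=> _ _|apply: IH].
move=> /testP[S gS sS]; suff -> : greedy (enum 'I_n) = S by [].
apply/eqP; rewrite eqEsubset sS andbT; apply/subsetP => e eg.
have := h _ e (mem_enum _ e) eg; apply: contraR => eS.
apply/testP; exists S => //; apply/subsetP => x xS.
rewrite !inE (subsetP sS _ xS) andbT; apply: contraNneq eS => <- //.
Qed.

Lemma greedy_test s : test setT -> test (greedy s).
Proof.
move=> t0; elim/last_ind: s => // s x IH; rewrite greedy_rcons.
by case: (boolP (test (greedy s :\ x))).
Qed.

End Greedy.

Section Keys.
Variable n : nat.

Definition chi (S : {set 'I_n}) : 'rV[int]_n := \row_e (e \in S)%:Z.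

(** The entries of P (chi S - chi T)^T are at most n g in absolute value, so in radix n g + 1 the
    difference of two keys vanishes only if all of them do. *)
Definition keyw (g : int) (P : 'M[int]_n) (e : 'I_n) : int :=
  \sum_j P e j * (n%:Z * g + 1) ^+ j.

Definition key (U : 'I_n -> int) (S : {set 'I_n}) : int := \sum_e (e \in S)%:Z * U e.

Lemma key_sum U S : key U S = \sum_(e in S) U e.
Proof.
rewrite [RHS]big_mkcond; apply: eq_bigr => e _.
by case: (e \in S); rewrite ?mul1r ?mul0r.
Qed.

Lemma key_sub (g : int) (P : 'M[int]_n) S T : P^T = P ->
  key (keyw g P) S - key (keyw g P) T =
  \sum_(j < n) (n%:Z * g + 1) ^+ j * (P *m (chi S - chi T)^T) j 0.
Proof.
move=> Ps; rewrite /key -sumrB; under eq_bigr do rewrite -mulrBl /keyw mulr_sumr.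
rewrite exchange_big /=; apply: eq_bigr => j _; rewrite mxE mulr_sumr.
apply: eq_bigr => e _; rewrite !mxE.
have -> : P e j = P j e by rewrite -[in LHS]Ps mxE.
by ring.
Qed.

Variable w : 'I_n -> int.

(** The bound on the determinant belongs to the invariant, because the sizes of the projection and
    of the keys are derived from it. *)
Definition equations r (D : 'M[int]_(r, n)) : Prop :=
  [/\ D *m (\col_e w e) = 0, 0 < \det (D *m D^T) &
      \det (D *m D^T) <= ((n * n) ^ r)%:Z].

Lemma equations0 : equations (0 : 'M_(0, n)).
Proof.
split; first by apply/matrixP => -[].
  by rewrite det_mx00.
by rewrite det_mx00 expn0.
Qed.

Variables (r : nat) (D : 'M[int]_(r, n)).
Hypothesis hD : equations D.
Let g := \det (D *m D^T).
Let P := gproj D.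
Let U := keyw g P.

Lemma chi_le1 S T : one_bounded (chi S - chi T).
Proof. by move=> j; rewrite !mxE; case: (j \in S); case: (j \in T). Qed.

Lemma key_eqP S T : reflect (P *m (chi S - chi T)^T = 0) (key U S == key U T).
Proof.
have [_ g0 _] := hD.
rewrite -subr_eq0 key_sub ?gproj_sym //; apply: (iffP eqP) => [|->]; last first.
  by apply: big1 => j _; rewrite mxE mulr0.
move/radix_eq0 => h; apply/matrixP => j l; rewrite (ord1 l) [RHS]mxE; apply: h => {l}j.
apply: (@le_lt_trans _ _ (n%:Z * g)); last by rewrite ltrDl.
rewrite mxE; apply: le_trans (ler_norm_sum _ _ _) _.
apply: le_trans (_ : \sum_(i < n) g <= _); last first.
  by rewrite sumr_const card_ord -mulr_natl natz.
apply: ler_sum => i _; rewrite normrM -[g]mulr1 ler_pM //; first exact: gproj_le.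
by rewrite mxE; apply: chi_le1.
Qed.

Lemma weight_chi S : weight w S = (chi S *m (\col_e w e)) 0 0.
Proof.
rewrite /weight mxE big_mkcond; apply: eq_bigr => e _; rewrite !mxE.
by case: (e \in S); rewrite ?mul1r ?mul0r.
Qed.

(** The weight vector W is orthogonal to the equations, so P W = g W. Hence g (chi S - chi T) W =
    (chi S - chi T) P W, which is 0 for equal keys, and g cancels. *)
Lemma key_weight S T : key U S = key U T -> weight w S = weight w T.
Proof.
have [Dw g0 _] := hD; move/eqP/key_eqP => Pd; apply/eqP; rewrite -subr_eq0.
rewrite !weight_chi; set W := \col_e w e.
have Pw : P *m W = g *: W.
  by rewrite /P /gproj mulmxBl mul_scalar_mx -!mulmxA Dw !mulmx0 subr0.
have dP : (chi S - chi T) *m P = 0.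
  by apply: trmx_inj; rewrite trmx_mul gproj_sym Pd trmx0.
have : (chi S - chi T) *m P *m W = 0 by rewrite dP mul0mx.
rewrite -mulmxA Pw -scalemxAr mulmxBl => /matrixP /(_ 0 0); rewrite !mxE => /eqP.
by rewrite mulf_eq0 gt_eqF //= -!mxE.
Qed.

(** Different keys mean that P does not kill the difference, so it is independent of the rows of
    [D]; its entries in {-1, 0, 1} limit the growth of the determinant to the factor n^2. *)
Lemma equations_rcons S T : key U S != key U T -> weight w S = weight w T ->
  equations (col_mx D (chi S - chi T)).
Proof.
have [Dw g0 gle] := hD; move=> /key_eqP /eqP v0 eST; split.
- rewrite mul_col_mx Dw (_ : _ *m _ = 0) ?col_mx0 //.
  apply/matrixP => i j; rewrite (ord1 i) (ord1 j) mulmxBl [LHS]mxE [X in _ + X]mxE.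
  by rewrite -!weight_chi eST subrr mxE.
- exact: det_gram_gt0.
apply: le_trans (det_gram_le g0 (@chi_le1 S T)) _.
by rewrite addn1 expnS [X in _ <= X]PoszM ler_wpM2l.
Qed.

End Keys.

Lemma sm_prod_seq L (T : Type) (s : seq T) (f : T -> int) :
  (forall x, sm L (f x)) -> sm (L * size s).+1 (\prod_(x <- s) f x).
Proof.
move=> hf; rewrite /sm expnS mul2n -addnn.
suff h : (absz (\prod_(x <- s) f x)%R <= 2 ^ (L * size s))%N.
  by apply: leq_ltn_trans h _; rewrite -{1}[(2 ^ _)%N]addn0 ltn_add2l expn_gt0.
elim: s => [|x s IH]; first by rewrite big_nil muln0.
by rewrite big_cons abszM /= mulnS expnD leq_mul // ltnW //; apply: hf.
Qed.

(** One modulus serves all of [s]: a small nondivisor of the product of the values, to whose size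
    each factor contributes at most L bits. *)
Lemma exists_modulus L (T : eqType) (s : seq T) (f : T -> int) :
  (forall x, sm L (f x)) -> (forall x, x \in s -> f x != 0) ->
  exists2 p, (0 < p <= 2 * (L * size s).+1)%N &
    forall x, x \in s -> ~~ (p %| `|f x|)%N.
Proof.
move=> hf f0; have Z0 : (0 < absz (\prod_(x <- s) f x)%R)%N.
  by rewrite absz_gt0 prodf_seq_neq0; apply/allP => x xs; rewrite f0.
have [p hp npZ] := small_nondivisor Z0 (sm_prod_seq s hf).
exists p; first by rewrite mul2n -addnn.
move=> x xs; apply: contra npZ => h; rewrite (big_rem x xs) /= abszM.
exact: dvdn_mulr.
Qed.

Notation "x ==' y" := ((x <=' y) *' (y <=' x)) (at level 55).

Lemma eval_eqb (x y : int) :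
  eval_op Defs.Mul (eval_op Defs.Leq x y) (eval_op Defs.Leq y x) = (x == y)%:Z.
Proof. by rewrite /= eq_le; case: (x <= y); case: (y <= x). Qed.

Lemma sm_leq b (x y : int) : (0 < b)%N -> sm b (eval_op Defs.Leq x y).
Proof. exact: sm_bool. Qed.

Lemma smE b x : sm b x = (`|x| < 2%:Z ^+ b).
Proof. by rewrite /sm -ltz_nat abszE -[in LHS]natz natrX natz. Qed.

Lemma iota_enum (n : nat) :
  [seq VInt (i : nat) | i <- iota 0 n] = [seq VInt (nat_of_ord i) | i <- enum 'I_n].
Proof. by rewrite -val_enum_ord -map_comp. Qed.

Definition IDM := Let (Call IOTA V0) (Call (Map2
  (Call (Map2 (hd 0 V0 ==' tl 2 V0)) (tl 2 V0,, tl 2 V0,, hd 0 V0)))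
  (V0,, V0,, V0)).

Lemma IDM_run : exists2 c, poly_bounded c &
  forall O b n, (n < b)%N ->
  run O [:: VInt n%:Z] IDM (encm (1%:M : 'M[int]_n)) (c b) 0.
Proof.
have [ci pi Hi] := IOTA_run; have [cm pm Hm] := Map2_run.
eexists; last first.
  move=> O b n nb.
  have sn : (size (enum 'I_n) <= b)%N by rewrite size_enum_ord ltnW.
  have si (i : 'I_n) : sm b (i : nat) by apply: sm_nat; have := ltn_ord i; lia.
  apply: run_conv.
  - rewrite /IDM /hd /tl /=; steps; first by apply: Hi; exact: ltnW nb.
    rewrite iota_enum.
    apply: (Hm O b _ _ (enum 'I_n) (fun i : 'I_n => VInt (i : nat)) _
      (fun i => encv ((1%:M : 'M[int]_n) i))) => // i _.
    apply: run_conv.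
    + steps.
      apply: (Hm O b _ _ (enum 'I_n) _ _ (fun j => VInt ((1%:M : 'M[int]_n) i j))) => // j _.
      apply: run_conv.
      * stepsb b; [exact: si|exact: si|exact: si|exact: si| |];
          by apply: sm_leq; apply: leq_ltn_trans nb.
      * by rewrite eval_eqb mxE eqz_nat eq_sym natz.
      * exact: leqnn.
      * by [].
    + by [].
    + exact: leqnn.
    + by [].
  - by [].
  - exact: leqnn.
  - by [].
by rewrite /=; poly.
Qed.

Definition ONES := Let (Call IOTA V0) (Call (Map2 (Cst 1)) (V0,, V0,, Cst 0)).

Lemma ONES_run : exists2 c, poly_bounded c &
  forall O b n, (n <= b)%N ->
  run O [:: VInt n%:Z] ONES (@encv n (fun=> 1)) (c b) 0.
Proof.
have [ci pi Hi] := IOTA_run; have [cm pm Hm] := Map2_run.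
eexists; last first.
  move=> O b n nb.
  apply: run_conv.
  - rewrite /ONES; steps; first exact: Hi nb.
    rewrite iota_enum.
    apply: (Hm O b _ _ (enum 'I_n) _ _ (fun i => VInt 1)); last by rewrite size_enum_ord.
    by move=> i _; apply: run_cst.
  - by [].
  - exact: leqnn.
  - by [].
by rewrite /=; poly.
Qed.

Definition DETB := Call UPD (Cst 1,, Call (Map2 (hd 0 V0 *' hd 1 V0))
  (hd 0 V0,, tl 2 V0,, Cst 0),, hd 1 V0).

Definition DET := Fst (Call (Fold DETB) (hd 0 V0,, (Cst 1,, tl 2 V0),, hd 1 V0)).

Section DetSize.
Variables (n : nat) (I : Type) (r : I -> 'rV[int]_n) (a : nat).
Hypothesis sr : forall i j, sm a (r i 0 j).

(** A row with entries of size a multiplies the determinant by at most 1 + n^2 4^a, and n <= 2^n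
    puts this below 2^(2a + 2n + 1). *)
Lemma gram1_det_sm s :
  sm ((2 * a + 2 * n + 1) * size s).+1 (\det (gram1 r s)) /\
  (forall i j, sm ((2 * a + 2 * n + 1) * size s).+1 (\adj (gram1 r s) i j)).
Proof.
have h : `|\det (gram1 r s)| <= 2%:Z ^+ ((2 * a + 2 * n + 1) * size s).
  elim/last_ind: s => [|s i IH].
    by rewrite /gram1 big_nil addr0 det1 muln0 expr0.
  rewrite ger0_norm; last by apply: ltW; apply: gram1_det_gt0.
  rewrite ger0_norm in IH; last by apply: ltW; apply: gram1_det_gt0.
  have ra j : `|r i 0 j| <= 2%:Z ^+ a by apply: ltW; rewrite -smE.
  apply: le_trans (gram1_det_rcons s _ ra) _; first exact: exprn_ge0.
  have n2 : n%:Z <= 2%:Z ^+ n by apply: ltW; have := sm_nat (leqnn n); rewrite smE.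
  have a1 : 1 <= 2%:Z ^+ a by rewrite exprn_ege1.
  have n1 : 1 <= 2%:Z ^+ n by rewrite exprn_ege1.
  have n0 : 0 <= n%:Z by [].
  rewrite size_rcons mulnS exprD PoszM; apply: ler_pM => //.
  - by rewrite addr_ge0 // !mulr_ge0 // exprn_ge0.
  - by apply: ltW; apply: gram1_det_gt0.
  have -> : 2%:Z ^+ (2 * a + 2 * n + 1) = 2%:Z * (2%:Z ^+ a * 2%:Z ^+ a) * (2%:Z ^+ n * 2%:Z ^+ n).
    by rewrite !mul2n -!addnn !exprD expr1; ring.
  move: (2%:Z ^+ n) (2%:Z ^+ a) n%:Z n0 n1 n2 a1 => N B m m0 N1 mN B1.
  have h1 : m * m <= N * N by nia.
  have h2 : 1 <= B * B by nia.
  have h3 : m * m * (B * B) <= N * N * (B * B) by nia.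
  have h4 : 1 <= N * N * (B * B) by nia.
  by lia.
have h' : `|\det (gram1 r s)| < 2%:Z ^+ ((2 * a + 2 * n + 1) * size s).+1.
  by apply: le_lt_trans h _; rewrite ltr_eXn2l.
split=> [|i j]; rewrite smE //; apply: le_lt_trans h'.
have g0 := gram1_det_gt0 r s.
by apply: le_trans (gram1_adj_le g0 i j) _; apply: ler_norm.
Qed.
End DetSize.

Lemma DET_run : exists2 c, poly_bounded c &
  forall O a b n k (A : 'M[int]_(k, n)) (z : 'I_n -> int) (r : 'I_k -> 'rV[int]_n),
  (forall i j, sm a (A i j)) -> (forall j, sm a (z j)) ->
  (forall i j, r i 0 j = A i j * z j) ->
  (k <= b)%N -> (4 * ((4 * a + 2 * n + 1) * k + 2 * a + 1) + 2 * n + 10 <= b)%N ->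
  run O [:: encm A;; encv z;; encm (1%:M : 'M[int]_n)] DET
    (VInt (\det (gram1 r (enum 'I_k)))) (c b) 0.
Proof.
have [cm pm Hm] := Map2_run; have [cu pu Hu] := UPD_run.
eexists; last first.
  move=> O a b n k A z r hA hz rE kb ab.
  have hr i j : sm (2 * a) (r i 0 j) by rewrite rE; apply: smM (hA _ _) (hz _) _; lia.
  have sn : (size (enum 'I_n) <= b)%N by rewrite size_enum_ord; lia.
  apply: run_conv.
  - rewrite /DET /hd /tl /=; steps.
    have := @Fold_run O 'I_k (fun i => encv (A i))
      (fun s => VInt (\det (gram1 r s));; encm (\adj (gram1 r s))) (encv z) DETB.
    have -> : gram1 r [::] = 1%:M by rewrite /gram1 big_nil addr0.
    have -> : \adj (1%:M : 'M[int]_n) = 1%:M.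
      by have := mul_mx_adj (1%:M : 'M[int]_n); rewrite mul1mx det1.
    rewrite det1; apply; last by rewrite size_enum_ord; exact: kb.
    move=> s1 i s2 es; have [_ _] := split_cat es; rewrite size_enum_ord => lt_s.
    have [hg hQ] := gram1_det_sm hr s1.
    have le_s : (((2 * (2 * a) + 2 * n + 1) * size s1).+1 <=
        (4 * a + 2 * n + 1) * k + 2 * a + 1)%N.
      have : ((4 * a + 2 * n + 1) * size s1 <= (4 * a + 2 * n + 1) * k)%N.
        by rewrite leq_mul2l ltnW ?orbT.
      by rewrite mulnA; lia.
    apply: run_conv.
    + rewrite /DETB /hd /tl /=; steps.
        apply: (Hm O b _ _ (enum 'I_n) _ _ (fun j => VInt (r i 0 j))) => // j _.
        apply: run_conv.
        * by stepsb b; [apply: smW (hA i j) _; lia|apply: smW (hz j) _; lia].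
        * by rewrite rE.
        * exact: leqnn.
        * by [].
      apply: (Hu O _ b true n (r i 0) (\det (gram1 r s1)) (\adj (gram1 r s1)) _ _ _ ab).
      * by move=> j; apply: smW (hr i j) _; lia.
      * exact: smW hg le_s.
      * by move=> j l; apply: smW (hQ j l) le_s.
    + have [-> e] := upd_gram1 r s1 i; congr (_;; _).
      by congr vlist; apply: eq_map => j; congr vlist; apply: eq_map => l; rewrite e.
    + exact: leqnn.
    + by [].
  - by [].
  - exact: leqnn.
  - by [].
by rewrite /=; poly.
Qed.

(** * Finding a basis with a new key *)

Section Digit.
Variables (k n : nat) (A : 'M[int]_(k, n)) (X : int).

Definition zval (u : 'I_n -> nat) (o : nat) (S : {set 'I_n}) e : int :=
  (e \in S)%:Z * X ^+ (o + u e).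

Definition zrow u o S (i : 'I_k) : 'rV[int]_n := \row_e (A i e * zval u o S e).

(** The offset (n + 1) p exceeds n p, as [genf_coef_neq0] demands. The base is X^2 because the
    powers of X in [zval] enter the Gram matrix squared. *)
Definition digit u p s S : int :=
  let o := (n.+1 * p)%N in
  let q := divz (\det (gram1 (zrow u o S) (enum 'I_k))) ((X * X) ^+ (k * o + s)) in
  q - (X * X) * divz q (X * X).

Lemma gram1_mx (r : 'I_k -> 'rV[int]_n) :
  gram1 r (enum 'I_k) = 1%:M + (\matrix_i r i)^T *m (\matrix_i r i).
Proof.
congr (_ + _); rewrite big_enum /=; apply/matrixP => i j; rewrite summxE mxE.
by apply: eq_bigr => l _; rewrite mxE big_ord1 !mxE.
Qed.

Lemma det_gram1_genf u o S :
  \det (gram1 (zrow u o S) (enum 'I_k)) = (genf A S (fun e => o + u e)%N).[X * X].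
Proof.
rewrite gram1_mx det_1DmulC /genf -[_.[_]]/(horner_eval (X * X) _) -det_map_mx.
congr (\det _); rewrite map_mxD map_mx1 !map_mxM map_trmx -!map_mx_comp.
have -> : map_mx (horner_eval (X * X) \o polyC) A = A.
  by apply/matrixP => i j; rewrite mxE /= /horner_eval hornerC.
congr (_ + _); apply/matrixP => i j; rewrite !mxE; apply: eq_bigr => e _.
rewrite map_diag_mx mul_mx_diag !mxE /zval /mono.
rewrite /= /horner_eval hornerC; case: (e \in S).
  by rewrite /= hornerXn exprMn; ring.
by rewrite /= horner0; ring.
Qed.

Hypothesis XE : X = \det (1%:M + A *m A^T) + 1.
Hypothesis kn : (k <= n)%N.

(** X exceeds the bound det(1 + A A^T) on all coefficients, hence so does the base X^2, and the
    digit is a coefficient. *)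
Lemma digit_neq0 u p s (S : {set 'I_n}) : (0 < p)%N -> (forall e, u e < p)%N ->
  reflect (exists2 g : {ffun 'I_k -> 'I_n}, \det (colsub g A) != 0 &
             (forall i, g i \in S) /\ (\sum_i u (g i) = s)%N)
    (digit u p s S != 0).
Proof.
move=> p0 up; have -> : digit u p s S =
    (genf A S (fun e => n.+1 * p + u e)%N)`_(k * (n.+1 * p) + s).
  rewrite /digit det_gram1_genf; apply: horner_digit => i.
  have /andP[-> h] := genf_coef_bounds A S (fun e => n.+1 * p + u e)%N i.
  apply: le_lt_trans h _; rewrite XE.
  have d0 : 0 <= \det (1%:M + A *m A^T).
    have := gram1_det_gt0 (fun i => row i A) (enum 'I_k).
    rewrite gram1_mx -det_1DmulC => /ltW; congr (_ <= \det _).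
    by congr (_ + _ *m _^T); apply/matrixP => x y; rewrite !mxE.
  by move: (\det _) d0 => d d0; nia.
by apply: genf_coef_neq0 => //; rewrite ltn_mul2r p0 ltnSn.
Qed.

End Digit.

Notation st_n st := (hd 0 st) (only parsing).
Notation st_k st := (hd 1 st) (only parsing).
Notation st_rows st := (hd 2 st) (only parsing).
Notation st_id st := (hd 3 st) (only parsing).
Notation st_X st := (tl 4 st) (only parsing).

Definition enc_st k n (A : 'M[int]_(k, n)) (X : int) : tree :=
  VInt n;; VInt k;; encm A;; encm (1%:M : 'M[int]_n);; VInt X.

(** The language offers only division, so the residue of a key entry is computed as x - p (x /
    p). *)
Definition ZENT := hd 0 V0 *' Call POW
  (hd 2 V0,, tl 4 V0 +' (hd 1 V0 -' hd 3 V0 *' (hd 1 V0 /' hd 3 V0))).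

Definition TEST :=
  Let ((st_n (hd 1 V0) +' Cst 1) *' hd 3 V0)
 (Let (Call (Map2 ZENT) (hd 0 (Var 1),, hd 2 (Var 1),, (st_X (hd 1 (Var 1)),, hd 3 (Var 1),, V0)))
 (Let (Call DET (st_rows (hd 1 (Var 2)),, V0,, st_id (hd 1 (Var 2))))
 (Let (st_X (hd 1 (Var 3)) *' st_X (hd 1 (Var 3)))
 (Let (Var 1 /' Call POW (V0,, st_k (hd 1 (Var 4)) *' Var 3 +' tl 4 (Var 4)))
  (V0 -' Var 1 *' (V0 /' Var 1)))))).

Definition umod n (U : 'I_n -> int) (p : nat) e : nat := absz (modz (U e) p).

Definition zsize a n p := (a * ((n + 2) * p) + 2)%N.
Definition det_size a n k p := ((4 * zsize a n p + 2 * n + 1) * k)%N.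
Definition test_size a n k p s : nat :=
  (4 * (det_size a n k p + 2 * zsize a n p + 1) + 2 * n + 20 + 2 * (a * (k * (n.+1 * p) + s))
   + (k * (n.+1 * p) + s) + (n + 2) * p + 2 * a)%N.

Lemma test_sizeP a n k p s b : (0 < p)%N -> (test_size a n k p s <= b)%N ->
  [/\ (0 < b)%N, (n.+1 <= b)%N, (p <= b)%N, (n.+1 * p <= b)%N & (n + 2) * p <= b]%N /\
  [/\ k * (n.+1 * p) + s <= b, 2 * a * (k * (n.+1 * p) + s) <= b, 2 * a <= b,
      zsize a n p <= b & 4 * (det_size a n k p + 2 * zsize a n p + 1) + 2 * n + 10 <= b]%N /\
  [/\ (det_size a n k p).+1 <= b & 2 * a + (det_size a n k p).+1 <= b]%N /\ (a <= zsize a n p)%N.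
Proof.
move=> p0 ab; have az : (a <= zsize a n p)%N.
  rewrite /zsize; apply: leq_trans (_ : a * ((n + 2) * p) <= _)%N; last exact: leq_addr.
  by rewrite leq_pmulr // muln_gt0 addnS p0.
rewrite -[(2 * a * _)%N]mulnA.
have h1 : (n.+1 * p <= (n + 2) * p)%N by rewrite leq_mul2r addn2 leqnSn orbT.
have h2 : (p <= n.+1 * p)%N by rewrite leq_pmull.
move: ab az h1 h2; rewrite /test_size; clear p0.
(* Products become variables, so that only linear inequalities remain. *)
generalize (k * (n.+1 * p) + s)%N => y; generalize (a * y)%N => x.
generalize (n.+1 * p)%N (det_size a n k p) (zsize a n p) ((n + 2) * p)%N.
by move=> z u v t *; do !split; lia.
Qed.

Lemma umod_lt n (U : 'I_n -> int) p e : (0 < p)%N -> (umod U p e < p)%N.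
Proof.
move=> p0; rewrite /umod -ltz_nat abszE ger0_norm ?modz_ge0 //; last by lia.
by rewrite ltz_pmod.
Qed.

Lemma TEST_run : exists2 c, poly_bounded c &
  forall O a b k n (A : 'M[int]_(k, n)) X (S : {set 'I_n}) U p s,
  (0 < p)%N -> (k <= n)%N -> sm a X -> (forall i j, sm a (A i j)) ->
  (forall e, sm b (U e)) -> (forall e, sm b (p%:Z * divz (U e) p)) -> 
  (test_size a n k p s <= b)%N ->
  run O [:: enc_set S;; enc_st A X;; encv U;; VInt p;; VInt s] TEST
    (VInt (digit A X (umod U p) p s S)) (c b) 0.
Proof.
have [cm pm Hm] := Map2_run; have [cp pp Hp] := POW_run; have [cd pd Hd] := DET_run.
eexists; last first.
  move=> O a b k n A X S U p s p0 kn hX hA hU hU' ab.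
  have [[b0 nb pb ob n2b] [[kob akob a2b zb hb] [[Db aDb] aaz]]] := test_sizeP p0 ab.
  clear ab; have ab := leq_trans aaz zb.
  have sn : (size (enum 'I_n) <= b)%N by rewrite size_enum_ord ltnW.
  set o := (n.+1 * p)%N in kob akob ob.
  have oE : eval_op Defs.Mul (eval_op Defs.Add n 1) p = o by rewrite /= -PoszD addn1.
  have aE e : (o + umod U p e <= (n + 2) * p)%N.
    by rewrite addn2 mulSnr leq_add2l ltnW // umod_lt.
  have az e : (a * (o + umod U p e) <= a * ((n + 2) * p))%N by rewrite leq_mul2l aE orbT.
  have az' e : (a * (o + umod U p e) <= b)%N.
    by apply: leq_trans zb; apply: leq_trans (az e) _; apply: leq_addr.
  have umE e : eval_op Defs.Sub (U e) (eval_op Defs.Mul p (eval_op Defs.Div (U e) p)) =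
      umod U p e.
    rewrite /= /umod abszE ger0_norm ?modz_ge0 ?/modz ?[_ * p%:Z]mulrC //.
    by rewrite eqz_nat -lt0n.
  have hz j : sm (zsize a n p) (zval X (umod U p) o S j).
    apply: (@smM 1 (a * ((n + 2) * p)).+1); [exact: sm_bool| |by rewrite /zsize add1n [X in (_ <= X)%N]addn2].
    by apply: smX hX _ _ => //; rewrite ltnW // ltnS az.
  have hN : sm (det_size a n k p).+1
     (\det (gram1 (zrow A X (umod U p) o S) (enum 'I_k))).
    have rs i j : sm (2 * zsize a n p) (zrow A X (umod U p) o S i 0 j).
      rewrite mxE; apply: smM (smW (hA i j) aaz) (hz j) _; by rewrite mul2n addnn.
    have [h _] := gram1_det_sm rs (enum 'I_k).
    by apply: smW h _; rewrite size_enum_ord mulnA.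
  have hX2 : sm (2 * a) (eval_op Defs.Mul X X).
    by apply: (smM hX hX); rewrite mul2n addnn.
  have h1 : sm b 1 by apply: (@sm_nat _ 1).
  have hn : sm b n by apply: sm_nat; apply: ltnW.
  have hn1 : sm b (eval_op Defs.Add n 1).
    by rewrite /= -PoszD addn1; apply: sm_nat.
  have hp : sm b p by apply: sm_nat.
  have ho : sm b o by apply: sm_nat.
  have hk : sm b k by apply: sm_nat; apply: leq_trans kn (ltnW nb).
  have hs : sm b s by apply: sm_nat; apply: leq_trans kob; apply: leq_addl.
  have hko : sm b (eval_op Defs.Mul k o).
    by rewrite /= -PoszM; apply: sm_nat; apply: leq_trans kob; apply: leq_addr.
  have koE : eval_op Defs.Add (eval_op Defs.Mul k o) s = (k * o + s)%N by [].
  have hXb : sm b X := smW hX ab.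
  have hX2b : sm b (eval_op Defs.Mul X X) := smW hX2 a2b.
  apply: run_conv.
  - rewrite /TEST /hd /tl /=; stepsb b; rewrite ?oE; try sma.
    + apply: (Hm O b _ _ (enum 'I_n) _ _ (fun j => VInt (zval X (umod U p) o S j))) => // j _.
      apply: run_conv.
      * rewrite /ZENT /hd /tl /=; stepsb b; try sma.
        - exact: sm_div (hU j).
        - exact: hU'.
        - by rewrite umE; apply: sm_nat; apply: leq_trans n2b; apply: leq_trans (aE j); apply: leq_addl.
        - rewrite umE; apply: (Hp O a b) => //.
          exact: leq_trans (aE j) n2b.
        - by apply: sm_bool.
        - by apply: smX hX _ _.
      * by [].
      * exact: leqnn.
      * by [].
    + apply: (Hd O _ b n k A _ (zrow A X (umod U p) o S) _ _ _ _ hb) => // [i j|i j|].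
      * exact: smW (hA i j) aaz.
      * by rewrite mxE.
      * exact: leq_trans kn (ltnW nb).
    + by rewrite koE; apply: (Hp O (2 * a)%N b).
    + exact: smW hN _.
    + exact: smX hX2 _ _.
    + by apply: sm_div; apply: smW hN _.
    + by apply: sm_div; apply: sm_div; apply: smW hN _.
    + by apply: sm_div; apply: smW hN _.
    + exact: smM hX2 (sm_div _ (sm_div _ hN)) _.
  - by [].
  - exact: leqnn.
  - by [].
by rewrite /=; poly.
Qed.

Definition MEM := Fold (hd 1 V0 +' (hd 0 V0 ==' tl 2 V0)).

Lemma MEM_run : exists2 c, poly_bounded c &
  forall O b (T : Type) (s : seq T) (f : T -> int) y,
  (forall x, sm b (f x)) -> sm b y -> (size s < b)%N ->
  run O [:: vlist [seq VInt (f x) | x <- s];; VInt 0;; VInt y] MEM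
    (VInt (count (fun x => f x == y) s)) (c b) 0.
Proof.
eexists; last first.
  move=> O b T s f y hf hy sb.
  have b0 : (0 < b)%N by apply: leq_ltn_trans sb.
  apply: run_conv.
  - apply: (@Fold_run O T (fun x => VInt (f x))
      (fun s1 => VInt (count (fun x => f x == y) s1)) (VInt y)); last exact: ltnW sb.
    move=> s1 x s2 es; have [_ _ ls] := split_cat es.
    apply: run_conv.
    + rewrite /hd /tl /=; stepsb b; try sma.
      * by apply: sm_nat; apply: leq_trans (count_size _ _) _; rewrite ltnW // (ltn_trans ls).
      * by rewrite eval_eqb; apply: sm_bool.
    + by rewrite eval_eqb /= -cats1 count_cat /= addn0 PoszD.
    + exact: leqnn.
    + by [].
  - by [].
  - exact: leqnn.
  - by [].
by rewrite /=; poly.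
Qed.

Definition GB :=
  Let (Call (Map2 (hd 0 V0 *' (Cst 1 -' (hd 1 V0 ==' tl 2 V0))))
         (hd 1 V0,, Call IOTA (st_n (hd 2 V0)),, hd 0 V0))
  (If (Call TEST (V0,, tl 2 (Var 1))) V0 (hd 1 (Var 1))).

Definition GREEDY := Call (Fold GB)
  (Call IOTA (st_n (hd 0 V0)),, Call ONES (st_n (hd 0 V0)),, V0).

Lemma test_size_mono a n k p p' s s' : (p <= p')%N -> (s <= s')%N ->
  (test_size a n k p s <= test_size a n k p' s')%N.
Proof.
move=> pp ss; have hz : (zsize a n p <= zsize a n p')%N by rewrite /zsize leq_add2r !leq_mul.
have hd : (det_size a n k p <= det_size a n k p')%N.
  by rewrite /det_size leq_mul // !leq_add2r leq_mul.
have hk : (k * (n.+1 * p) + s <= k * (n.+1 * p') + s')%N by rewrite leq_add // !leq_mul.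
have ha : (a * (k * (n.+1 * p) + s) <= a * (k * (n.+1 * p') + s'))%N by rewrite leq_mul.
have hn : ((n + 2) * p <= (n + 2) * p')%N by rewrite leq_mul.
move: hz hd hk ha hn; rewrite /test_size; clear.
generalize (k * (n.+1 * p) + s)%N (k * (n.+1 * p') + s')%N => x x'.
generalize (a * x)%N (a * x')%N (det_size a n k p) (det_size a n k p') (zsize a n p)
  (zsize a n p') ((n + 2) * p)%N ((n + 2) * p')%N; lia.
Qed.

Section Find.
Variables (k n : nat) (A : 'M[int]_(k, n)) (X : int).
Variables (U : 'I_n -> int) (Ts : seq {set 'I_n}).

Definition test p s (S : {set 'I_n}) : bool := digit A X (umod U p) p s S != 0.

(** For an unsuitable p the isolated basis may have an already known key, which agrees with the one
    sought only modulo p; hence the comparison of full keys. *)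
Definition candidate p s : option {set 'I_n} :=
  let G := greedy (test p s) (enum 'I_n) in
  if test p s G && (key U G \notin [seq key U T | T <- Ts]) then Some G else None.

Definition cand_step p (acc : option {set 'I_n}) s := if acc is Some G then Some G else candidate p s.

Definition find_sum acc p := foldl (cand_step p) acc (iota 0 (n * p + 1)).

(** The bound of [exists_modulus] for one key difference per known representative, each of at most 2
    (n + 2)^3 bits. *)
Definition pmax : nat := (2 * (2 * ((n + 2) * (n + 2) * (n + 2)) * size Ts + 1))%N.

Definition find_new := foldl (fun acc j => find_sum acc j.+1) None (iota 0 pmax).

End Find.

Definition enc_opt n (x : option {set 'I_n}) : tree :=
  if x is Some G then VInt 0;; enc_set G else VInt 0.

Definition CAND :=
  If (IsPair (hd 1 V0)) (hd 1 V0)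
  (Let (hd 3 V0,, hd 4 V0,, hd 2 V0,, hd 0 V0)
  (Let (Call GREEDY V0)
  (If (Call TEST (V0,, Var 1))
     (If (Call MEM (tl 5 (Var 2),, Cst 0,, Call DOT (V0,, hd 1 (Var 1))))
         (Cst 0) (Cst 0,, V0))
     (Cst 0)))).

Definition PB := Let (hd 0 V0 +' Cst 1)
  (Call (Fold CAND) (Call IOTA (st_n (hd 2 (Var 1)) *' V0 +' Cst 1),, hd 1 (Var 1),,
     (V0,, tl 2 (Var 1)))).

Definition FIND := Let (st_n (hd 1 V0) +' Cst 2)
  (Call (Fold PB)
    (Call IOTA (Cst 2 *' (Cst 2 *' (V0 *' V0 *' V0) *' hd 0 (Var 1) +' Cst 1)),,
     Cst 0,, tl 1 (Var 1))).

Lemma GREEDY_run : exists2 c, poly_bounded c &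
  forall O a b k n (A : 'M[int]_(k, n)) X U p s,
  (0 < p)%N -> (k <= n)%N -> sm a X -> (forall i j, sm a (A i j)) ->
  (forall e, sm b (U e)) -> (forall e, sm b (p%:Z * divz (U e) p)) -> 
  (test_size a n k p s <= b)%N ->
  run O [:: enc_st A X;; encv U;; VInt p;; VInt s] GREEDY
    (enc_set (greedy (test A X U p s) (enum 'I_n))) (c b) 0.
Proof.
have [ct pt Ht] := TEST_run; have [cm pm Hm] := Map2_run.
have [ci pi Hi] := IOTA_run; have [co po Ho] := ONES_run.
eexists; last first.
  move=> O a b k n A X U p s p0 kn hX hA hU hU' ab.
  have [[b0 nb _ _ _] _] := test_sizeP p0 ab.
  have sn : (size (enum 'I_n) <= b)%N by rewrite size_enum_ord ltnW.
  have si (i : 'I_n) : sm b (i : nat).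
    by apply: sm_nat; apply: leq_trans (ltnW nb); apply: ltnW.
  have h1 : sm b 1 by apply: (@sm_nat _ 1).
  apply: run_conv.
  - rewrite /GREEDY /hd /tl /=; steps.
    + by apply: Hi; exact: ltnW nb.
    + by apply: Ho; exact: ltnW nb.
    rewrite iota_enum.
    have := @Fold_run O 'I_n (fun i => VInt (nat_of_ord i))
      (fun s1 => enc_set (greedy (test A X U p s) s1))
      (enc_st A X;; encv U;; VInt p;; VInt s) GB.
    have -> : enc_set (greedy (test A X U p s) [::]) = @encv n (fun=> 1).
      by congr vlist; apply: eq_map => j; rewrite inE.
    apply; last exact: sn.
    move=> s1 e s2 _.
    apply: (@run_conv O _ GB (enc_set (greedy (test A X U p s) (rcons s1 e)))).
    + rewrite /GB /hd /tl /=; steps.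
      * by apply: Hi; exact: ltnW nb.
      * rewrite iota_enum.
        apply: (Hm O b _ _ (enum 'I_n) _ _
          (fun j => VInt (j \in greedy (test A X U p s) s1 :\ e)%:Z)) => // j _.
        apply: run_conv.
        - stepsb b; try sma.
          * by rewrite eval_eqb; apply: sm_bool.
          * exact: sm_bool.
          * by rewrite eval_eqb; case: (_ == _) => //=; apply: (@sm_nat _ 0).
        - rewrite eval_eqb !inE /=; congr VInt; rewrite eqz_nat -[(j : nat) == e]/(j == e).
          by case: (j == e); case: (j \in _).
        - exact: leqnn.
        - by [].
      * exact: (Ht O a b k n A X _ U p s p0 kn hX hA hU hU' ab).
      * move=> t0; rewrite greedy_rcons /test t0; apply: run_var; reflexivity.
      * move=> t0; rewrite greedy_rcons /test t0 eqxx /=; steps.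
    + by [].
    + exact: leqnn.
    + by [].
  - by [].
  - exact: leqnn.
  - by [].
by rewrite /=; poly.
Qed.

Lemma CAND_run : exists2 c, poly_bounded c &
  forall O a b u k n (A : 'M[int]_(k, n)) X U Ts p s acc,
  (0 < p)%N -> (k <= n)%N -> sm a X -> (forall i j, sm a (A i j)) ->
  (forall e, sm u (U e)) -> (u + n + 2 <= b)%N -> (forall e, sm b (p%:Z * divz (U e) p)) ->
  (test_size a n k p s <= b)%N -> (size Ts < b)%N ->
  run O [:: VInt s;; enc_opt acc;; VInt p;; enc_st A X;; encv U;;
            vlist [seq VInt (key U T) | T <- Ts]] CAND
    (enc_opt (cand_step A X U Ts p acc s)) (c b) 0.
Proof.
have [cg pg Hg] := GREEDY_run; have [ct pt Ht] := TEST_run.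
have [cd pd Hd] := DOT_run; have [cm pm Hm] := MEM_run.
eexists; last first.
  move=> O a b u k n A X U Ts p s acc p0 kn hX hA hU ub hU' ab Tsb.
  have hUb e : sm b (U e) by apply: smW (hU e) _; lia.
  have hkey T : sm b (key U T).
    apply: (@sm_sumI u.+1) => [e|]; last by lia.
    by apply: (@smM 1 u) => //; apply: sm_bool.
  apply: (@run_conv O _ CAND (enc_opt (cand_step A X U Ts p acc s))).
  - rewrite /CAND /hd /tl /=; step; first by steps.
      by case: acc => [G|] // _; steps.
    case: acc => [G|] //= _; rewrite /candidate; steps.
    + exact: (Hg O a b k n A X U p s p0 kn hX hA hUb hU' ab).
    + exact: (Ht O a b k n A X _ U p s p0 kn hX hA hUb hU' ab).
    + move=> t0; steps.
      * apply: (Hd O 1%N u b _ (enum 'I_n)) => //.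
          by move=> e; apply: sm_bool.
        by rewrite size_enum_ord; lia.
      * apply: (Hm O b _ Ts) => //.
        by rewrite big_enum; apply: hkey.
      * rewrite big_enum -/(key U _) => c0.
        have -> : key U (greedy (test A X U p s) (enum 'I_n)) \in [seq key U T | T <- Ts].
          have : has (fun x => key U x == key U (greedy (test A X U p s) (enum 'I_n))) Ts.
            by rewrite has_count -ltz_nat lt_neqAle eq_sym c0.
          by case/hasP => T TTs /eqP <-; apply: map_f.
        by rewrite andbF; steps.
      * rewrite big_enum -/(key U _) => c0.
        have -> : key U (greedy (test A X U p s) (enum 'I_n)) \notin [seq key U T | T <- Ts].
          apply/mapP => -[T TTs e].
          have : has (fun x => key U x == key U (greedy (test A X U p s) (enum 'I_n))) Ts.
            by apply/hasP; exists T => //; apply/eqP.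
          by rewrite has_count -ltz_nat c0.
        by rewrite /test t0 /=; steps.
    + by move=> t0; rewrite /test t0 eqxx /=; steps.
  - by [].
  - exact: leqnn.
  - by [].
by rewrite /=; poly.
Qed.

Lemma FIND_run : exists2 c, poly_bounded c &
  forall O a b u k n (A : 'M[int]_(k, n)) X U (Ts : seq {set 'I_n}),
  (k <= n)%N -> sm a X -> (forall i j, sm a (A i j)) ->
  (forall e, sm u (U e)) -> (u + pmax Ts + n * pmax Ts + 2 * ((n + 2) * (n + 2) * (n + 2)) + n + 5 <= b)%N ->
  (test_size a n k (pmax Ts) (n * pmax Ts) <= b)%N -> (size Ts < b)%N ->
  run O [:: VInt (size Ts);; enc_st A X;; encv U;;
            vlist [seq VInt (key U T) | T <- Ts]] FIND
    (enc_opt (find_new A X U Ts)) (c b) 0.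
Proof.
have [cc pc Hc] := CAND_run; have [ci pi Hi] := IOTA_run.
eexists; last first.
  move=> O a b u k n A X U Ts kn hX hA hU ub ab Tsb.
  have hp p s : (0 < p <= pmax Ts)%N -> (s <= n * p)%N ->
      (forall e, sm b (p%:Z * divz (U e) p)) /\ (test_size a n k p s <= b)%N.
    move=> /andP[p0 pp] sp; split=> [e|].
      by apply: smM (sm_nat (leqnn p)) (sm_div _ (hU e)) _; lia.
    apply: leq_trans (test_size_mono _ _ _ pp _) ab.
    by apply: leq_trans sp _; rewrite leq_mul.
  pose m := (n + 2)%N.
  have mE : eval_op Defs.Add n 2 = m by [].
  have m3E : eval_op Defs.Mul (eval_op Defs.Mul m m) m = (m * m * m)%N by [].
  have LE : eval_op Defs.Mul 2 (m * m * m)%N = (2 * (m * m * m))%N by [].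
  have LcE : eval_op Defs.Mul (2 * (m * m * m))%N (size Ts) = (2 * (m * m * m) * size Ts)%N by [].
  have pE : eval_op Defs.Mul 2 (eval_op Defs.Add (2 * (m * m * m) * size Ts)%N 1) = pmax Ts by [].
  have b3 : (2 < b)%N by lia.
  have le1 : ((2 * (m * m * m) * size Ts + 1) <= pmax Ts)%N by rewrite /pmax leq_pmull.
  have pb : (pmax Ts <= b)%N by lia.
  have npb : (n * pmax Ts + 1 <= b)%N by lia.
  have m3b : (2 * (m * m * m) <= b)%N by rewrite /m; lia.
  have m2m : (m * m <= m * m * m)%N by rewrite leq_pmulr // /m addn2.
  have h2 : sm b 2 by apply: (@sm_nat _ 2); lia.
  have h1 : sm b 1 by apply: (@sm_nat _ 1); lia.
  have hm : sm b m by apply: sm_nat; rewrite /m; lia.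
  have hn : sm b n by apply: sm_nat; lia.
  have nsm (x : nat) : (x <= b)%N -> sm b x by apply: sm_nat.
  apply: (@run_conv O _ FIND (enc_opt (find_new A X U Ts))).
  - rewrite /FIND /hd /tl /=; stepsb b; rewrite ?mE ?m3E ?LE ?LcE ?pE.
    1-14: try by [exact: h2|exact: h1|exact: hm|exact: hn].
    + by rewrite /= -PoszM; apply: nsm; lia.
    + by apply: nsm; lia.
    + by apply: nsm; lia.
    + by apply: nsm; lia.
    + by apply: nsm; apply: leq_trans pb; apply: leq_trans le1; apply: leq_addr.
    + by rewrite /= -PoszD; apply: nsm; apply: leq_trans pb.
    + exact: Hi pb.
    apply: (@Fold_run O nat (fun j => VInt j)
      (fun s1 => enc_opt (foldl (fun acc j => find_sum A X U Ts acc j.+1) None s1))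
      (enc_st A X;; encv U;; vlist [seq VInt (key U T) | T <- Ts])); last first.
      by rewrite size_iota; exact: pb.
    move=> s1 j s2 es; have jp : (j < pmax Ts)%N.
      have : j \in iota 0 (pmax Ts) by rewrite es mem_cat inE eqxx orbT.
      by rewrite mem_iota.
    set acc := foldl _ _ s1; have jE : eval_op Defs.Add j 1 = j.+1 by rewrite /= -PoszD addn1.
    have le_np : (n * j.+1 + 1 <= b)%N.
      by apply: leq_trans npb; rewrite leq_add2r leq_mul2l jp orbT.
    have nE : eval_op Defs.Add (eval_op Defs.Mul n j.+1) 1 = (n * j.+1 + 1)%N by [].
    apply: run_conv.
    + rewrite /PB /hd /tl /=; stepsb b; rewrite ?jE ?nE.
      * by apply: nsm; lia.
      * exact: h1.
      * exact: hn.
      * by apply: nsm; lia.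
      * by rewrite /= -PoszM; apply: nsm; apply: leq_trans le_np; apply: leq_addr.
      * exact: h1.
      * exact: Hi le_np.
      apply: (@Fold_run O nat (fun s => VInt s)
        (fun s1 => enc_opt (foldl (cand_step A X U Ts j.+1) acc s1))
        (VInt j.+1;; enc_st A X;; encv U;; vlist [seq VInt (key U T) | T <- Ts])); last first.
        by rewrite size_iota; exact: le_np.
      move=> t1 s t2 et; have sp : (s <= n * j.+1)%N.
        have : s \in iota 0 (n * j.+1 + 1) by rewrite et mem_cat inE eqxx orbT.
        by rewrite mem_iota addn1 ltnS.
      have [hU' ts] := hp j.+1 s jp sp.
      rewrite -cats1 foldl_cat; apply: (Hc O a b u k n A X U Ts j.+1 s _ _ kn) => //.
      lia.
    + by rewrite -cats1 foldl_cat.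
    + exact: leqnn.
    + by [].
  - by [].
  - exact: leqnn.
  - by [].
by rewrite /=; poly.
Qed.

(** * Correctness of the search for a new key *)

Section FindCorrect.
Variables (R : realType) (k n : nat) (Aq : 'M[rat]_(k, n)).
Let A := int_mx Aq.
Let F := bases (map_mx ratr Aq : 'M[R]_(k, n)).
Variable (X : int) (U : 'I_n -> int) (Ts : seq {set 'I_n}).
Hypothesis XE : X = \det (1%:M + A *m A^T) + 1.
Hypothesis kn : (k <= n)%N.

Lemma testP p s (S : {set 'I_n}) : (0 < p)%N ->
  reflect (exists2 T : {set 'I_n}, T \in F /\ (\sum_(e in T) umod U p e = s)%N & T \subset S)
    (test A X U p s S).
Proof.
move=> p0; have sumE (g : {ffun 'I_k -> 'I_n}) : \det (colsub g A) != 0 ->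
    (\sum_(e in [set g i | i : 'I_k]) umod U p e = \sum_i umod U p (g i))%N.
  move=> /det_colsub_inj gI; rewrite big_imset /=; first by apply: eq_bigl => i; rewrite inE.
  by move=> i j _ _; apply: gI.
apply: (iffP (digit_neq0 XE kn s S p0 (fun e => umod_lt U e p0))).
  case=> g dg [gS gs]; exists [set g i | i : 'I_k].
    by split; [apply/basesP; exists g|rewrite sumE].
  by apply/subsetP => e /imsetP[i _ ->].
case=> T [/basesP[g dg ->] + ] TS; rewrite sumE // => gs; exists g => //; split=> // i.
by apply: (subsetP TS); apply: imset_f.
Qed.

Lemma candidate_some p s S : (0 < p)%N -> candidate A X U Ts p s = Some S ->
  S \in F /\ key U S \notin [seq key U T | T <- Ts].
Proof.
rewrite /candidate => p0; case: ifP => // /andP[tG kG] [<-]; split=> //.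
by have [] := greedy_good (fun S => testP s S p0) tG.
Qed.

Lemma find_new_some S : find_new A X U Ts = Some S ->
  S \in F /\ key U S \notin [seq key U T | T <- Ts].
Proof.
rewrite /find_new; set s := iota 0 _.
have : forall j, j \in s -> (0 < j.+1)%N by [].
elim/last_ind: s S => // s j IH S _; rewrite -cats1 foldl_cat /=.
set acc := foldl _ _ s; rewrite /find_sum; set t := iota _ _.
elim/last_ind: t S => [|t x IHt] S; first by apply: IH.
rewrite -cats1 foldl_cat /=; set acc' := foldl _ _ t.
by rewrite {1}/cand_step; case E: acc' => [S'|]; [move=> [<-]; apply: IHt|apply: candidate_some].
Qed.

Lemma foldl_cand_some p S t : foldl (cand_step A X U Ts p) (Some S) t = Some S.
Proof. by elim: t. Qed.

Lemma foldl_find_some S t :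
  foldl (fun acc j => find_sum A X U Ts acc j.+1) (Some S) t = Some S.
Proof. by elim: t => //= j t IH; rewrite {2}/find_sum foldl_cand_some. Qed.

Lemma find_new_candidate p s : (0 < p <= pmax Ts)%N -> (s <= n * p)%N ->
  find_new A X U Ts = None -> candidate A X U Ts p s = None.
Proof.
case: p => // p /andP[_ pp] sp; case E: (candidate _ _ _ _ _ _) => [S|] //.
have p_in : p \in iota 0 (pmax Ts) by rewrite mem_iota.
have s_in : s \in iota 0 (n * p.+1 + 1) by rewrite mem_iota addn1 ltnS.
rewrite /find_new; case/splitPr: p_in => s1 s2; rewrite foldl_cat /=.
set acc := foldl _ None s1.
have [S' ->] : exists S', find_sum A X U Ts acc p.+1 = Some S'.
  rewrite /find_sum; case/splitPr: s_in => t1 t2; rewrite foldl_cat /=.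
  rewrite {2}/cand_step; case: (foldl _ acc t1) => [S'|]; first by exists S'; rewrite foldl_cand_some.
  by rewrite E; exists S; rewrite foldl_cand_some.
by rewrite foldl_find_some.
Qed.

(** The case p = 0 is split off: the residue modulo 0 is the number itself, and [umod] drops its
    sign. *)
Lemma umod_sum p (S : {set 'I_n}) :
  (p%:Z %| key U S - (\sum_(e in S) umod U p e)%N%:Z)%Z || (p == 0%N).
Proof.
case: posnP => [->|p0]; rewrite ?orbT // orbF.
have -> : (\sum_(e in S) umod U p e)%N%:Z = \sum_(e in S) modz (U e) p.
  rewrite (big_morph Posz PoszD (erefl _)); apply: eq_bigr => e _.
  by rewrite /umod abszE ger0_norm // modz_ge0 // eqz_nat -lt0n.
rewrite key_sum -sumrB; apply: (big_ind (fun x => dvdz p x)) => [|x y|e _]; first exact: dvdz0.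
  exact: rpredD.
rewrite /modz; have -> : U e - (U e - divz (U e) p * p%:Z) = divz (U e) p * p%:Z by ring.
exact: dvdz_mull.
Qed.

(** A basis S with a new key would be found: choose p that separates S from all representatives and
    let s be its reduced sum. The greedy deletion then isolates a basis G with the same reduced sum,
    whose key is congruent to that of S modulo p. If the key of G were that of some T, then p would
    divide the difference of the keys of S and T. *)
Lemma find_new_none L : L = (2 * ((n + 2) * (n + 2) * (n + 2)))%N ->
  (forall S T, sm L (key U S - key U T)) ->
  find_new A X U Ts = None -> forall S, S \in F -> key U S \in [seq key U T | T <- Ts].
Proof.
move=> LE hL fN S SF; apply/negPn/negP => Sk.
have [p pp dvp] : exists2 p, (0 < p <= 2 * (L * size Ts).+1)%N &
    forall T, T \in Ts -> ~~ (p %| `|key U S - key U T|)%N.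
  apply: exists_modulus => [T|T TTs]; first exact: hL.
  by rewrite subr_eq0; apply: contraNneq Sk => ->; apply: map_f.
have p0 : (0 < p)%N by case/andP: pp.
pose s := (\sum_(e in S) umod U p e)%N.
have sp : (s <= n * p)%N.
  apply: leq_trans (_ : \sum_(e in S) p <= _)%N.
    by apply: leq_sum => e _; apply: ltnW; apply: umod_lt.
  by rewrite sum_nat_const leq_mul2r (leq_trans (max_card _)) ?card_ord ?orbT.
have := find_new_candidate _ sp fN; rewrite /pmax -LE addn1 => /(_ pp).
rewrite /candidate; set G := greedy _ _.
have t0 : test A X U p s setT.
  by apply/testP => //; exists S; rewrite ?subsetT.
have tG : test A X U p s G := greedy_test _ t0.
have [GF Gs] := greedy_good (fun S => testP s S p0) tG.
rewrite tG /=; case: ifP => // /negbFE /mapP[T TTs kT] _.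
have /negP := dvp T TTs; apply; rewrite -kT.
have := umod_sum p S; have := umod_sum p G; rewrite Gs -/s gtn_eqF // !orbF => h1 h2.
rewrite -[(p %| _)%N]/((p %| key U S - key U G)%Z).
have -> : key U S - key U G = (key U S - s%:Z) - (key U G - s%:Z) by ring.
exact: rpredB.
Qed.

End FindCorrect.

(** * Setup: integer matrix and radix *)

Definition DEN := Call (Fold (Call (Fold (hd 1 V0 *' Snd (hd 0 V0)))
  (hd 0 V0,, hd 1 V0,, Cst 0))) (V0,, Cst 1,, Cst 0).

Definition enc_rat_mx k n (A : 'M[rat]_(k, n)) : tree :=
  vlist [seq vlist [seq enc_rat (A i j) | j <- enum 'I_n] | i <- enum 'I_k].

Lemma DEN_run : exists2 c, poly_bounded c &
  forall O e b k n (A : 'M[rat]_(k, n)),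
  (forall i j, sm e (denq (A i j))) -> (k <= b)%N -> (n <= b)%N ->
  (e + (e * n + 1) + (e * n + 1) * k + 2 <= b)%N ->
  run O [:: enc_rat_mx A] DEN (VInt (den_prod A)) (c b) 0.
Proof.
eexists; last first.
  move=> O e b k n A hA kb nb eb.
  have hrow i : sm (e * n + 1) (\prod_j denq (A i j)).
    by rewrite -big_enum; apply: smW (sm_prod_seq _ (hA i)) _; rewrite size_enum_ord addn1.
  have hpre s : (size s <= k)%N -> sm ((e * n + 1) * k).+1 (\prod_(i <- s) \prod_j denq (A i j)).
    by move=> sk; apply: smW (sm_prod_seq s hrow) _; rewrite ltnS leq_mul2l sk orbT.
  apply: run_conv.
  - rewrite /DEN /hd /tl /=; steps.
    have := @Fold_run O 'I_k (fun i => vlist [seq enc_rat (A i j) | j <- enum 'I_n])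
      (fun s => VInt (\prod_(i <- s) \prod_j denq (A i j))) (VInt 0).
    rewrite big_nil; apply; last by rewrite size_enum_ord; exact: kb.
    move=> s1 i s2 es; have [_ _] := split_cat es; rewrite size_enum_ord => lts.
    apply: run_conv.
    + steps.
      have := @Fold_run O 'I_n (fun j => enc_rat (A i j))
        (fun t => VInt (\prod_(i <- s1) \prod_j denq (A i j) * \prod_(j <- t) denq (A i j))) (VInt 0).
      rewrite big_nil mulr1; apply; last by rewrite size_enum_ord; exact: nb.
      move=> t1 j t2 et; have [_ _] := split_cat et; rewrite size_enum_ord => ltt.
      apply: run_conv.
      * stepsb b.
          apply: smM (hpre s1 (ltnW lts)) (sm_prod_seq t1 (hA i)) _.
          have : (e * size t1 <= e * n)%N by rewrite leq_mul2l (ltnW ltt) orbT.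
          by lia.
        by apply: smW (hA i j) _; lia.
      * by rewrite /= -cats1 big_cat big_seq1 mulrA.
      * exact: leqnn.
      * by [].
    + by rewrite /= big_enum -cats1 big_cat big_seq1.
    + exact: leqnn.
    + by [].
  - by rewrite big_enum.
  - exact: leqnn.
  - by [].
by rewrite /=; poly.
Qed.

Definition INTROWS := Call (Map2 (Call
   (Map2 ((tl 2 V0 *' Fst (hd 0 V0)) /' Snd (hd 0 V0))) (hd 0 V0,, hd 0 V0,, tl 2 V0)))
  (hd 0 V0,, hd 0 V0,, tl 1 V0).

Lemma INTROWS_run : exists2 c, poly_bounded c &
  forall O e f b k n (A : 'M[rat]_(k, n)),
  (forall i j, sm e (denq (A i j))) -> (forall i j, sm e (numq (A i j))) ->
  sm f (den_prod A) -> (k <= b)%N -> (n <= b)%N -> (e + f <= b)%N ->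
  run O [:: enc_rat_mx A;; VInt (den_prod A)] INTROWS (encm (int_mx A)) (c b) 0.
Proof.
have [cm pm Hm] := Map2_run.
eexists; last first.
  move=> O e f b k n A hden hnum hf kb nb eb.
  apply: run_conv.
  - rewrite /INTROWS /hd /tl /=; steps.
    apply: (Hm O b _ _ (enum 'I_k) _ _ (fun i => encv (int_mx A i))); last by rewrite size_enum_ord.
    move=> i _; apply: run_conv.
    + steps; apply: (Hm O b _ _ (enum 'I_n) _ _ (fun j => VInt (int_mx A i j))); last by rewrite size_enum_ord.
      move=> j _; apply: run_conv.
      * stepsb b.
        - by apply: smW hf _; lia.
        - by apply: smW (hnum i j) _; lia.
        - by apply: smM hf (hnum i j) _; lia.
        - by apply: smW (hden i j) _; lia.
      * by rewrite mxE.
      * exact: leqnn.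
      * by [].
    + by [].
    + exact: leqnn.
    + by [].
  - by [].
  - exact: leqnn.
  - by [].
by rewrite /=; poly.
Qed.

Definition SETUP :=
  Let (Call INTROWS (tl 2 V0,, Call DEN (tl 2 V0)))
 (Let (Call IDM (hd 0 (Var 1)))
 (Let (Call DET (Var 1,, Call ONES (hd 0 (Var 2)),, V0) +' Cst 1)
  (hd 0 (Var 3),, hd 1 (Var 3),, Var 2,, Var 1,, V0))).

Definition base k n (A : 'M[int]_(k, n)) : int := \det (1%:M + A *m A^T) + 1.

Lemma base_gram1 k n (A : 'M[int]_(k, n)) :
  base A = \det (gram1 (fun i => row i A) (enum 'I_k)) + 1.
Proof.
have e : \matrix_i row i A = A by apply/matrixP => x y; rewrite !mxE.
by rewrite gram1_mx e /base; congr (_ + _); apply: det_1DmulC.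
Qed.

Definition base_size a n k := ((2 * a + 2 * n + 1) * k + 2)%N.

Lemma base_sm k n (A : 'M[int]_(k, n)) a : (forall i j, sm a (A i j)) ->
  sm (base_size a n k) (base A).
Proof.
move=> hA; rewrite base_gram1; have hr i j : sm a (row i A 0 j) by rewrite mxE.
have [h _] := gram1_det_sm hr (enum 'I_k); rewrite size_enum_ord in h.
by apply: smD h (sm_nat _) _; rewrite /base_size ?addn2.
Qed.

Definition int_size e n k := (e + (e * n + 1) * k + 1)%N.

Lemma int_mx_sm k n (A : 'M[rat]_(k, n)) e :
  (forall i j, sm e (denq (A i j))) -> (forall i j, sm e (numq (A i j))) ->
  sm ((e * n + 1) * k + 1) (den_prod A) /\ (forall i j, sm (int_size e n k) (int_mx A i j)).
Proof.
move=> hden hnum; have hD : sm ((e * n + 1) * k + 1) (den_prod A).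
  rewrite /den_prod -big_enum /=; have hrow i : sm (e * n + 1) (\prod_j denq (A i j)).
    by rewrite -big_enum; apply: smW (sm_prod_seq _ (hden i)) _; rewrite size_enum_ord addn1.
  by apply: smW (sm_prod_seq _ hrow) _; rewrite size_enum_ord [X in (_ <= X)%N]addn1.
split=> // i j; rewrite mxE; apply: sm_div; apply: smM hD (hnum i j) _.
by rewrite /int_size addnC addnA.
Qed.

Lemma SETUP_run : exists2 c, poly_bounded c &
  forall O e b k n (A : 'M[rat]_(k, n)), let a := int_size e n k in
  (forall i j, sm e (denq (A i j))) -> (forall i j, sm e (numq (A i j))) ->
  (k <= n)%N -> (n < b)%N -> 
  (4 * ((4 * a.+1 + 2 * n + 1) * k + 2 * a.+1 + 1) + 2 * n + 10 + base_size a n k + 2 * (e * n + 1) <= b)%N ->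
  run O [:: enc_mx A] SETUP (enc_st (int_mx A) (base (int_mx A))) (c b) 0.
Proof.
have [cd pd Hd] := DEN_run; have [ci pi Hi] := INTROWS_run; have [cI pI HI] := IDM_run.
have [cD pD HD] := DET_run; have [co po Ho] := ONES_run.
eexists; last first.
  move=> O e b k n A a hden hnum kn nb ab; have [hD hA] := int_mx_sm hden hnum.
  have kb : (k <= b)%N by lia.
  have a_b : (2 * a.+1 <= b)%N by lia.
  have b2 : (2 < b)%N by lia.
  have hb' : (4 * ((4 * a.+1 + 2 * n + 1) * k + 2 * a.+1 + 1) + 2 * n + 10 <= b)%N by lia.
  have enb : (2 * (e * n + 1) <= b)%N by lia.
  have bs : (base_size a n k <= b)%N by lia.
  apply: run_conv.
  - rewrite /SETUP /hd /tl /=; stepsb b.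
    + apply: (Hd O e b k n A hden kb (ltnW nb)).
      by move: ab a_b enb; rewrite {1 2}/a /int_size; lia.
    + apply: (Hi O e _ b k n A hden hnum hD kb (ltnW nb)).
      by move: a_b; rewrite /a /int_size; lia.
    + exact: HI nb.
    + exact: Ho (ltnW nb).
    + apply: (HD O a.+1 b n k (int_mx A) (fun=> 1) (fun i => row i (int_mx A)) _ _ _ kb hb').
      * by move=> i j; apply: smW (hA i j) _.
      * by move=> j; apply: (@sm_nat _ 1).
      * by move=> i j; rewrite mxE mulr1.
    + have hr i j : sm a (row i (int_mx A) 0 j) by rewrite mxE.
      have [h _] := gram1_det_sm hr (enum 'I_k); apply: smW h _; rewrite size_enum_ord.
      by apply: leq_trans bs; rewrite /base_size addn2 ltnW.
    + by apply: (@sm_nat _ 1); lia.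
  - by rewrite /enc_st base_gram1.
  - exact: leqnn.
  - by [].
by rewrite /=; poly.
Qed.

(** * Computing keys, and list access *)

Definition KEYW :=
  Let (hd 0 V0 *' hd 1 V0 +' Cst 1)
 (Let (Call IOTA (hd 0 (Var 1)))
 (Let (Call (Map2 (Call POW (tl 2 V0,, hd 0 V0))) (V0,, V0,, Var 1))
  (Call (Map2 (Call DOT (hd 0 V0,, tl 2 V0))) (tl 2 (Var 3),, tl 2 (Var 3),, V0)))).

Definition radix_size gb n := (n + gb + 2)%N.
Definition keyw_size gb n := (gb + (radix_size gb n * n + 1) + n)%N.

Lemma radix_sm gb n g : sm gb g -> sm (radix_size gb n) (n%:Z * g + 1).
Proof.
move=> hg; apply: (@smD (n + gb + 1)); last by rewrite /radix_size; lia.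
  by apply: smM (sm_nat (leqnn n)) hg _; lia.
by apply: (@sm_nat _ 1); lia.
Qed.

Lemma radixX_sm gb n g (j : 'I_n) : sm gb g ->
  sm (radix_size gb n * n + 1) ((n%:Z * g + 1) ^+ j).
Proof.
move=> hg; apply: (smX (radix_sm n hg)); first by rewrite addn1.
by rewrite addn1 leqW // leq_mul2l ltnW ?orbT.
Qed.

Lemma keyw_sm gb n g (P : 'M[int]_n) : sm gb g -> (forall i j, sm gb (P i j)) ->
  forall e, sm (keyw_size gb n) (keyw g P e).
Proof.
move=> hg hP e; apply: (@sm_sumI (gb + (radix_size gb n * n + 1))) => [j|//].
exact: smM (hP _ _) (radixX_sm j hg) _.
Qed.

Lemma KEYW_run : exists2 c, poly_bounded c &
  forall O gb b n g (P : 'M[int]_n), sm gb g -> (forall i j, sm gb (P i j)) ->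
  (keyw_size gb n + radix_size gb n <= b)%N ->
  run O [:: VInt n;; VInt g;; encm P] KEYW (encv (keyw g P)) (c b) 0.
Proof.
have [ci pi Hi] := IOTA_run; have [cp pp Hp] := POW_run.
have [cm pm Hm] := Map2_run; have [cd pd Hd] := DOT_run.
eexists; last first.
  move=> O gb b n g P hg hP kb; move: (kb); rewrite {1}/keyw_size => kb'.
  have hr := radix_sm n hg; have rb : (n + gb + 2 <= b)%N.
    by move: kb'; rewrite {2}/radix_size; lia.
  have nb : (n <= b)%N by lia.
  have sn : (size (enum 'I_n) <= b)%N by rewrite size_enum_ord.
  have rE : eval_op Defs.Add (eval_op Defs.Mul n g) 1 = n%:Z * g + 1 by [].
  apply: run_conv.
  - rewrite /KEYW /hd /tl /=; stepsb b; rewrite ?rE.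
    + exact: sm_nat.
    + by apply: smW hg _; lia.
    + by apply: smM (sm_nat (leqnn n)) hg _; lia.
    + by apply: (@sm_nat _ 1); lia.
    + exact: Hi nb.
    + rewrite iota_enum.
      apply: (Hm O b _ _ (enum 'I_n) _ _ (fun j : 'I_n => VInt ((n%:Z * g + 1) ^+ j))) => // j _.
      apply: run_conv.
      * steps; apply: (Hp O _ b _ _ hr).
        - lia.
        - by apply: leq_trans (ltnW (ltn_ord j)) nb.
        - apply: leq_trans (_ : radix_size gb n * n <= _)%N; last by lia.
          by rewrite leq_mul2l ltnW ?orbT.
      * by [].
      * exact: leqnn.
      * by [].
    + apply: (Hm O b _ _ (enum 'I_n) _ _ (fun e => VInt (keyw g P e))) => // e _.
      apply: run_conv.
      * steps; apply: (Hd O gb (radix_size gb n * n + 1)%N b _ (enum 'I_n) (P e)) => //.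
          by move=> j; apply: radixX_sm.
        by rewrite size_enum_ord; lia.
      * by rewrite big_enum.
      * exact: leqnn.
      * by [].
  - by [].
  - exact: leqnn.
  - by [].
by rewrite /=; poly.
Qed.

Definition KEYS := Call (Map2 (Call DOT (hd 0 V0,, tl 2 V0))) (hd 0 V0,, hd 0 V0,, tl 1 V0).

Definition enc_sets n (Ts : seq {set 'I_n}) := vlist [seq enc_set T | T <- Ts].
Definition enc_keys n (U : 'I_n -> int) Ts := vlist [seq VInt (key U T) | T <- Ts].

Lemma key_run : exists2 c, poly_bounded c &
  forall O u b n (U : 'I_n -> int) T, (forall e, sm u (U e)) -> (1 + u + n <= b)%N ->
  run O [:: enc_set T;; encv U] DOT (VInt (key U T)) (c b) 0.
Proof.
have [cd pd Hd] := DOT_run; exists cd => // O u b n U T hU ub.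
rewrite /key -big_enum; apply: (Hd O 1%N u b _ (enum 'I_n)) => //.
  by move=> e; apply: sm_bool.
by rewrite size_enum_ord.
Qed.

Lemma KEYS_run : exists2 c, poly_bounded c &
  forall O u b n (U : 'I_n -> int) (Ts : seq {set 'I_n}),
  (forall e, sm u (U e)) -> (1 + u + n <= b)%N -> (size Ts <= b)%N ->
  run O [:: enc_sets Ts;; encv U] KEYS (enc_keys U Ts) (c b) 0.
Proof.
have [cd pd Hd] := key_run; have [cm pm Hm] := Map2_run.
eexists; last first.
  move=> O u b n U Ts hU ub Tb; apply: run_conv.
  - rewrite /KEYS /hd /tl /=; steps.
    apply: (Hm O b _ _ Ts (@enc_set n) (@enc_set n) (fun T => VInt (key U T))) => // T _.
    apply: run_conv.
    + by steps; exact: Hd hU ub.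
    + by [].
    + exact: leqnn.
    + by [].
  - by [].
  - exact: leqnn.
  - by [].
by rewrite /=; poly.
Qed.

Definition LEN := Call (Fold (hd 1 V0 +' Cst 1)) (V0,, Cst 0,, Cst 0).

Lemma LEN_run : exists2 c, poly_bounded c &
  forall O b (T : Type) (E : T -> tree) s, (size s < b)%N ->
  run O [:: vlist (map E s)] LEN (VInt (size s)) (c b) 0.
Proof.
eexists; last first.
  move=> O b T E s sb; apply: run_conv.
  - rewrite /LEN /hd /tl /=; steps.
    apply: (@Fold_run O T E (fun s => VInt (size s))); last exact: ltnW sb.
    move=> s1 x s2 es; have [_ _ ls] := split_cat es; apply: run_conv.
    + stepsb b; first by apply: sm_nat; lia.
      by apply: (@sm_nat _ 1); lia.
    + by rewrite size_rcons /= -PoszD addn1.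
    + exact: leqnn.
    + by [].
  - by [].
  - exact: leqnn.
  - by [].
by rewrite /=; poly.
Qed.

(** A zipper: keeping the prefix reversed lets [NTH] read a head and [INSERT] restore the list by a
    single [RevApp]. *)
Definition SPLIT := Call (Fold (Snd (Fst (hd 1 V0)),, Fst (Fst (hd 1 V0)),, Snd (hd 1 V0)))
  (Call IOTA (hd 0 V0),, (tl 1 V0,, Cst 0),, Cst 0).

Lemma SPLIT_run : exists2 c, poly_bounded c &
  forall O b (T : Type) (E : T -> tree) s i, (i <= size s)%N -> (i <= b)%N ->
  run O [:: VInt (i : nat);; vlist (map E s)] SPLIT
    (vlist (map E (drop i s));; vlist (map E (rev (take i s)))) (c b) 0.
Proof.
have [ci pi Hi] := IOTA_run.
eexists; last first.
  move=> O b T E s i si ib; apply: run_conv.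
  - rewrite /SPLIT /hd /tl /=; steps; first exact: Hi ib.
    have := @Fold_run O nat (fun j => VInt j)
      (fun t => vlist (map E (drop (size t) s));; vlist (map E (rev (take (size t) s)))) (VInt 0).
    rewrite drop0 take0; apply; last by rewrite size_iota; exact: ib.
    move=> t1 j t2 et; have [_ _] := split_cat et; rewrite size_iota size_rcons => lt.
    have lts : (size t1 < size s)%N by apply: leq_trans si.
    case E0: (drop (size t1) s) => [|x s2].
      by have := congr1 size E0; rewrite size_drop /=; lia.
    have [d t] : drop (size t1).+1 s = s2 /\ take (size t1).+1 s = rcons (take (size t1) s) x.
      move: (cat_take_drop (size t1) s); rewrite E0; set p := take _ s => es.
      have sp : size p = size t1 by rewrite size_take lts.
      rewrite -es -sp -cat_rcons -(size_rcons p x) drop_size_cat // take_size_cat //.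
    apply: run_conv.
    + by steps.
    + by rewrite d t rev_rcons.
    + exact: leqnn.
    + by [].
  - by rewrite size_iota.
  - exact: leqnn.
  - by [].
by rewrite /=; poly.
Qed.

Definition NTH := Fst (Fst (Call SPLIT V0)).

Lemma NTH_run : exists2 c, poly_bounded c &
  forall O b (T : Type) (E : T -> tree) x0 s i, (i < size s)%N -> (i <= b)%N ->
  run O [:: VInt (i : nat);; vlist (map E s)] NTH (E (nth x0 s i)) (c b) 0.
Proof.
have [cs ps Hs] := SPLIT_run.
eexists; last first.
  move=> O b T E x0 s i si ib; apply: run_conv.
  - rewrite /NTH; steps.
    by have := Hs O b T E s i (ltnW si) ib; rewrite (drop_nth x0 si) /=; apply.
  - by [].
  - exact: leqnn.
  - by [].
by rewrite /=; poly.
Qed.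

Definition INSERT := Let (Call SPLIT (hd 0 V0,, tl 2 V0))
  (Call RevApp (Snd V0,, (hd 1 (Var 1),, Fst V0),, Cst 0)).

Lemma INSERT_run : exists2 c, poly_bounded c &
  forall O b (T : Type) (E : T -> tree) x s i, (i <= size s)%N -> (i <= b)%N ->
  run O [:: VInt (i : nat);; E x;; vlist (map E s)] INSERT
    (vlist (map E (take i s ++ x :: drop i s))) (c b) 0.
Proof.
have [cs ps Hs] := SPLIT_run; have [cr pr Hr] := RevApp_run.
eexists; last first.
  move=> O b T E x s i si ib; apply: run_conv.
  - rewrite /INSERT /hd /tl /=; steps; first exact: Hs si ib.
    apply: (Hr O b T (rev (take i s)) (x :: drop i s) E).
    by rewrite size_rev size_take_min geq_min ib.
  - by rewrite revK.
  - exact: leqnn.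
  - by [].
by rewrite /=; poly.
Qed.

(** Works on the keys that [MAIN] returns, hence without queries. The second component of the
    accumulator records that the key has been met and stops the counting. *)
Definition RANK :=
  Let (Call DOT (Snd V0,, hd 0 (Fst V0)))
  (Fst (Call (Fold (If (Snd (hd 1 V0)) (hd 1 V0)
     (If (hd 0 V0 ==' tl 2 V0) (Fst (hd 1 V0),, Cst 1) (Fst (hd 1 V0) +' Cst 1,, Cst 0))))
   (tl 1 (Fst (Var 1)),, (Cst 0,, Cst 0),, V0))).

Lemma RANK_run : exists2 c, poly_bounded c &
  forall O u b n (U : 'I_n -> int) (Ts : seq {set 'I_n}) S,
  (forall e, sm u (U e)) -> (1 + u + n <= b)%N -> (size Ts < b)%N ->
  run O [:: (encv U;; enc_keys U Ts);; enc_set S] RANK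
    (VInt (index (key U S) [seq key U T | T <- Ts])) (c b) 0.
Proof.
have [ck pk Hk] := key_run.
eexists; last first.
  move=> O u b n U Ts S hU ub Tb.
  have hkey T : sm b (key U T).
    apply: (@sm_sumI u.+1) => [e|]; last by lia.
    by apply: (@smM 1 u) => //; apply: sm_bool.
  pose acc (t : seq int) := VInt (index (key U S) t);; VInt (key U S \in t)%:Z.
  apply: run_conv.
  - rewrite /RANK /hd /tl /=; steps; first exact: Hk hU ub.
    rewrite /enc_keys (map_comp VInt (key U)).
    apply: (@Fold_run O int VInt acc (VInt (key U S)) _ _ b); last by rewrite size_map ltnW.
    move=> s1 x s2 es; have [_ _] := split_cat es; rewrite size_map => lts.
    have hx : sm b x.
      have : x \in [seq key U T | T <- Ts] by rewrite es mem_cat inE eqxx orbT.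
      by case/mapP => T _ ->.
    apply: (@run_conv _ _ _ (acc (rcons s1 x))).
    + step; first by steps.
      * move=> h; have hin : key U S \in s1 by move: h; case: (_ \in s1).
        have -> : acc (rcons s1 x) = acc s1.
          by rewrite /acc -cats1 index_cat mem_cat hin.
        by steps.
      * move=> h; have hin : key U S \in s1 = false by move: h; case: (_ \in s1).
        stepsb b.
        - exact: hx.
        - exact: hkey.
        - exact: hkey.
        - exact: hx.
        - by apply: sm_bool; lia.
        - by apply: sm_bool; lia.
        - rewrite eval_eqb; have [xk _|//] := eqVneq x (key U S).
          have -> : acc (rcons s1 x) = (VInt (index (key U S) s1);; VInt 1).
            rewrite /acc -cats1 index_cat mem_cat hin /= xk eqxx addn0 mem_head.
            by rewrite (memNindex (negbT hin)).
          by steps.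
        - rewrite eval_eqb; have [//|xk _] := eqVneq x (key U S).
          have -> : acc (rcons s1 x) =
              (VInt (eval_op Defs.Add (index (key U S) s1) 1);; VInt 0).
            rewrite /acc -cats1 index_cat mem_cat hin /= (negPf xk) inE eq_sym (negPf xk).
            by rewrite (memNindex (negbT hin)) -PoszD.
          stepsb b; first by apply: sm_nat; exact: leq_trans (index_size _ _) (ltnW (ltn_trans lts Tb)).
          by apply: (@sm_nat _ 1); lia.
    + by [].
    + exact: leqnn.
    + by [].
  - by [].
  - exact: leqnn.
  - by [].
by rewrite /=; poly.
Qed.

(** * Binary search *)

Definition BINSC := If (hd 2 V0) (Cst 0) (hd 0 V0 +' Cst 1 <=' hd 1 V0).

Definition BINSB :=
  Let ((hd 0 V0 +' hd 1 V0) /' Cst 2)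
  (Let (Query (hd 3 (Var 1)) (Call NTH (V0,, tl 4 (Var 1))))
  (If V0
     (If (V0 <=' Cst 0) (hd 0 (Var 2),, Var 1,, Cst 0,, tl 3 (Var 2))
        (Var 1 +' Cst 1,, hd 1 (Var 2),, Cst 0,, tl 3 (Var 2)))
     (Var 1,, Var 1,, Cst 1,, tl 3 (Var 2)))).

Definition BINS := Loop BINSC BINSB.

(** The query budget for a search among m representatives; the value 0 at m = 0 makes the first
    round free. *)
Definition depth (m : nat) : nat := if m is 0 then 0 else (trunc_log 2 m).+1.

Lemma depthE m : (0 < m)%N -> depth m = (trunc_log 2 m).+1.
Proof. by case: m. Qed.

Lemma depth_half m : (0 < m)%N -> depth m = (depth m./2).+1.
Proof.
move=> m0; rewrite depthE //; have [m1|m1] := leqP m 1.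
  by have -> : m = 1%N by [lia]; rewrite trunc_log1.
by rewrite depthE ?half_gt0 // trunc_log2S.
Qed.

Lemma leq_depth m m' : (m <= m')%N -> (depth m <= depth m')%N.
Proof.
case: m => // m; case: m' => // m' mm; rewrite /= ltnS; exact: leq_trunc_log.
Qed.

Section BinarySearch.
Variables (n : nat) (w : 'I_n -> int).
Variables (S : {set 'I_n}) (Ts : seq {set 'I_n}).
Hypothesis sorted_Ts : sorted <%R [seq weight w T | T <- Ts].

Definition bins_enc (st : nat * nat * bool) : tree :=
  VInt st.1.1;; VInt st.1.2;; VInt (st.2 : nat);; enc_set S;; enc_sets Ts.

(** In the unequal case the open positions are lo <= i < hi; when lo = hi this common value is the
    place for inserting S. *)
Definition bins_inv (st : nat * nat * bool) : Prop :=
  let: (lo, hi, eq) := st in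
  if eq then (lo < size Ts)%N /\ weight w (nth set0 Ts lo) = weight w S
  else [/\ (lo <= hi <= size Ts)%N,
    forall i, (i < lo)%N -> weight w (nth set0 Ts i) < weight w S &
    forall i, (hi <= i < size Ts)%N -> weight w S < weight w (nth set0 Ts i)].

Definition bins_mu (st : nat * nat * bool) := if st.2 then 0%N else (st.1.2 - st.1.1)%N.
Definition bins_phi (st : nat * nat * bool) := if st.2 then 0%N else depth (st.1.2 - st.1.1).

Lemma depth_step m m' : (0 < m)%N -> (m' <= m./2)%N -> (1 + depth m' <= depth m)%N.
Proof. by move=> m0 mm; rewrite (depth_half m0) add1n ltnS leq_depth. Qed.

Lemma sorted_weight i j : (i < j < size Ts)%N ->
  weight w (nth set0 Ts i) < weight w (nth set0 Ts j).
Proof.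
move=> /andP[ij js]; have si := ltn_trans ij js.
have := sorted_ltn_nth lt_trans (weight w set0) sorted_Ts.
move=> /(_ i j); rewrite !inE size_map si js => /(_ isT isT ij).
by rewrite !(nth_map set0).
Qed.

End BinarySearch.

Lemma BINS_run : exists2 c, poly_bounded c &
  forall b n (F : {set {set 'I_n}}) (w : 'I_n -> int) (S : {set 'I_n}) (Ts : seq {set 'I_n}),
  S \in F -> {subset Ts <= F} -> sorted <%R [seq weight w T | T <- Ts] ->
  (2 * size Ts + 4 <= b)%N ->
  exists lo hi eq, [/\ bins_inv w S Ts (lo, hi, eq), eq || (lo == hi) &
    run (comparison F w) [:: bins_enc S Ts (0%N, size Ts, false)] BINS
      (bins_enc S Ts (lo, hi, eq)) (c b) (depth (size Ts))].
Proof.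
have [cn pn Hn] := NTH_run.
pose dn (st : nat * nat * bool) := st.2 || (st.1.1 == st.1.2).
eexists; last first.
  move=> b n F w S Ts SF TsF sorted_Ts Tb; set O := comparison F w.
  have nsm (x : nat) : (x <= b)%N -> sm b x by apply: sm_nat.
  pose Tc := (4 + (1 + (3 + 1 + b.+1 * b.+1 + 3 + b.+1 * b.+1 + 100)))%N.
  pose Tb' := (cn b + 20 * (b.+1 * b.+1) + 500)%N.
  have stp st : bins_inv w S Ts st ->
     (dn st /\ run O (bins_enc S Ts st :: [::]) BINSC (VInt 0) Tc 0) \/
     exists st' z q, [/\ [/\ bins_inv w S Ts st', z != 0 & run O (bins_enc S Ts st :: [::]) BINSC (VInt z) Tc 0],
        (bins_mu st' < bins_mu st)%N, (q + bins_phi st' <= bins_phi st)%N &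
        run O (bins_enc S Ts st :: [::]) BINSB (bins_enc S Ts st') Tb' q].
    case: st => -[lo hi] [] /=.
      move=> _; left; split=> //.
      by apply: run_conv; first by rewrite /BINSC /hd /=; apply: run_if1; [|steps|steps].
    move=> inv; have [/andP[lohi hiT] ltw gtw] := inv.
    have rc : run O [:: bins_enc S Ts (lo, hi, false)] BINSC (VInt (lo < hi)%N) Tc 0.
      apply: (@run_conv _ _ _ (VInt (lo < hi)%N)).
      - rewrite /BINSC /hd /=; apply: run_if0; first by steps.
        have -> : (lo < hi)%N%:Z = eval_op Defs.Leq (eval_op Defs.Add lo 1) hi.
          by rewrite /= -PoszD addn1 lez_nat.
        stepsb b.
        + by apply: nsm; lia.
        + by apply: (nsm 1%N); lia.
        + by rewrite /= -PoszD; apply: nsm; lia.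
        + by apply: nsm; lia.
      - by [].
      - by rewrite /Tc; lia.
      - by [].
    case: (ltnP lo hi) rc => [lt_lohi|le_hilo] rc; last first.
      by left; split=> //; rewrite /dn /= eqn_leq lohi.
    right; pose mid := ((lo + hi) %/ 2)%N.
    have midE : eval_op Defs.Div (eval_op Defs.Add lo hi) 2 = mid.
      by rewrite /= -PoszD divz_nat.
    have mid1 : (lo <= mid < hi)%N by rewrite /mid; lia.
    have midT : (mid < size Ts)%N by lia.
    pose T := nth set0 Ts mid; pose r := Num.sg (weight w S - weight w T).
    have rO : O (enc_set S) (enc_set T) r.
      by exists S, T; split=> //; apply: TsF; apply: mem_nth.
    have srb : sm b r by rewrite /r; case: sgrP => _; [apply: (nsm 0%N)|apply: (nsm 1%N)|rewrite smN; apply: (nsm 1%N)]; lia.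
    have runb st' : bins_enc S Ts st' = (if r != 0 then if eval_op Defs.Leq r 0 != 0
        then VInt lo;; VInt mid;; VInt 0;; enc_set S;; enc_sets Ts
        else VInt (mid.+1);; VInt hi;; VInt 0;; enc_set S;; enc_sets Ts
        else VInt mid;; VInt mid;; VInt 1;; enc_set S;; enc_sets Ts) ->
        run O [:: bins_enc S Ts (lo, hi, false)] BINSB (bins_enc S Ts st') Tb' 1.
      move=> ->; set v := (X in run _ _ _ X); apply: (@run_conv _ _ _ v).
      - rewrite /BINSB /bins_enc /hd /tl /=; stepsb b; rewrite ?midE.
        + by apply: nsm; lia.
        + by apply: nsm; lia.
        + by rewrite /= -PoszD; apply: nsm; lia.
        + by apply: (nsm 2%N); lia.
        + eapply run_query; [by steps| |].
            by steps; apply: (Hn O b _ (@enc_set n) set0 Ts mid midT); lia.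
          exact: rO.
        + move=> r0; rewrite /v r0; step.
          * by stepsb b; [exact: srb|apply: (nsm 0%N); lia].
          * by move=> h; rewrite ifT //; steps.
          * move=> h; rewrite h eqxx.
            have -> : VInt mid.+1 = VInt (eval_op Defs.Add mid 1) by rewrite /= -PoszD addn1.
            stepsb b; [by apply: nsm; lia|by apply: (nsm 1%N); lia].
        + by move=> h; rewrite /v h eqxx; steps.
      - by [].
      - by rewrite /Tb'; lia.
      - by [].
    have m0 : (0 < hi - lo)%N by rewrite subn_gt0.
    have mz : ((lo < hi)%N%:Z != 0) by rewrite lt_lohi.
    have h1 : (mid - lo <= (hi - lo)./2)%N by rewrite /mid -divn2; lia.
    have h2 : (hi - mid.+1 <= (hi - lo)./2)%N by rewrite /mid -divn2; lia.
    rewrite lt_lohi in rc mz.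
    have [wST|wST|wST] := ltgtP (weight w S) (weight w T).
    - exists (lo, mid, false), 1, 1%N; split=> //.
      + split=> //; split=> [|//|i /andP[mi iT]]; first by lia.
        move: mi; rewrite leq_eqVlt => /orP[/eqP <- //|mi].
        by apply: lt_trans wST (sorted_weight sorted_Ts _); rewrite mi.
      + by rewrite /bins_mu /=; lia.
      + exact: depth_step.
      + by apply: runb; rewrite /r ltr0_sg ?subr_lt0.
    - exists (mid.+1, hi, false), 1, 1%N; split=> //.
      + split=> //; split=> [|i|//]; first by lia.
        rewrite ltnS leq_eqVlt => /orP[/eqP -> //|mi].
        by apply: lt_trans (sorted_weight sorted_Ts _) wST; rewrite mi.
      + by rewrite /bins_mu /=; lia.
      + exact: depth_step.
      + by apply: runb; rewrite /r gtr0_sg ?subr_gt0.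
    - exists (mid, mid, true), 1, 1%N; split=> //.
      + by rewrite /bins_phi /= (depth_half m0).
      + by apply: runb; rewrite /r wST subrr sgr0.
  have inv0 : bins_inv w S Ts (0%N, size Ts, false).
    by split=> [|//|i /andP[h1 h2]]; [rewrite leqnn|lia].
  have [[[lo hi] eq] [i' d' r']] := run_loop stp inv0.
  exists lo, hi, eq; split=> //.
  apply: run_conv r' _ _ _ => //; last by rewrite /bins_phi /= subn0.
  apply: leq_trans (_ : (b.+1 * (Tc + Tb').+1) <= _)%N; last by rewrite /Tc /Tb'; exact: leqnn.
  by rewrite leq_mul2r /bins_mu /= subn0 ltnS; lia.
by rewrite /=; poly.
Qed.

(** * Rounds *)

Section Sizes.
Variables (n : nat) (w : 'I_n -> int) (r : nat) (D : 'M[int]_(r, n)).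
Hypothesis hD : equations w D.

Definition eq_size n := (2 * n * n + 1)%N.

(** There are at most n equations, so the determinant is at most n^(2n) <= 2^(2 n^2), and it bounds
    the entries of the projection. *)
Lemma equations_sm :
  sm (eq_size n) (\det (D *m D^T)) /\ (forall i j, sm (eq_size n) (gproj D i j)).
Proof.
have [_ g0 gle] := hD; have rn := gram_rank g0.
have h : `|\det (D *m D^T)| < 2%:Z ^+ (eq_size n).
  rewrite gtr0_norm //; apply: le_lt_trans gle _.
  rewrite -[X in _ < X](_ : (2 ^ eq_size n)%:Z = _); last by rewrite -natz natrX natz.
  rewrite ltz_nat; apply: leq_ltn_trans (_ : 2 ^ (2 * n * n) < _)%N.
    apply: leq_trans (_ : (2 ^ (2 * n)) ^ r <= _)%N; last first.
      by rewrite -expnM leq_exp2l // leq_mul2l rn orbT.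
    case: (posnP r) => [->|r0] //; rewrite leq_exp2r // mul2n -addnn expnD.
    by rewrite leq_mul // ltnW // ltn_expl.
  by rewrite /eq_size addn1 ltn_exp2l.
split=> [|i j]; rewrite smE //; apply: le_lt_trans h.
by apply: le_trans (gproj_le g0 i j) _; apply: ler_norm.
Qed.

Definition key_size n := keyw_size (eq_size n) n.
Let U := keyw (\det (D *m D^T)) (gproj D).

Lemma equations_keyw_sm e : sm (key_size n) (U e).
Proof. by have [h1 h2] := equations_sm; apply: keyw_sm. Qed.

(** The leading term of the size of a key is 2 n^3: n digits in a radix of about 2 n^2 bits. *)
Lemma key_diff_sm S T :
  sm (2 * ((n + 2) * (n + 2) * (n + 2))) (key U S - key U T).
Proof.
have h V : sm (key_size n + 1 + n) (key U V).
  apply: (@sm_sumI (key_size n + 1)) => [e|//].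
  by apply: smM (sm_bool _ _) (equations_keyw_sm e) _; last exact: (eq_leq (addnC 1%N _)).
apply: smB (h S) (h T) _; rewrite /key_size /keyw_size /radix_size /eq_size; nia.
Qed.

End Sizes.

Definition ROUND :=
  Let (Call KEYW (st_n (Snd V0),, tl 2 (Fst V0)))
 (Let (Call FIND (Call LEN (hd 1 (Fst (Var 1))),, Snd (Var 1),, V0,,
          Call KEYS (hd 1 (Fst (Var 1)),, V0)))
 (If (IsPair V0)
   (Let (Call BINS (Cst 0,, Call LEN (hd 1 (Fst (Var 2))),, Cst 0,, Snd V0,, hd 1 (Fst (Var 2))))
     (If (hd 2 V0)
       (Cst 1,, hd 1 (Fst (Var 3)),, Call UPD (Cst 0,,
          Call (Map2 (hd 0 V0 -' hd 1 V0))
            (Snd (Var 1),, Call NTH (hd 0 V0,, hd 1 (Fst (Var 3))),, Cst 0),,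
          tl 2 (Fst (Var 3))))
       (Cst 1,, Call INSERT (hd 0 V0,, Snd (Var 1),, hd 1 (Fst (Var 3))),, tl 2 (Fst (Var 3)))))
   (Cst 0,, hd 1 (Fst (Var 2)),, tl 2 (Fst (Var 2))))).

Definition pmax_of n c := (2 * (2 * ((n + 2) * (n + 2) * (n + 2)) * c + 1))%N.

Definition round_size a n k c : nat :=
  (test_size a n k (pmax_of n c) (n * pmax_of n c)
   + (key_size n + pmax_of n c + n * pmax_of n c + 2 * ((n + 2) * (n + 2) * (n + 2)) + n + 5)
   + radix_size (eq_size n) n + (2 * c + 4) + (4 * eq_size n + 2 * n + 10))%N.

Lemma sorted_insert n (w : 'I_n -> int) (Ts : seq {set 'I_n}) S lo : 
  sorted <%R [seq weight w T | T <- Ts] -> bins_inv w S Ts (lo, lo, false) ->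
  sorted <%R [seq weight w T | T <- take lo Ts ++ S :: drop lo Ts].
Proof.
move=> sT [/andP[_ lo_s] hlt hgt].
rewrite (sorted_pairwise lt_trans) map_cat map_cons pairwise_cat /=.
move: (sT); rewrite (sorted_pairwise lt_trans) -{1}(cat_take_drop lo Ts) map_cat pairwise_cat.
move=> /and3P[h1 -> ->]; rewrite !andbT.
have lS : all (fun x => x < weight w S) [seq weight w T | T <- take lo Ts].
  rewrite all_map; apply/(all_nthP set0) => i; rewrite size_take_min leq_min => /andP[il _].
  by rewrite /= nth_take //; apply: hlt.
have Sg : all (fun x => weight w S < x) [seq weight w T | T <- drop lo Ts].
  rewrite all_map; apply/(all_nthP set0) => i; rewrite size_drop => il.
  by rewrite /= nth_drop; apply: hgt; rewrite leq_addr /=; lia.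
by rewrite Sg allrel_consr h1 lS.
Qed.

Section Round.
Variables (R : realType) (k n : nat) (Aq : 'M[rat]_(k, n)) (w : 'I_n -> int).
Let A := int_mx Aq.
Let X := base A.
Let F := bases (map_mx ratr Aq : 'M[R]_(k, n)).
Let C := num_weights F w.

Definition keyf r (D : 'M[int]_(r, n)) := keyw (\det (D *m D^T)) (gproj D).

(** The number of rows is a field, since a new equation changes the type of the matrix. The flag is
    cleared once the search for a new key fails. *)
Record state := State {
  flag : bool; reps : seq {set 'I_n}; rnk : nat; eqs : 'M[int]_(rnk, n) }.

Definition enc_state (s : state) : tree :=
  VInt (flag s : nat);; enc_sets (reps s);; VInt (\det (eqs s *m (eqs s)^T));;
  encm (gproj (eqs s)).

Definition complete (s : state) : Prop :=
  forall S, S \in F -> key (keyf (eqs s)) S \in [seq key (keyf (eqs s)) T | T <- reps s].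

Definition loop_inv (s : state) : Prop :=
  [/\ {subset reps s <= F}, sorted <%R [seq weight w T | T <- reps s],
      equations w (eqs s) & ~~ flag s -> complete s].

(** Every round adds an equation, adds a representative or clears the flag; there are at most n of
    the first and C of the second. *)
Definition rounds_left (s : state) : nat := (flag s + (n - rnk s) + (C - size (reps s)))%N.

(** The case distinction is forced by the bound in B: n B log(n B) vanishes for n B = 1, where there
    is only one basis and no query may be charged. *)
Definition per_round : nat := if (#|F| <= 1)%N then 0 else (trunc_log 2 C).+1.

Definition queries_left (s : state) : nat := (per_round * ((n - rnk s) + (C - size (reps s))))%N.

Lemma size_reps (Ts : seq {set 'I_n}) : {subset Ts <= F} ->
  sorted <%R [seq weight w T | T <- Ts] -> (size Ts <= C)%N.
Proof.
move=> TsF sT; rewrite -(size_map (weight w)) /C /num_weights.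
apply: uniq_leq_size; first exact: lt_sorted_uniq sT.
move=> x /mapP[T TT ->]; rewrite mem_undup; apply/mapP; exists T => //.
by rewrite mem_enum; apply: TsF.
Qed.

(** Without representatives the search costs nothing; otherwise S and a representative with another
    key are two distinct bases. *)
Lemma depth_per_round (Ts : seq {set 'I_n}) S U : {subset Ts <= F} ->
  sorted <%R [seq weight w T | T <- Ts] -> S \in F ->
  key U S \notin [seq key U T | T <- Ts] -> (depth (size Ts) <= per_round)%N.
Proof.
move=> TsF sT SF Sk; have := size_reps TsF sT; case: Ts TsF Sk {sT} => // T Ts TsF Sk sC.
have TF : T \in F by apply: TsF; apply: mem_head.
have ST : S != T by apply: contraNneq Sk => ->; apply: mem_head.
rewrite /per_round ifF; first by rewrite depthE // ltnS leq_trunc_log.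
apply/negbTE; rewrite -ltnNge; apply/card_gt1P; exists S, T; split=> //.
Qed.

End Round.

Lemma round_sizeP a n k c b : (round_size a n k c <= b)%N ->
  [/\ test_size a n k (pmax_of n c) (n * pmax_of n c) <= b,
    key_size n + pmax_of n c + n * pmax_of n c + 2 * ((n + 2) * (n + 2) * (n + 2)) + n + 5 <= b,
    key_size n + radix_size (eq_size n) n <= b, 2 * c + 4 <= b &
    4 * eq_size n + 2 * n + 10 <= b]%N.
Proof.
rewrite /round_size.
generalize (test_size a n k (pmax_of n c) (n * pmax_of n c)) (key_size n)
  (radix_size (eq_size n) n) (n * pmax_of n c)%N (pmax_of n c)
  ((n + 2) * (n + 2) * (n + 2))%N (eq_size n) => x y z t p v e h.
by split; lia.
Qed.

Lemma ROUND_run : exists2 c, poly_bounded c &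
  forall (R : realType) (k n : nat) (Aq : 'M[rat]_(k, n)) (w : 'I_n -> int) a b,
  let A := int_mx Aq in let X := base A in
  let F := bases (map_mx ratr Aq : 'M[R]_(k, n)) in
  (k <= n)%N -> sm a X -> (forall i j, sm a (A i j)) ->
  (round_size a n k (num_weights F w) <= b)%N ->
  forall s : state n, loop_inv R Aq w s -> flag s ->
  exists s' q, [/\ loop_inv R Aq w s', (rounds_left R Aq w s' < rounds_left R Aq w s)%N,
     (q + queries_left R Aq w s' <= queries_left R Aq w s)%N &
     run (comparison F w) [:: enc_state s;; enc_st A X] ROUND (enc_state s') (c b) q].
Proof.
have [ck pk Hk] := KEYW_run; have [cf pf Hf] := FIND_run; have [cl pl Hl] := LEN_run.
have [cK pK HK] := KEYS_run; have [cb pb Hb] := BINS_run; have [cu pu Hu] := UPD_run.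
have [cm pm Hm] := Map2_run; have [cn pn Hn] := NTH_run; have [ci pi Hi] := INSERT_run.
eexists; last first.
  move=> R k n Aq w a b A X F kn hX hA /round_sizeP[tb fb kb Cb ub].
  case=> fl Ts r D /= [/= TsF sT hD _] fl1.
  set C := num_weights F w in tb fb Cb; have TC : (size Ts <= C)%N := size_reps TsF sT.
  have [hg hP] := equations_sm hD; set g := \det _ in hg; set P := gproj D in hP.
  set U := keyw g P; have hU e : sm (key_size n) (U e) := equations_keyw_sm hD e.
  have Tb : (2 * size Ts + 4 <= b)%N by lia.
  have Tb' : (size Ts < b)%N by lia.
  have pmC : (pmax Ts <= pmax_of n C)%N by rewrite /pmax /pmax_of leq_mul2l leq_add2r leq_mul.
  have npmC : (n * pmax Ts <= n * pmax_of n C)%N by rewrite leq_mul2l pmC orbT.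
  have tb' : (test_size a n k (pmax Ts) (n * pmax Ts) <= b)%N.
    exact: leq_trans (test_size_mono _ _ _ pmC npmC) tb.
  have fb' : (key_size n + pmax Ts + n * pmax Ts + 2 * ((n + 2) * (n + 2) * (n + 2)) + n + 5 <= b)%N.
    by lia.
  have kub : (1 + key_size n + n <= b)%N by lia.
  set s := State fl Ts D; set O := comparison F w.
  have run_cand := Hf O a b (key_size n) k n A X U Ts kn hX hA hU fb' tb' Tb'.
  have run_U : run O [:: VInt n;; VInt g;; encm P] KEYW (encv U) (ck b) 0.
    exact: Hk hg hP kb.
  have run_len : run O [:: enc_sets Ts] LEN (VInt (size Ts)) (cl b) 0 by exact: Hl.
  have run_keys : run O [:: enc_sets Ts;; encv U] KEYS (enc_keys U Ts) (cK b) 0.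
    exact: HK hU kub (ltnW Tb').
  pose K := (ck b + cf b + 2 * cl b + cK b + cb b + (cm (b.+1 * b.+1 + 50) b + cn b + cu b + ci b) + 1000)%N.
  (* The computation of the keys and the search for a new one, common to all three outcomes of the
     round. *)
  have prefix e v T Q : run O [:: enc_opt (find_new A X U Ts); encv U; enc_state s;; enc_st A X] e v T Q ->
      (T <= cl b + cb b + (cm (b.+1 * b.+1 + 50) b + cn b + cu b + ci b) + 500)%N ->
      run O [:: enc_state s;; enc_st A X] (Let (Call KEYW (st_n (Snd V0),, tl 2 (Fst V0)))
        (Let (Call FIND (Call LEN (hd 1 (Fst (Var 1))),, Snd (Var 1),, V0,,
          Call KEYS (hd 1 (Fst (Var 1)),, V0))) e)) v K Q.
    move=> re TK; apply: run_conv.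
    - rewrite /enc_state /= /hd /tl /=; steps; [exact: run_U|exact: run_len|exact: run_keys|exact: run_cand|exact: re].
    - by [].
    - by rewrite /K; lia.
    - by [].
  (* First outcome: no new key, so the representatives are complete by [find_new_none], and the flag
     is cleared. *)
  case E: (find_new A X U Ts) => [S|]; last first.
    exists (State false Ts D), 0%N; split.
    - split; [exact: TsF|exact: sT|exact: hD|move=> _ S SF].
      exact: (find_new_none (erefl _) kn (erefl _) (key_diff_sm hD) E SF).
    - by rewrite /rounds_left /= fl1.
    - by [].
    apply: (prefix _ _ 100%N); last by lia.
    rewrite E /hd /tl /=; apply: run_conv.
    - by apply: run_if0; [apply: (@run_ispair _ _ _ (VInt 0)); steps|steps].
    - by [].
    - by [].
    - by [].
  have [SF Sk] := find_new_some R (erefl _) kn E.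
  have [lo [hi [eq [binv beq brun]]]] := Hb b n F w S Ts SF TsF sT Tb.
  have lo_s : (lo <= size Ts)%N by case: (eq) binv => [[/ltnW]|[/andP[? ?] _ _]] //; lia.
  have lob : (lo <= b)%N by lia.
  have dp := depth_per_round TsF sT SF Sk.
  have mid (s' : state n) T Q : run O [:: bins_enc S Ts (lo, hi, eq); enc_opt (Some S); encv U; enc_state s;; enc_st A X]
      (If (hd 2 V0)
       (Cst 1,, hd 1 (Fst (Var 3)),, Call UPD (Cst 0,,
          Call (Map2 (hd 0 V0 -' hd 1 V0))
            (Snd (Var 1),, Call NTH (hd 0 V0,, hd 1 (Fst (Var 3))),, Cst 0),,
          tl 2 (Fst (Var 3))))
       (Cst 1,, Call INSERT (hd 0 V0,, Snd (Var 1),, hd 1 (Fst (Var 3))),, tl 2 (Fst (Var 3))))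
      (enc_state s') T Q -> 
      (T <= (cm (b.+1 * b.+1 + 50) b + cn b + cu b + ci b) + 300)%N ->
      run O [:: enc_state s;; enc_st A X] ROUND (enc_state s') K (depth (size Ts) + Q).
    move=> re TK; apply: run_conv.
    - apply: (prefix _ _ (cl b + cb b + T + 100)%N (depth (size Ts) + Q)%N); last by lia.
      rewrite E; apply: run_conv.
      + rewrite /= /hd /tl /=; apply: (@run_if1 _ _ _ _ _ 1) => //.
          by apply: (@run_ispair _ _ _ (VInt 0;; enc_set S)); steps.
        by eapply run_let; [steps; [exact: run_len|exact: brun]|exact: re].
      + by [].
      + by lia.
      + by rewrite !addn0 !add0n.
    - by [].
    - exact: leqnn.
    - by [].
  case: eq binv beq brun mid => [[loT wlo]|binv] beq brun mid.
    (* Second outcome: equal weights with different keys, which give an independent equation. *)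
    pose T := nth set0 Ts lo.
    have TTs : T \in Ts by apply: mem_nth.
    have kST : key U S != key U T by apply: contraNneq Sk => ->; apply: map_f.
    have eqs' := equations_rcons hD kST (esym wlo).
    exists (State true Ts (col_mx D (chi S - chi T))), (depth (size Ts)); split.
    - by split.
    - rewrite /rounds_left /= fl1; have [_ g' _] := eqs'; have := gram_rank g'; lia.
    - rewrite /queries_left /=; have [_ g' _] := eqs'; have := gram_rank g' => rn.
      have -> : (n - r = (n - (r + 1)).+1)%N by lia.
      by rewrite addSn mulnS leq_add2r.
    have [_ g0 _] := hD.
    have v0 : P *m (chi S - chi T)^T != 0 by apply/eqP => /(key_eqP hD); apply/negP.
    have [ug um] := upd_proj g0 v0.
    have chi_sm e : sm (eq_size n) ((chi S - chi T) 0 e).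
      apply: (@smW 1); last by rewrite /eq_size addn1.
      by rewrite !mxE; case: (e \in S); case: (e \in T).
    rewrite -[X in run _ _ _ _ _ X]addn0.
    apply: (mid _ (cm (b.+1 * b.+1 + 50) b + cn b + cu b + 200)%N 0%N); last by clear; lia.
    apply: run_conv.
    - apply: (@run_if1 _ _ _ _ _ 1) => //; first by rewrite /hd /=; steps.
      rewrite /hd /tl /=; steps.
      + by apply: (Hn O b _ (@enc_set n) set0 Ts lo).
      + apply: (Hm O b (b.+1 * b.+1 + 50)%N _ (enum 'I_n) _ _
          (fun e => VInt ((chi S - chi T) 0 e))); last by rewrite size_enum_ord; clear -fb; lia.
        move=> e _; apply: run_conv.
        * by stepsb b; apply: sm_bool; clear -fb; lia.
        * by rewrite !mxE.
        * by clear; lia.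
        * by [].
      + exact: (Hu O (eq_size n) b false n _ _ _ chi_sm hg hP ub).
    - rewrite /enc_state /= ug; congr (_;; _;; _;; _).
      by congr vlist; apply: eq_map => i; congr vlist; apply: eq_map => j; rewrite um.
    - by clear; lia.
    - by [].
  (* Third outcome: the weight of S is new, and S is inserted where the search ended. *)
  have {}beq : lo = hi by apply/eqP.
  subst hi.
  have sT' := sorted_insert sT binv.
  have TsF' : {subset take lo Ts ++ S :: drop lo Ts <= F}.
    move=> T; rewrite mem_cat inE => /or3P[/mem_take|/eqP ->|/mem_drop] //; apply: TsF.
  have size' : size (take lo Ts ++ S :: drop lo Ts) = (size Ts).+1.
    by rewrite size_cat /= addnS -size_cat cat_take_drop.
  have := size_reps TsF' sT'; rewrite size' -/C => ltC.
  exists (State true (take lo Ts ++ S :: drop lo Ts) D), (depth (size Ts)); split.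
  - by split.
  - by rewrite /rounds_left /= fl1 size' -/C; clear -ltC; lia.
  - rewrite /queries_left /= size' -/C.
    have -> : (C - size Ts = (C - (size Ts).+1).+1)%N by clear -ltC; lia.
    by rewrite addnS mulnS leq_add2r.
  rewrite -[X in run _ _ _ _ _ X]addn0.
  apply: (mid _ (ci b + 200)%N 0%N); last by clear; lia.
  apply: run_conv.
  - apply: run_if0; first by rewrite /hd /=; steps.
    rewrite /hd /tl /=; steps.
    exact: (Hi O b _ (@enc_set n) S Ts lo lo_s lob).
  - by [].
  - by clear; lia.
  - by [].
by rewrite /=; poly.
Qed.

(** * The complete programs *)

Definition MAIN :=
  Let (Call SETUP V0)
 (Let (Cst 1,, Cst 0,, Cst 1,, st_id V0)
 (Let (Loop (hd 0 V0) (Call ROUND (V0,, Var 1)))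
 (Let (Call KEYW (st_n (Var 2),, tl 2 V0))
  (hd 1 (Var 1),, V0,, Call KEYS (hd 1 (Var 1),, V0))))).

Definition mx_size e n k := (int_size e n k + base_size (int_size e n k) n k)%N.

Definition main_size e n k c : nat :=
  (4 * ((4 * (int_size e n k).+1 + 2 * n + 1) * k + 2 * (int_size e n k).+1 + 1) + 2 * n + 10
   + base_size (int_size e n k) n k + 2 * (e * n + 1)
   + round_size (mx_size e n k) n k c + n + c + 2)%N.

Definition init_state n : state n := State true [::] (0 : 'M_(0, n)).

(** Without equations the Gram determinant is that of an empty matrix, namely 1, and the projection
    is the identity. *)
Lemma enc_init_state n :
  enc_state (init_state n) = (VInt 1;; VInt 0;; VInt 1;; encm (1%:M : 'M[int]_n)).
Proof.
rewrite /enc_state /=; have -> : gproj (0 : 'M[int]_(0, n)) = 1%:M.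
  by rewrite /gproj mulmx0 subr0 det_mx00.
by rewrite det_mx00.
Qed.

Lemma MAIN_run : exists2 c, poly_bounded c &
  forall (R : realType) (k n : nat) (Aq : 'M[rat]_(k, n)) (w : 'I_n -> int) e b,
  let F := bases (map_mx ratr Aq : 'M[R]_(k, n)) in let C := num_weights F w in
  (k <= n)%N -> (forall i j, sm e (denq (Aq i j))) -> (forall i j, sm e (numq (Aq i j))) ->
  (main_size e n k C <= b)%N ->
  exists s : state n, [/\ loop_inv R Aq w s, complete R Aq s &
    run (comparison F w) [:: enc_mx Aq] MAIN
     (enc_sets (reps s);; encv (keyf (eqs s));; enc_keys (keyf (eqs s)) (reps s))
     (c b) (per_round R Aq w * (n + C))].
Proof.
have [cs ps Hs] := SETUP_run; have [cr pr Hr] := ROUND_run.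
have [ck pk Hk] := KEYW_run; have [cK pK HK] := KEYS_run.
eexists; last first.
  move=> R k n Aq w e b F C kn hden hnum mb.
  have [sb rb nCb] : [/\ 4 * ((4 * (int_size e n k).+1 + 2 * n + 1) * k + 2 * (int_size e n k).+1 + 1)
      + 2 * n + 10 + base_size (int_size e n k) n k + 2 * (e * n + 1) <= b,
      round_size (mx_size e n k) n k C <= b & n + C + 2 <= b]%N.
    move: mb; rewrite /main_size; clear.
    generalize (round_size (mx_size e n k) n k C) (base_size (int_size e n k) n k) (e * n)%N.
    generalize ((4 * (int_size e n k).+1 + 2 * n + 1) * k)%N (int_size e n k) => x y z t u h.
    by split; lia.
  have nb : (n < b)%N by clear -nCb; lia.
  have [_ hA] := int_mx_sm hden hnum.
  have hX : sm (mx_size e n k) (base (int_mx Aq)).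
    by apply: smW (base_sm hA) _; apply: leq_addl.
  have hA' i j : sm (mx_size e n k) (int_mx Aq i j).
    by apply: smW (hA i j) _; apply: leq_addr.
  have [_ _ kb Cb _] := round_sizeP rb.
  set O := comparison F w; set st := enc_st (int_mx Aq) (base (int_mx Aq)).
  have stp s : loop_inv R Aq w s ->
     (~~ flag s /\ run O (enc_state s :: [:: st; enc_mx Aq]) (hd 0 V0) (VInt 0) 10 0) \/
     exists s' z q, [/\ [/\ loop_inv R Aq w s', z != 0 &
          run O (enc_state s :: [:: st; enc_mx Aq]) (hd 0 V0) (VInt z) 10 0],
        (rounds_left R Aq w s' < rounds_left R Aq w s)%N,
        (q + queries_left R Aq w s' <= queries_left R Aq w s)%N &
        run O (enc_state s :: [:: st; enc_mx Aq]) (Call ROUND (V0,, Var 1)) (enc_state s')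
          (cr b + 10) q].
    move=> Is; have rf : run O (enc_state s :: [:: st; enc_mx Aq]) (hd 0 V0) (VInt (flag s : nat)) 10 0.
      by apply: run_conv; first by rewrite /enc_state /hd /=; steps.
    case fs: (flag s) rf => rf; last by left.
    right; have [s' [q [Is' m' q' r']]] :=
      Hr R k n Aq w _ b kn hX hA' rb s Is fs.
    exists s', 1, q; split=> //.
    apply: run_conv; first by steps; exact: r'.
    - by [].
    - by clear; lia.
    - by [].
  have I0 : loop_inv R Aq w (init_state n) by split=> //; exact: equations0.
  have [s [Is ds rs]] := run_loop stp I0.
  exists s; have [TsF sT hD cp] := Is; split=> //; first exact: cp.
  have TC : (size (reps s) <= C)%N := size_reps TsF sT.
  have [hg hP] := equations_sm hD.
  have hU i : sm (key_size n) (keyf (eqs s) i) := equations_keyw_sm hD i.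
  have rounds : ((rounds_left R Aq w (init_state n)).+1 <= b.+1)%N.
    by rewrite ltnS /rounds_left /= !subn0 -/F -/C; clear -nCb; lia.
  have rs' := run_conv rs erefl (leq_mul rounds (leqnn _)) (leqnn _).
  apply: run_conv.
  - rewrite /MAIN; eapply run_let.
      by steps; exact: (Hs O e b k n Aq hden hnum kn nb sb).
    eapply run_let; first by rewrite /hd /=; steps.
    eapply run_let; first by rewrite enc_init_state in rs'; exact: rs'.
    rewrite /enc_state /hd /tl /=; steps.
      exact: (Hk O _ b n _ _ hg hP kb).
    apply: (HK O _ b n _ (reps s) hU).
      by move: (round_sizeP rb) => [_ h _ _ _]; clear -h; lia.
    by clear -nCb TC; lia.
  - by [].
  - exact: leqnn.
  - by rewrite /queries_left /= !subn0 !addn0 !add0n.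
by rewrite /=; poly.
Qed.

(** * Growth of the size bounds, and size of the output *)

Ltac mono := repeat first
  [ exact: leqnn | assumption
  | match goal with |- is_true (leq (S _) (S _)) => rewrite ltnS end | apply: leq_add | apply: leq_mul ].

Section Monotone.
Variables (e e' n n' k k' c c' : nat).
Hypotheses (ee : (e <= e')%N) (nn : (n <= n')%N) (kk : (k <= k')%N) (cc : (c <= c')%N).

Lemma int_size_mono : (int_size e n k <= int_size e' n' k')%N.
Proof. by rewrite /int_size; mono. Qed.

Lemma base_size_mono a a' : (a <= a')%N -> (base_size a n k <= base_size a' n' k')%N.
Proof. by move=> aa; rewrite /base_size; mono. Qed.

Lemma eq_size_mono : (eq_size n <= eq_size n')%N.
Proof. by rewrite /eq_size; mono. Qed.

Lemma radix_size_mono g g' : (g <= g')%N -> (radix_size g n <= radix_size g' n')%N.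
Proof. by move=> gg; rewrite /radix_size; mono. Qed.

Lemma key_size_mono : (key_size n <= key_size n')%N.
Proof.
have h := eq_size_mono; have h' := radix_size_mono h.
by rewrite /key_size /keyw_size; mono.
Qed.

Lemma pmax_of_mono : (pmax_of n c <= pmax_of n' c')%N.
Proof. by rewrite /pmax_of; mono. Qed.

Lemma test_size_le a a' p p' s s' : (a <= a')%N -> (p <= p')%N -> (s <= s')%N ->
  (test_size a n k p s <= test_size a' n' k' p' s')%N.
Proof.
move=> aa pp ss; have hz : (zsize a n p <= zsize a' n' p')%N by rewrite /zsize; mono.
have hd : (det_size a n k p <= det_size a' n' k' p')%N by rewrite /det_size; mono.
by rewrite /test_size; mono.
Qed.

Lemma round_size_mono a a' : (a <= a')%N -> (round_size a n k c <= round_size a' n' k' c')%N.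
Proof.
move=> aa; have hp := pmax_of_mono; have hk := key_size_mono; have hq := eq_size_mono.
have hr := radix_size_mono hq; have np : (n * pmax_of n c <= n' * pmax_of n' c')%N by mono.
have ht := test_size_le aa hp np.
by rewrite /round_size; mono.
Qed.

Lemma main_size_mono : (main_size e n k c <= main_size e' n' k' c')%N.
Proof.
have hi := int_size_mono; have hb := base_size_mono hi.
have hm : (mx_size e n k <= mx_size e' n' k')%N by rewrite /mx_size; mono.
by have hr := round_size_mono hm; rewrite /main_size; mono.
Qed.

End Monotone.

Lemma main_size_poly f g : poly_bounded f -> poly_bounded g ->
  poly_bounded (fun m => main_size (f m) m m (g m)).
Proof.
move=> pf pg; rewrite /main_size /mx_size /round_size /key_size /keyw_size /radix_size /eq_size
  /test_size /det_size /zsize /pmax_of /base_size /int_size; poly.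
Qed.

Lemma vsize_vlist (T : eqType) (E : T -> tree) (s : seq T) M :
  (forall x, x \in s -> vsize (E x) <= M)%N ->
  (vsize (vlist (map E s)) <= size s * M.+1 + 1)%N.
Proof.
elim: s => [|x s IH] h /=; first by rewrite /bitlen trunc_log0.
rewrite -/(vlist _) mulSn -addnA !addSn ltnS leq_add //; first by apply: h; apply: mem_head.
by apply: IH => y ys; apply: h; rewrite inE ys orbT.
Qed.

Lemma vsize_int b z : sm b z -> (vsize (VInt z) <= b.+1)%N.
Proof. exact: bitlen_sm. Qed.

Lemma vsize_set n (S : {set 'I_n}) : (vsize (enc_set S) <= n * 3 + 1)%N.
Proof.
rewrite -{2}(size_enum_ord n); apply: vsize_vlist => i _; apply: vsize_int.
exact: sm_bool.
Qed.

Lemma vsize_output b n (U : 'I_n -> int) (Ts : seq {set 'I_n}) u :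
  (forall e, sm u (U e)) -> (1 + u + n <= b)%N -> (size Ts <= b)%N ->
  (vsize (enc_sets Ts;; encv U;; enc_keys U Ts) <=
    (b * (b * 3 + 2) + 1 + (b * b.+2 + 1 + (b * b.+2 + 1)).+1).+1)%N.
Proof.
move=> hU ub Tb; have nb : (n <= b)%N by lia.
rewrite /= ltnS leq_add //.
  apply: leq_trans (_ : size Ts * (n * 3 + 1).+1 + 1 <= _)%N.
    by apply: vsize_vlist => T _; apply: vsize_set.
  by rewrite leq_add2r addn1 addn2 leq_mul // !ltnS leq_mul2r nb.
rewrite ltnS leq_add //.
  apply: leq_trans (_ : n * b.+2 + 1 <= _)%N; last by rewrite leq_add2r leq_mul2r nb orbT.
  rewrite -{2}(size_enum_ord n); apply: vsize_vlist => i _.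
  by apply: vsize_int; apply: smW (hU i) _; lia.
apply: leq_trans (_ : size Ts * b.+2 + 1 <= _)%N; last by rewrite leq_add2r leq_mul2r Tb orbT.
apply: vsize_vlist => T _; apply: vsize_int.
apply: (@sm_sumI u.+1) => [e|]; last by lia.
by apply: (@smM 1 u) => //; apply: sm_bool.
Qed.

(** * Counting queries *)

Section Counting.
Variables (R : realType) (k n B : nat) (Aq : 'M[rat]_(k, n)) (w : 'I_n -> int).
Let F := bases (map_mx ratr Aq : 'M[R]_(k, n)).
Let C := num_weights F w.
Hypothesis wB : forall e, `|w e| <= B%:Z.

(** All weights are integers between -n B and n B. *)
Lemma num_weights_le : (C <= 2 * (n * B) + 1)%N.
Proof.
rewrite /C /num_weights; pose s := [seq (i : nat)%:Z - (n * B)%:Z | i <- iota 0 (2 * (n * B) + 1)].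
rewrite -(size_iota 0 (2 * (n * B) + 1)) -(size_map (fun i : nat => i%:Z - (n * B)%:Z)).
apply: uniq_leq_size; first exact: undup_uniq.
move=> x; rewrite mem_undup => /mapP[S _ ->].
have h : `|weight w S| <= (n * B)%:Z.
  apply: le_trans (ler_norm_sum _ _ _) _.
  apply: le_trans (_ : \sum_(e in S) B%:Z <= _); first by apply: ler_sum => e _; apply: wB.
  rewrite sumr_const -mulr_natl natz PoszM ler_wpM2r // lez_nat.
  by apply: leq_trans (max_card _) _; rewrite card_ord.
apply/mapP; exists (absz (weight w S + (n * B)%:Z)); last by lia.
by rewrite mem_iota; lia.
Qed.

(** Two distinct bases have equal size, so each contains an element that the other lacks. This makes
    log(n B) positive whenever queries are charged. *)
Lemma card_bases_gt1 : (1 < #|F|)%N -> (1 < n)%N.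
Proof.
case/card_gt1P => S [T [SF TF ST]].
have card V : V \in F -> #|V| = k by rewrite inE => /andP[_ /eqP].
have sub V W : V \in F -> W \in F -> V != W -> exists2 x, x \in V & x \notin W.
  move=> VF WF VW; apply/subsetPn; apply: contra VW => sVW.
  by rewrite eqEcard sVW (card _ VF) (card _ WF) leqnn.
have TS : T != S by rewrite eq_sym.
have [x xS xT] := sub S T SF TF ST; have [y yT yS] := sub T S TF SF TS.
have xy : x != y by apply: contraNneq yS => <-.
have := max_card (mem [set x; y]); rewrite cards2 xy card_ord.
by [].
Qed.

(** With N = n B >= 2 the constant 16 is the product of two factors 4: n + C <= 3 N + 1 <= 4 N, and
    log C + 1 <= log N + 3 <= 4 log N. For the bound in C the factor 2 suffices, by log C + 1 <= 2
    log(C + 1). *)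
Lemma per_round_bound c : (0 < C)%N -> (16 <= c)%N ->
  query_bound c n B C (per_round R Aq w * (n + C)).
Proof.
move=> C0 c16; rewrite /per_round -/F -/C; split.
  rewrite mulnC; case: ifP => _; first by rewrite muln0.
  have h1 : (trunc_log 2 C <= trunc_log 2 C.+1)%N by apply: leq_trunc_log.
  have h2 : (1 <= trunc_log 2 C.+1)%N by rewrite trunc_log_gt0.
  apply: leq_trans (_ : 2 * ((n + C) * trunc_log 2 C.+1) <= _)%N.
    by rewrite mulnCA leq_mul2l; apply/orP; right; lia.
  by rewrite leq_mul2r; apply/orP; right; lia.
move=> B0; case: ifP => [//|/negbT]; rewrite -ltnNge => /card_bases_gt1 n1.
have := num_weights_le; set N := (n * B)%N => CN.
have nN : (n <= N)%N by rewrite /N leq_pmulr.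
have N2 : (2 <= N)%N by apply: leq_trans nN.
have l1 : (1 <= trunc_log 2 N)%N by rewrite trunc_log_gt0.
have l2 : (trunc_log 2 C <= trunc_log 2 N + 2)%N.
  apply: leq_trans (_ : trunc_log 2 (N.*2.*2) <= _)%N.
    by apply: leq_trunc_log; lia.
  by rewrite !trunc_log2_double ?double_gt0 ?addn2 //; lia.
apply: leq_trans (_ : (4 * trunc_log 2 N) * (4 * N) <= _)%N.
  by apply: leq_mul; lia.
apply: leq_trans (_ : 16 * (N * trunc_log 2 N) <= _)%N; last by rewrite leq_mul2r c16 orbT.
by apply: eq_leq; ring.
Qed.

End Counting.

Lemma run_computes O p x y T Q t : run O [:: x] p y T Q -> (T + vsize y <= t)%N ->
  exists2 q, (q <= Q)%N & computes O p x y t q.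
Proof.
move=> [t0 [q [tT qQ h]]] le_t; exists q => //; exists t0 => //.
by apply: leq_trans le_t; rewrite leq_add2r.
Qed.

Lemma query_bound_le c n B C q q' : (q <= q')%N -> query_bound c n B C q' -> query_bound c n B C q.
Proof.
by move=> qq [h1 h2]; split=> [|B0]; [exact: leq_trans h1|exact: leq_trans (h2 B0)].
Qed.

Definition MIN := Fst (Fst (Call MAIN V0)).

Theorem mainTheorem4 (R : realType) :
  exists (sort_prog rank_prog min_prog : expr) (c : nat),
  forall entry_size : nat -> nat, poly_bounded entry_size ->
  exists2 time : nat -> nat -> nat, poly_bounded2 time &
  forall (n k B : nat) (V : 'M[R]_(k, n)) (A : 'M[rat]_(k, n))
         (w : 'I_n -> int),
    V = map_mx ratr A ->
    \rank V = k ->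
    (forall i j, (rat_size (A i j) <= entry_size n)%N) ->
    (forall e, `|w e| <= B%:Z) ->
    let F := bases V in
    let C := num_weights F w in
    (exists (L : seq {set 'I_n}) (d : tree) (q : nat),
      [/\ computes (comparison F w) sort_prog (enc_mx A)
            (VPair (vlist [seq enc_set T | T <- L]) d) (time n B) q,
          query_bound c n B C q,
          sorted_reps F w L &
          forall S, S \in F ->
            exists i : nat,
              [/\ computes no_oracle rank_prog (VPair d (enc_set S)) (VInt i)
                    (time n B) 0,
                  (i < size L)%N &
                  weight w (nth set0 L i) = weight w S]]) /\
    (exists (S : {set 'I_n}) (q : nat),
      [/\ computes (comparison F w) min_prog (enc_mx A) (enc_set S)
            (time n B) q,
          query_bound c n B C q,
          S \in F &
          forall T, T \in F -> weight w S <= weight w T]).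
Proof.
have [cM pM HM] := MAIN_run; have [cR pR HR] := RANK_run.
(* The programs and the constant are fixed before the entry size; only the time bound depends on
   it. *)
exists MAIN, RANK, MIN, 16%N => entry_size [ce [de es]].
(* [entry_size] may fail to be monotone, so its polynomial majorant, later taken at m = n + B,
   replaces it. *)
pose e1 m := (ce * m.+1 ^ de)%N.
(* The last argument bounds C <= 2 n B + 1, since n B <= m^2. *)
pose b0 m := main_size (e1 m) m m (2 * (m * m) + 1).
pose out b := (b * (b * 3 + 2) + 1 + (b * b.+2 + 1 + (b * b.+2 + 1)).+1).+1.
pose T m := (cM (b0 m) + cR (b0 m) + out (b0 m) + b0 m + 100)%N.
have pe : poly_bounded e1 by exists ce, de.
have pb : poly_bounded b0.
  by apply: main_size_poly => //; poly.
have pT : poly_bounded T by rewrite /T /out; poly.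
exists (fun n B => T (n + B)%N).
  by have [c [d h]] := pT; exists c, d => m l; apply: h.
move=> n k B V A w VE rk hA wB F C; subst V; set m := (n + B)%N.
have kn : (k <= n)%N by rewrite -rk; apply: rank_leq_col.
have nm : (n <= m)%N by apply: leq_addr.
have Bm : (B <= m)%N by apply: leq_addl.
have km : (k <= m)%N := leq_trans kn nm.
have em : (entry_size n <= e1 m)%N.
  apply: leq_trans (es n) _; rewrite /e1 leq_mul2l; apply/orP; right.
  by case: (de) => // d; rewrite leq_exp2r.
have hsz i j := leq_trans (hA i j) em.
have hden i j : sm (e1 m) (denq (A i j)).
  by apply: sm_bitlen; apply: leq_trans (hsz i j); apply: leq_addl.
have hnum i j : sm (e1 m) (numq (A i j)).
  by apply: sm_bitlen; apply: leq_trans (hsz i j); apply: leq_addr.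
have Cm : (C <= 2 * (m * m) + 1)%N.
  apply: leq_trans (num_weights_le R A wB) _.
  by rewrite leq_add2r leq_mul2l leq_mul.
have mb : (main_size (e1 m) n k C <= b0 m)%N by apply: main_size_mono.
have [s [Is cs rs]] := HM R k n A w (e1 m) (b0 m) kn hden hnum mb.
have [LF sL hD _] := Is; have LC : (size (reps s) <= C)%N := size_reps LF sL.
(* Full rank gives a basis; so C > 0, and the final list has a head for [MIN] to return. *)
have [S0 S0F] : exists S, S \in F := bases_neq0 rk.
have C0 : (0 < C)%N.
  have : weight w S0 \in undup [seq weight w T | T in F].
    by rewrite mem_undup; apply/mapP; exists S0; rewrite ?mem_enum.
  by rewrite /C /num_weights; case: (undup _).
have qb := per_round_bound wB C0 (leqnn 16).
have sizes : [/\ n + C + 2 <= b0 m & 1 + key_size n + n <= b0 m]%N.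
  move: mb; rewrite /main_size /round_size; clear.
  generalize (base_size (int_size (e1 m) n k) n k) (e1 m * n)%N (key_size n)
    (radix_size (eq_size n) n) (eq_size n) (test_size (mx_size (e1 m) n k) n k (pmax_of n C) (n * pmax_of n C)).
  generalize ((4 * (int_size (e1 m) n k).+1 + 2 * n + 1) * k)%N (int_size (e1 m) n k)
   (n * pmax_of n C)%N (pmax_of n C) ((n + 2) * (n + 2) * (n + 2))%N.
  by move=> *; split; lia.
have [nCb kb] := sizes.
have hU i : sm (key_size n) (keyf (eqs s) i) := equations_keyw_sm hD i.
have Lb : (size (reps s) < b0 m)%N by clear -LC nCb; lia.
have vo := vsize_output hU kb (ltnW Lb).
have key_w S S' : key (keyf (eqs s)) S = key (keyf (eqs s)) S' -> weight w S = weight w S'.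
  exact: (key_weight hD).
split.
  have [|q qQ hq] := run_computes (t := T m) rs.
    by move: vo; rewrite /T /out; generalize (b0 m * (b0 m * 3 + 2))%N (b0 m * (b0 m).+2)%N; clear; lia.
  exists (reps s), (encv (keyf (eqs s));; enc_keys (keyf (eqs s)) (reps s)), q; split=> //.
  - exact: query_bound_le qQ qb.
  - split=> // S SF; have /mapP[S' S'L e] := cs S SF.
    by apply/mapP; exists S'; rewrite // (key_w _ _ e).
  move=> S SF; set ks := [seq key (keyf (eqs s)) S' | S' <- reps s].
  have iks : (index (key (keyf (eqs s)) S) ks < size ks)%N by rewrite index_mem cs.
  exists (index (key (keyf (eqs s)) S) ks); rewrite -(size_map (key (keyf (eqs s)))).
  have rr := HR no_oracle (key_size n) (b0 m) n (keyf (eqs s)) (reps s) S hU kb Lb.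
  have vi : (vsize (VInt (index (key (keyf (eqs s)) S) ks)) <= (b0 m).+1)%N.
    by apply: vsize_int; apply: sm_nat; apply: ltnW; apply: leq_trans Lb; apply: leq_trans iks _; rewrite size_map.
  have [|q'] := run_computes (t := T m) rr; last first.
    rewrite leqn0 => /eqP -> hr; split=> //.
    apply: key_w; rewrite -(nth_map set0 0 (key (keyf (eqs s)))) ?nth_index ?cs //.
    by rewrite -(size_map (key (keyf (eqs s)))).
  apply: leq_trans (leq_add (leqnn _) vi) _; rewrite /T.
  by generalize (cM (b0 m)) (cR (b0 m)) (out (b0 m)) (b0 m); clear; lia.
have [S' S'L _] := mapP (cs S0 S0F).
have [S1 [L' eL]] : exists S1 L', reps s = S1 :: L'.
  by case: (reps s) S'L => // S1 L' _; exists S1, L'.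
have rm : run (comparison F w) [:: enc_mx A] MIN (enc_set S1)
    (cM (b0 m) + 10) (per_round R A w * (n + C)).
  apply: run_conv.
  - rewrite /MIN; steps; rewrite eL in rs; exact: rs.
  - by [].
  - by clear; lia.
  - by [].
have [|q qQ hq] := run_computes (t := T m) rm.
  move: vo; rewrite /T /out eL /=.
  have := vsize_set S1; move: nCb.
  by generalize (b0 m * (b0 m * 3 + 2))%N (b0 m * (b0 m).+2)%N; clear; lia.
exists S1, q; split=> //.
- exact: query_bound_le qQ qb.
- by apply: LF; rewrite eL mem_head.
(* By completeness each basis shares its key, hence its weight, with a representative, and the head
   of the sorted list is the lightest of these. *)
move=> S SF; have /mapP[S2 S2L /key_w ->] := cs S SF.
move: S2L sL; rewrite eL inE => /orP[/eqP -> //|S2L] /=.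
by move/(order_path_min lt_trans)/allP => /(_ (weight w S2)) h; apply/ltW/h/map_f.
Qed.
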